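(* Let $1<p<\infty$ and suppose that the metric measure space $X=(X,d,\mu)$, with $\mu$ doubling, supports the improved Poincaré inequalities (PI): there are $1<p_0<p$, $C_P>0$ and $\tau\ge1$ such that $X$ supports the $(q,q)$-Poincaré inequality with constants $C_P$ and $\tau$ for every $p_0\le q\le p$. Assume that $E\subset X$ is a uniformly $p$-fat closed set. Then there exist constants $0<\varepsilon<p-p_0$ and $C>0$, depending only on $p$, $p_0$, the doubling constant $C_D$ of $\mu$, $C_P$, $\tau$, and the constant $c_0$ of uniform $p$-fatness of $E$, such that the inequality $$\int_{B(w,\rho)}|u|^{p-\varepsilon}\,d\mu\le C\rho^{p-\varepsilon}\int_{B(w,\tau\rho)}\operatorname{Lip}(u,\cdot)^{p-\varepsilon}\,d\mu$$ holds whenever $w\in E$, $\rho>0$, and $u\in\operatorname{Lip}_0(X\setminus E)$.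
   Context: Setting: $X=(X,d,\mu)$ is a metric space (not assumed to be complete) with metric $d$ and a positive complete Borel measure $\mu$ (extended as a Borel regular outer measure) such that $0<\mu(B(x,r))<\infty$ for all balls $B(x,r)=\{y\in X: d(y,x)<r\}$. For $B=B(x,r)$ and $t>0$, $tB=B(x,tr)$; $\overline{A}$ is the closure of $A$ (so $\overline{B}$ is the closure of the ball $B$). $\mu$ is doubling: there is a constant $C_D\ge 1$ with $\mu(2B)\le C_D\,\mu(B)$ for all balls $B$. Lipschitz functions: $\operatorname{Lip}(X)$ is the set of Lipschitz functions $u\colon X\to\mathbb{R}$, and for $A\subset X$, $\operatorname{Lip}_0(A)=\{u\in\operatorname{Lip}(X): u=0\text{ in }X\setminus A\}$. The upper pointwise Lipschitz constant is $\operatorname{Lip}(u,x)=\limsup_{r\to0}\sup_{y\in B(x,r)}\frac{|u(y)-u(x)|}{r}$. Weak upper gradients: a curve is a nonconstant rectifiable continuous map from a compact interval to $X$. A Borel function $g\ge 0$ on $X$ is an upper gradient of an extended real-valued function $u$ on $X$ if for all curves $\gamma$ joining arbitrary points $x,y\in X$ we have $|u(x)-u(y)|\le\int_\gamma g\,ds$ whenever $u(x),u(y)$ are both finite, and $\int_\gamma g\,ds=\infty$ otherwise. For $1\le p<\infty$, a measurable $g\ge0$ on $X$ is a $p$-weak upper gradient of $u$ if this holds for $p$-almost every curve, i.e. there is a non-negative Borel function $\rho\in L^p(X)$ with $\int_\gamma\rho\,ds=\infty$ for every curve $\gamma$ for which the condition fails. $(q,q)$-Poincaré inequality with constants $C_P$,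 $\tau$: for all balls $B\subset X$, all measurable functions $u$ on $X$ and all $q$-weak upper gradients $g$ of $u$, $$\frac1{\mu(B)}\int_B|u-u_B|^q\,d\mu\le C_P\operatorname{diam}(B)^q\,\frac1{\mu(\tau B)}\int_{\tau B}g^q\,d\mu,$$ where $u_B=\frac1{\mu(B)}\int_B u\,d\mu$ and the left-hand side is interpreted as $\infty$ if $u_B$ is not defined. Capacity: for a bounded open $\Omega\subset X$ and a closed set $K\subset\Omega$, $\operatorname{cap}_p(K,\Omega)=\inf\int_\Omega g^p\,d\mu$, the infimum over all $u\in\operatorname{Lip}_0(\Omega)$ with $u\ge1$ in $K$ and all $p$-weak upper gradients $g$ of $u$ ($=\infty$ if there are no such $u$). Uniform fatness: a closed set $E\subset X$ is uniformly $p$-fat if there is a constant $0<c_0\le1$ such that $\operatorname{cap}_p(E\cap\overline{B(x,r)},B(x,2r))\ge c_0\operatorname{cap}_p(\overline{B(x,r)},B(x,2r))$ for all $x\in E$ and all $0<r<(1/8)\operatorname{diam}(X)$. *)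

(* Defs.v *)
From HB Require Import structures.
From mathcomp Require Import all_boot all_order all_algebra.
From mathcomp Require Import all_classical all_reals all_analysis.
From mathcomp Require Import measurable_realfun.

Set Implicit Arguments.
Unset Strict Implicit.
Unset Printing Implicit Defensive.

Import Order.TTheory GRing.Theory Num.Theory.
Import numFieldNormedType.Exports.

Local Open Scope classical_set_scope.
Local Open Scope ring_scope.
Local Open Scope ereal_scope.

(* Nonempty metric spaces: [measurableType]s are pointed, so a base point is
   needed to equip a metric space with a sigma-algebra. *)
#[short(type="pmetricType")]
HB.structure Definition PointedMetric (K : numDomainType) :=
  {M of Pointed M & Metric K M}.

Section metric.
Context {R : realType} {X : pmetricType R}.
Implicit Types (gamma : R -> X) (a b p : R) (A : set X).

Definition diam A : \bar R :=
  ereal_sup [set (mdist z.1 z.2)%:E | z in A `*` A].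

Definition Lipschitz (u : X -> R) : Prop :=
  exists L : R, forall x y, (`|u x - u y| <= L * mdist x y)%R.

Definition Lip0 A (u : X -> R) : Prop :=
  Lipschitz u /\ (forall x, (~` A) x -> u x = 0%R).

Definition Lip_upper (u : X -> R) (x : X) : \bar R :=
  limf_esup
    (fun r : R => ereal_sup [set (`|u y - u x| / r)%:E | y in ball x r])
    (0%R : R)^'+.

Definition borel_fun (g : X -> \bar R) : Prop :=
  measurable_fun [set: g_sigma_algebraType (@open X)]
    (g : g_sigma_algebraType (@open X) -> \bar R).

(* A path on [a, b] is a total function of which only the restriction to
   [a, b] is relevant. *)
Definition path_length gamma a b : \bar R :=
  ereal_sup [set (let F := gamma \o nth b (a :: s) in
                  \sum_(0 <= n < size s) mdist (F n) (F n.+1))%R%:E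
            | s in itv_partition a b].

Definition curve gamma a b : Prop :=
  [/\ (a <= b)%R,
      {within `[a, b], continuous gamma},
      (exists s t, [/\ s \in `[a, b], t \in `[a, b] & gamma s <> gamma t]) &
      path_length gamma a b < +oo].

(* The arc length parametrization of a curve: its value at [s] is
   [gamma t] for the first [t] at which the length of the arc from [gamma a]
   to [gamma t] reaches [s]. *)
Definition arc_param gamma a b (s : R) : X :=
  gamma (inf [set t : R | t \in `[a, b] /\ s%:E <= path_length gamma a t]).

Definition line_integral gamma a b (g : X -> \bar R) : \bar R :=
  \int[lebesgue_measure]_(s in `[0%R, fine (path_length gamma a b)])
    g (arc_param gamma a b s).

Definition upper_gradient_along gamma a b (u g : X -> \bar R) : Prop :=
  let fin := (u (gamma a) \is a fin_num) && (u (gamma b) \is a fin_num) in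
  (fin -> `|u (gamma a) - u (gamma b)| <= line_integral gamma a b g) /\
  (~~ fin -> line_integral gamma a b g = +oo).

End metric.

Section metric_measure.
Context {R : realType} {X : pmetricType R}.
Implicit Types (mu : {outer_measure set X -> \bar R}) (p q : R) (A : set X).

(* The complete measure on the Caratheodory sigma-algebra of [mu]. *)
Definition cara_measure mu : {measure set (caratheodory_type mu) -> \bar R} :=
  (mu : set (caratheodory_type mu) -> \bar R).

Definition measurable_function mu (u : X -> \bar R) : Prop :=
  measurable_fun [set: caratheodory_type mu]
    (u : caratheodory_type mu -> \bar R).

(* For a Borel regular [mu] which is finite on balls, the Caratheodory
   sigma-algebra is the completion of the Borel one. *)
Definition metric_measure mu : Prop :=
  [/\ <<s @open X >> `<=` mu.-cara.-measurable,
      (forall A, exists B, [/\ <<s @open X >> B, A `<=` B & mu B = mu A]) &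
      (forall (x : X) (r : R), (0 < r)%R -> 0 < mu (ball x r) < +oo)].

Definition doubling mu (CD : R) : Prop :=
  forall (x : X) (r : R), (0 < r)%R ->
    mu (ball x (2 * r)%R) <= CD%:E * mu (ball x r).

(* [g] need not be Borel, so [g] composed with the arc length parametrization
   may fail to be measurable on a family of curves. The integral of a
   nonnegative nonmeasurable function is its lower integral, and for p-almost
   every curve this is the Lebesgue integral. *)
Definition weak_upper_gradient mu p (u g : X -> \bar R) : Prop :=
  [/\ measurable_function mu g,
      (forall x, 0 <= g x) &
      exists rho : X -> \bar R,
        [/\ borel_fun rho,
            (forall x, 0 <= rho x),
            \int[cara_measure mu]_x (rho x `^ p) < +oo &
            forall gamma a b, curve gamma a b ->
              ~ upper_gradient_along gamma a b u g ->
              line_integral gamma a b rho = +oo]].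

Definition average mu A (u : X -> \bar R) : \bar R :=
  (mu A)^-1 * \int[cara_measure mu]_(x in A) u x.

Definition average_defined mu A (u : X -> \bar R) : Prop :=
  \int[cara_measure mu]_(x in A) (u^\+ x) < +oo \/
  \int[cara_measure mu]_(x in A) (u^\- x) < +oo.

Definition oscillation mu q A (u : X -> \bar R) : \bar R :=
  if `[< average_defined mu A u >]
  then average mu A (fun x => `|u x - average mu A u| `^ q)
  else +oo.

Definition poincare mu q (CP tau : R) : Prop :=
  forall (x : X) (r : R), (0 < r)%R ->
  forall u g : X -> \bar R,
    measurable_function mu u -> weak_upper_gradient mu q u g ->
    oscillation mu q (ball x r) u <=
      CP%:E * diam (ball x r) `^ q *
      average mu (ball x (tau * r)%R) (fun y => g y `^ q).

Definition capacity mu p (K Omega : set X) : \bar R :=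
  ereal_inf [set I | exists (u : X -> R) (g : X -> \bar R),
    [/\ Lip0 Omega u,
        (forall x, K x -> (1 <= u x)%R),
        weak_upper_gradient mu p (EFin \o u) g &
        I = \int[cara_measure mu]_(x in Omega) (g x `^ p)]].

Definition uniformly_fat mu p (c0 : R) (E : set X) : Prop :=
  closed E /\
  forall (x : X) (r : R), E x -> (0 < r)%R -> r%:E < 8^-1%:E * diam [set: X] ->
    c0%:E * capacity mu p (closure (ball x r)) (ball x (2 * r)%R) <=
    capacity mu p (E `&` closure (ball x r)) (ball x (2 * r)%R).

End metric_measure.

(* Main.v *)
Require Import Defs.
From HB Require Import structures.
From mathcomp Require Import all_boot all_order all_algebra.
From mathcomp Require Import all_classical all_reals all_analysis.
From mathcomp Require Import measurable_realfun lra ring.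

(** The inequality is first an improvement result: if the claim with exponent
    q = p - eps holds with some constant A, for all centres in E and all radii,
    then it holds with A / 2 + B, where B depends on the data only. Adding a
    constant kappa > 0 to Lip u makes the claim true with the constant
    (L / kappa) ^ q, for a nonnegative L-Lipschitz u, so iteration brings A down
    to 2 B + 1, and kappa tends to 0.

    For the improvement on a ball B(w, 32 rho) the (q, q)-Poincare inequality
    reduces the integral of u ^ q to b ^ q mu(B(w, rho)), where b is the constant
    that u is compared with. Call a point bad at level t if it lies in a ball of
    radius at most 2 rho on which t ^ q times the measure is less than A + 1
    times the integral of g ^ q over the enlarged ball, with g = Lip u + kappa.
    By Vitali's covering lemma the bad set U_t has measure at most a constant
    times (A + 1) t ^ -q times the energy (bad_set_measure). At the other points
    u is Lipschitz with a constant proportional to t, by telescoping over balls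
    with the (q, q)-Poincare inequality, and it is bounded by a multiple of
    t times the distance to any nearby point of E, by the a priori inequality
    (good_lipschitz, good_dist_le). So min(u, b) has a Lipschitz extension from the complement of
    U_t and E whose pointwise Lipschitz constant is at most a multiple of t in
    U_t and, almost everywhere outside, at most g and a multiple of t
    (truncation_extension); the latter rests on density points of closed sets
    (Lip_upper_zero_ae).

    Let h be the mean of these extensions for the levels 2 ^ j T b / rho, j < k,
    and cut max(0, 1 - 2 h / b) off outside B(w, 2 rho). It is 1 on E near w, so
    fatness bounds its p-energy from below by rho ^ -p mu(B(w, rho)), up to a
    constant, since the (p, p)-Poincare inequality gives such a lower bound for
    the capacity of balls (capacity_ball_ge). For the bound from above
    (test_function) the gradients on the bad sets form a dyadic sum, so that
    averaging gains the factor k ^ (1 - p), whereas passing from the exponent q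
    to p costs only (2 ^ k T) ^ eps. The remaining part of the energy comes from
    the points where h < b / 2, which are bad at the lowest level or satisfy
    u < b / 2. The terms that carry A + 1 have the factors k ^ (1 - p) (2 ^ k T)
    ^ eps and T ^ -q, which are small if first T, then k and last eps is chosen
    (improved_const_contracts).

    That Lip u is a weak upper gradient of u (Lip_upper_gradient_along) follows
    from a form of the fundamental theorem of calculus along the arc length
    parametrization, and that a weak upper gradient of a function supported in
    an open set may be cut off outside that set from an analysis of subcurves
    (weak_upper_gradient_restrict). *)

Set Implicit Arguments.
Unset Strict Implicit.
Unset Printing Implicit Defensive.

Import Order.TTheory GRing.Theory Num.Theory.
Import numFieldNormedType.Exports.

Local Open Scope classical_set_scope.
Local Open Scope ring_scope.
Local Open Scope ereal_scope.

(** * Elementary inequalities *)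

Section real_inequalities.
Context {R : realType}.
Implicit Types s t c : R.

Lemma dist_maxr_le c s t : (`|Num.max c s - Num.max c t| <= `|s - t|)%R.
Proof.
have := ler_norm (s - t)%R; have := ler_norm (t - s)%R.
rewrite (distrC t) => h1 h2; rewrite ler_norml.
by case: (leP c s) => ?; case: (leP c t) => ?; apply/andP; split; lra.
Qed.

Lemma dist_minr_le c s t : (`|Num.min s c - Num.min t c| <= `|s - t|)%R.
Proof.
have := ler_norm (s - t)%R; have := ler_norm (t - s)%R.
rewrite (distrC t) => h1 h2; rewrite ler_norml.
by case: (leP s c) => ?; case: (leP t c) => ?; apply/andP; split; lra.
Qed.

Lemma invS_lt c : (0 < c)%R ->
  exists N : nat, forall n, (N <= n)%N -> (n.+1%:R^-1 < c)%R.
Proof.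
move=> c0; exists (Num.truncn c^-1) => n Nn.
rewrite -(invrK c) ltf_pV2 ?posrE ?invr_gt0//.
by rewrite (lt_le_trans (truncnS_gt _))// ler_nat ltnS.
Qed.

Lemma powR_le (q s t : R) : (0 <= q)%R -> (0 <= s)%R -> (s <= t)%R ->
  (s `^ q <= t `^ q)%R.
Proof.
by move=> q0 s0 st; rewrite ge0_ler_powR ?nnegrE// (le_trans s0).
Qed.

End real_inequalities.

(** * The upper pointwise Lipschitz constant *)

Section lip_upper.
Context {R : realType} {X : pmetricType R}.
Implicit Types (u v : X -> R) (x y : X).

Lemma ballP x (r : R) y : ball x r y <-> (mdist x y < r)%R.
Proof. by rewrite ballEmdist. Qed.

Let S u x (r : R) : \bar R :=
  ereal_sup [set (`|u y - u x| / r)%:E | y in ball x r].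

Let S_ge0 u x (r : R) : (0 < r)%R -> 0 <= S u x r.
Proof.
move=> r0; apply: ereal_sup_ubound; exists x; first exact: ballxx.
by rewrite subrr normr0 mul0r.
Qed.

(** The limsup of suprema over whole balls controls the difference quotient at y
    itself, because the radius may be taken just above the distance of y. *)
Lemma Lip_upper_lt u x (c : R) : Lip_upper u x < c%:E ->
  exists2 d : R, (0 < d)%R &
    forall y, (mdist x y < d)%R -> (`|u y - u x| <= c * mdist x y)%R.
Proof.
move=> /ereal_inf_lt[_ [A A0 <-]] Ac.
move: A0 => [/= e e0 Ae].
exists e => // y xy.
apply/ler_addgt0Pr => d d0.
have c0 : (0 <= c)%R.
  rewrite -lee_fin (le_trans _ (ltW Ac))//.
  apply: (le_trans (@S_ge0 u x (e / 2) _)); first by rewrite divr_gt0.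
  apply: ereal_sup_ubound; exists (e / 2)%R => //; apply: Ae => /=.
    by rewrite sub0r normrN gtr0_norm ?divr_gt0// ltr_pdivrMr// ltr_pMr// ltr1n.
  by rewrite divr_gt0.
pose r := Num.min ((e + mdist x y) / 2)%R (mdist x y + d / (c + 1))%R.
have c10 : (0 < c + 1)%R by rewrite ltr_wpDl.
have dxr : (mdist x y < r)%R.
  by rewrite lt_min ltrDl divr_gt0// andbT; lra.
have r0 : (0 < r)%R by rewrite (le_lt_trans _ dxr)// mdist_ge0.
have re : (r < e)%R by rewrite gt_min; apply/orP; left; lra.
have : (`|u y - u x| / r)%:E <= c%:E.
  apply/ltW; apply: le_lt_trans Ac.
  apply: (@le_trans _ _ (S u x r)); last first.
    apply: ereal_sup_ubound; exists r; last reflexivity.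
    by apply: Ae => //=; rewrite sub0r normrN gtr0_norm.
  by apply: ereal_sup_ubound; exists y => //; exact/ballP.
rewrite lee_fin ler_pdivrMr// => /le_trans; apply.
apply: (@le_trans _ _ (c * (mdist x y + d / (c + 1)))%R).
  by rewrite ler_wpM2l// ge_min lexx orbT.
rewrite mulrDr lerD2l mulrA ler_pdivrMr// mulrC ler_wpM2l ?(ltW d0)//.
by rewrite lerDl.
Qed.

Lemma Lip_upper_le u x (c d : R) : (0 <= c)%R -> (0 < d)%R ->
  (forall y, (mdist x y < d)%R -> (`|u y - u x| <= c * mdist x y)%R) ->
  Lip_upper u x <= c%:E.
Proof.
move=> c0 d0 H.
apply: (@le_trans _ _ (ereal_sup (S u x @` [set r | 0 < r < d]%R))).
  apply: ereal_inf_lbound; exists [set r | 0 < r < d]%R => //.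
  exists d => //= r /=; rewrite sub0r normrN => rd r0; rewrite r0/=.
  by rewrite gtr0_norm in rd.
apply: ge_ereal_sup => _ [r /= /andP[r0 rd] <-].
apply: ge_ereal_sup => _ [y /ballP xy <-].
rewrite lee_fin ler_pdivrMr// (le_trans (H _ (lt_trans xy rd)))//.
by rewrite ler_wpM2l// ltW.
Qed.

Lemma Lip_upper_ge0 u x : 0 <= Lip_upper u x.
Proof.
apply: le_ereal_inf_tmp => _ [A [/= e e0 Ae] <-].
apply: (le_trans (@S_ge0 u x (e / 2) _)); first by rewrite divr_gt0.
apply: ereal_sup_ubound; exists (e / 2)%R => //; apply: Ae => /=.
  by rewrite sub0r normrN gtr0_norm ?divr_gt0// ltr_pdivrMr// ltr_pMr// ltr1n.
by rewrite divr_gt0.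
Qed.

Lemma Lipschitz_ge0 u : Lipschitz u ->
  exists2 L : R, (0 < L)%R & forall x y, (`|u x - u y| <= L * mdist x y)%R.
Proof.
move=> [L HL]; exists (`|L| + 1)%R; first by rewrite ltr_wpDl.
move=> x y; rewrite (le_trans (HL x y))// ler_wpM2r ?mdist_ge0//.
by rewrite (le_trans (ler_norm L))// lerDl.
Qed.

Lemma Lip_upper_Lip u (L : R) x : (0 <= L)%R ->
  (forall x y, (`|u x - u y| <= L * mdist x y)%R) -> Lip_upper u x <= L%:E.
Proof.
by move=> L0 uL; apply: (@Lip_upper_le _ _ _ 1) => // y _; rewrite metric_sym.
Qed.

Lemma Lip_upper_fin u x : Lipschitz u -> Lip_upper u x \is a fin_num.
Proof.
move=> /Lipschitz_ge0[L L0 uL]; rewrite ge0_fin_numE ?Lip_upper_ge0//.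
by rewrite (le_lt_trans (Lip_upper_Lip x (ltW L0) uL))// ltry.
Qed.

(** For continuous u, the supremum over a punctured neighbourhood of 0 of the
    difference quotients is lower semicontinuous, which makes Lip_upper u a
    countable infimum of Borel functions. *)
Lemma borel_Lip_upper u : Lipschitz u -> borel_fun (Lip_upper u).
Proof.
move=> /Lipschitz_ge0[L L0 uL].
pose F n x := ereal_sup [set S u x r | r in [set r | 0 < r < n.+1%:R^-1]%R].
have FE : Lip_upper u = fun x => einfs (fun n => F n x) 0%N.
  apply/funext => x; apply/eqP; rewrite eq_le; apply/andP; split.
    apply: le_ereal_inf_tmp => _ [n _ <-]; apply: ereal_inf_lbound.
    exists [set r | 0 < r < n.+1%:R^-1]%R => //.
    exists n.+1%:R^-1%R => //= r /=; rewrite sub0r normrN => rd r0.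
    by rewrite r0/=; rewrite gtr0_norm in rd.
  apply: le_ereal_inf_tmp => _ [A [/= e e0 Ae] <-].
  have [n /(_ _ (leqnn n)) ne] := invS_lt e0.
  apply: (@le_trans _ _ (F n x)).
    by apply: ereal_inf_lbound; exists n.
  apply: ereal_sup_le => _ [r /= /andP[r0 rn] <-]; exists r => //.
  by apply: Ae => //=; rewrite sub0r normrN gtr0_norm// (lt_trans rn).
rewrite FE /borel_fun.
apply: (@measurable_fun_einfs _ (g_sigma_algebraType (@open X)) R) => n.
apply: (measurability _ (ErealGenOInfty.measurableE R)).
move=> /= _ [_ [a ->]] <-; rewrite setTI preimage_itvoy.
apply: sub_sigma_algebra; rewrite openE => x /= /ereal_sup_gt[_ [r /= r1 <-]].
move=> /ereal_sup_gt[_ [y /ballP xy <-]]; rewrite lte_fin => auy.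
have /andP[r0 _] := r1.
pose e : R :=
  Num.min (r - mdist x y)%R ((`|u y - u x| - a * r) / (L + 1))%R.
have L1 : (0 < L + 1)%R by rewrite ltr_wpDl// ltW.
have e0 : (0 < e)%R.
  rewrite lt_min subr_gt0 xy/= divr_gt0// subr_gt0.
  by rewrite -ltr_pdivlMr.
have : nbhs x (ball x e) by exact: nbhsx_ballx.
apply: filterS => z /ballP xz /=.
have zr : (mdist z y < r)%R.
  rewrite (le_lt_trans (metric_triangle _ x _))// -ltrBrDr metric_sym.
  by rewrite (lt_le_trans xz)// ge_min lexx.
apply: (@lt_le_trans _ _ (S u z r)); last first.
  by apply: ereal_sup_ubound; exists r.
apply: (@lt_le_trans _ _ (`|u y - u z| / r)%:E); last first.
  by apply: ereal_sup_ubound; exists y => //; exact/ballP.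
rewrite lte_fin ltr_pdivlMr//.
have h1 : (`|u y - u x| <= `|u y - u z| + L * mdist z x)%R.
  by rewrite -(subrKA (u z))  (le_trans (ler_normD _ _))// lerD2l uL.
have h2 : (mdist x z * (L + 1) < `|u y - u x| - a * r)%R.
  by rewrite -ltr_pdivlMr// (lt_le_trans xz)// ge_min lexx orbT.
have h3 : (0 <= mdist x z)%R by exact: mdist_ge0.
rewrite metric_sym in h1; nra.
Qed.

End lip_upper.

(** * Lengths of paths *)

Section path_length.
Context {R : realType} {X : pmetricType R}.
Variable gamma : R -> X.
Implicit Types (a b e x y : R) (s : seq R).

Let ell := path_length gamma.

Let chain a s : R := 
  (\sum_(0 <= n < size s) mdist (gamma (nth 0 (a :: s) n))
                                (gamma (nth 0 (a :: s) n.+1)))%R.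

Let chain_cons a x s :
  chain a (x :: s) = (mdist (gamma a) (gamma x) + chain x s)%R.
Proof. by rewrite /chain /= big_nat_recl//. Qed.

Let chain_nil a : chain a [::] = 0%R.
Proof. by rewrite /chain big_nil. Qed.

Let chain_cat a s t : chain a (s ++ t) = (chain a s + chain (last a s) t)%R.
Proof.
elim: s a => [|x s IH] a; first by rewrite chain_nil add0r.
by rewrite /= !chain_cons IH addrA.
Qed.

Let ellE a b : ell a b = ereal_sup [set (chain a s)%:E | s in itv_partition a b].
Proof.
rewrite /ell /path_length; congr ereal_sup; apply: eq_imagel => s _ /=.
congr EFin; apply: eq_big_nat => n /andP[_ ns] /=.
congr (mdist (gamma _) (gamma _)); apply: set_nth_default => //=.
by rewrite ltnS ltnW.
Qed.

Let chain_le a b s : itv_partition a b s -> (chain a s)%:E <= ell a b.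
Proof. by move=> abs; rewrite ellE; apply: ereal_sup_ubound; exists s. Qed.

Lemma path_length_dist a b : (a <= b)%R ->
  (mdist (gamma a) (gamma b))%:E <= ell a b.
Proof.
rewrite le_eqVlt => /predU1P[->|ab].
  rewrite mdistxx; apply: (le_trans _ (@chain_le b b [::] _)) => //.
  by rewrite chain_nil.
have := chain_le (itv_partition1 ab).
by rewrite chain_cons chain_nil addr0.
Qed.

Lemma path_length_ge0 a b : (a <= b)%R -> 0 <= ell a b.
Proof.
by move=> /path_length_dist; apply: le_trans; rewrite lee_fin mdist_ge0.
Qed.

Lemma path_lengthxx a : ell a a = 0.
Proof.
apply/eqP; rewrite eq_le path_length_ge0// andbT ellE.
apply: ge_ereal_sup => _ [s /itv_partitionxx -> <-].
by rewrite chain_nil.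
Qed.

(** Lengths of consecutive arcs add up: concatenate partitions in one
    direction, insert the common endpoint in the other. *)
Lemma path_lengthD a e b : (a <= e <= b)%R -> ell a b = ell a e + ell e b.
Proof.
move=> /andP[ae eb]; apply/eqP; rewrite eq_le; apply/andP; split; last first.
  have cat_le s t : itv_partition a e s -> itv_partition e b t ->
      (chain a s)%:E + (chain e t)%:E <= ell a b.
    move=> aes ebt; rewrite -EFinD.
    have /eqP <- : last a s == e by case: aes.
    by rewrite -chain_cat; apply: chain_le; exact: itv_partition_cat ebt.
  have cat_le' s : itv_partition a e s -> (chain a s)%:E + ell e b <= ell a b.
    move=> aes; rewrite -leeBrDl// ellE; apply: ge_ereal_sup => _ [t ebt <-].
    by rewrite leeBrDl//; exact: cat_le.
  have [ebfin|] := boolP (ell e b \is a fin_num).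
    rewrite -leeBrDr// [leLHS]ellE; apply: ge_ereal_sup => _ [s aes <-].
    by rewrite leeBrDr//; exact: cat_le'.
  rewrite ge0_fin_numE ?path_length_ge0// -leNgt leye_eq => /eqP eboo.
  have [s aes] : exists s, itv_partition a e s.
    move: ae; rewrite le_eqVlt => /predU1P[->|ae]; first by exists [::].
    by exists [:: e]; exact: itv_partition1.
  by have := cat_le' _ aes; rewrite eboo addey// leye_eq => /eqP ->; rewrite leey.
rewrite ellE; apply: ge_ereal_sup => _ [s abs <-].
elim: s a ae abs => [|x s IH] a ae abs.
  by rewrite chain_nil adde_ge0// path_length_ge0.
rewrite chain_cons EFinD.
have ax : (a < x)%R by case: abs => /= /andP[].
have xbs := itv_partition_cons abs.
have [xe|ex] := leP x e.
  rewrite (le_trans (leeD2l _ (IH _ xe xbs)))// addeA leeD2r//.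
  rewrite ellE -leeBrDl// ellE; apply: ge_ereal_sup => _ [t xet <-].
  rewrite leeBrDl// -EFinD; apply: ereal_sup_ubound; exists (x :: t).
    split => /=; first by rewrite ax; case: xet.
    by case: xet.
  by rewrite chain_cons.
have ebxs : itv_partition e b (x :: s).
  by split => /=; [rewrite ex; case: xbs|case: xbs].
apply: (@le_trans _ _ ((mdist (gamma a) (gamma e))%:E + (chain e (x :: s))%:E)).
  rewrite chain_cons -!EFinD lee_fin addrA lerD2r.
  exact: metric_triangle.
by apply: leeD; [exact: path_length_dist|exact: chain_le].
Qed.

End path_length.

(** * Integrals of nonmeasurable functions and translations *)

Section lower_integral.
Context d (T : measurableType d) (R : realType).
Variable m : {measure set T -> \bar R}.
Import HBNNSimple.

(** The integral of a nonnegative function is a supremum over simple functions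
    below it, so monotonicity holds without measurability. *)
Lemma integral_le_nonmeasurable (A B : set T) (f g : T -> \bar R) :
  (forall x, A x -> 0 <= f x) -> (forall x, B x -> 0 <= g x) ->
  A `<=` B -> (forall x, A x -> f x <= g x) ->
  \int[m]_(x in A) f x <= \int[m]_(x in B) g x.
Proof.
move=> f0 g0 AB fg; rewrite !ge0_integralE//.
apply: ge_ereal_sup => _ [h /= hf <-]; apply: ereal_sup_ubound; exists h => //=.
move=> x; apply: (le_trans (hf x)); rewrite !patchE.
case: ifPn => xA; last by case: ifPn => //; rewrite inE => /g0.
by rewrite inE in xA; rewrite mem_set ?fg//; exact: AB.
Qed.

End lower_integral.

Section translation.
Context {R : realType}.
Local Notation lam := (@lebesgue_measure R).
Import HBNNSimple.

Lemma lebesgue_measure_translation (c : R) (A : set R) : measurable A ->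
  pushforward lam ((fun x => x + c)%R : R -> measurableTypeR R) A = lam A.
Proof.
move=> mA.
have mc : measurable_fun [set: measurableTypeR R] ((fun x => x + c)%R : R -> measurableTypeR R).
  exact: measurable_funD.
apply/esym/lebesgue_measure_unique => //= _ [[a b]] _ <-.
rewrite /pushforward /=.
rewrite (_ : _ @^-1` _ = `](a - c)%R, (b - c)%R]%classic); last first.
  apply/seteqP; split => x /=; rewrite !in_itv/= => /andP[h1 h2]; apply/andP; split; lra.
rewrite !lebesgue_measure_itv/= !lte_fin ltrD2r.
by case: ifPn => // _; rewrite -!EFinB; congr EFin; lra.
Qed.

(** For a function that may be nonmeasurable: translate the simple functions
    below it. *)
Lemma ge0_integral_translation (c : R) (f : R -> \bar R) :
  (forall x, 0 <= f x) ->
  \int[lam]_x f (x + c)%R <= \int[lam]_x f x.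
Proof.
move=> f0; rewrite [leLHS]ge0_integralTE//.
apply: ge_ereal_sup => _ [h /= hf <-].
have mc : measurable_fun [set: measurableTypeR R] ((fun x => x + c)%R : R -> measurableTypeR R).
  exact: measurable_funD.
have mc' : measurable_fun [set: measurableTypeR R]
    (fun x => (h (x - c)%R)%:E : \bar R).
  apply/measurable_EFinP; apply: measurableT_comp.
    exact: (@measurable_funPT _ _ _ _ h).
  exact: measurable_funD.
rewrite -integralT_nnsfun.
apply: (@le_trans _ _
    (\int[lam]_x ((fun y : R => (h (y - c)%R)%:E) \o (fun x => x + c)%R) x)).
  by apply: integral_le_nonmeasurable => // x _; rewrite /= ?addrK ?lee_fin.
have := @ge0_integral_pushforward _ _ _ _ R _ mc lam setT
  (fun x => (h (x - c)%R)%:E) measurableT mc'.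
rewrite preimage_setT => <-; last by move=> x _; rewrite lee_fin.
rewrite (eq_measure_integral lam); last first.
  by move=> A mA _; exact: lebesgue_measure_translation.
apply: integral_le_nonmeasurable => //.
- by move=> x _; rewrite lee_fin.
- by move=> x _; rewrite (le_trans (hf _))// subrK.
Qed.

Lemma ge0_integral_translation_itv (c l L : R) (f : R -> \bar R) :
  (forall x, 0 <= f x) -> (0 <= c)%R -> (l + c <= L)%R ->
  \int[lam]_(x in `[0%R, l]) f (x + c)%R <= \int[lam]_(x in `[0%R, L]) f x.
Proof.
move=> f0 c0 lL.
rewrite [leLHS]integral_mkcond [leRHS]integral_mkcond.
apply: (le_trans _ (ge0_integral_translation c _)); last first.
  by move=> x; rewrite patchE; case: ifPn.
apply: integral_le_nonmeasurable => //.
- by move=> x _; rewrite patchE; case: ifPn.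
- by move=> x _; rewrite patchE; case: ifPn.
move=> x _; rewrite !patchE; case: ifPn => [|_]; last by case: ifPn.
rewrite inE/= in_itv/= => /andP[x0 xl]; rewrite mem_set//= in_itv/=.
by apply/andP; split; lra.
Qed.

End translation.

(** * Parametrization by arc length *)

Section arc_length.
Context {R : realType} {X : pmetricType R}.

(** A curve without the requirement of being nonconstant: unlike curves, these
    paths are stable under restriction to subintervals. *)
Definition rectifiable_path (gamma : R -> X) (a b : R) : Prop :=
  [/\ (a <= b)%R, {within `[a, b], continuous gamma} &
      path_length gamma a b < +oo].

Lemma curve_rectifiable gamma (a b : R) :
  curve gamma a b -> rectifiable_path gamma a b.
Proof. by case. Qed.

Lemma rectifiable_path_sub gamma (a b c d : R) :
  rectifiable_path gamma a b -> (a <= c)%R -> (c <= d)%R -> (d <= b)%R ->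
  rectifiable_path gamma c d.
Proof.
move=> [ab gc gL] ac cd db; split => //.
  apply: continuous_subspaceW gc => t /=; rewrite !in_itv/= => /andP[ct td].
  by rewrite (le_trans ac)// (le_trans td).
apply: le_lt_trans gL; rewrite (@path_lengthD _ _ _ a c b) ?ac ?(le_trans cd)//.
rewrite (@path_lengthD _ _ _ c d b) ?cd// (le_trans _ (leeDr _ _))//.
  by rewrite leeDl// path_length_ge0.
by rewrite path_length_ge0.
Qed.

Section arc_param.
Variables (gamma : R -> X) (a b : R).
Hypothesis cg : rectifiable_path gamma a b.
Implicit Types (s t e x y : R).

Let ell := path_length gamma.
Let L := fine (ell a b).

Let ab : (a <= b)%R. Proof. by case: cg. Qed.

Lemma curve_length_fin : ell a b = L%:E.
Proof. by rewrite fineK// ge0_fin_numE ?path_length_ge0//; case: cg. Qed.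

Lemma curve_length_ge0 : (0 <= L)%R.
Proof. by rewrite -lee_fin -curve_length_fin path_length_ge0. Qed.

Lemma curve_continuous x e : x \in `[a, b] -> (0 < e)%R ->
  exists2 d : R, (0 < d)%R & forall y, y \in `[a, b] ->
    (`|x - y| < d)%R -> (mdist (gamma x) (gamma y) < e)%R.
Proof.
move=> xab e0; have [_ gc _] := cg.
have := gc x _ (nbhsx_ballx (gamma x) _ e0).
rewrite /= nbhs_simpl/=.
rewrite -[X in X _ -> _](@nbhs_subspace_in _ `[a, b]%classic x)//.
move=> [d /= d0 dP]; exists d => // y yab xyd.
by have /ballP := dP y xyd yab.
Qed.

Let T s := [set t : R | t \in `[a, b] /\ s%:E <= ell a t].

Lemma arc_inf_ge s : (s <= L)%R ->
  let t0 := inf (T s) in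
  [/\ (a <= t0 <= b)%R,
      forall t, (a <= t < t0)%R -> ell a t < s%:E &
      forall d : R, (0 < d)%R -> exists t, [/\ (t0 <= t < t0 + d)%R,
        (t <= b)%R & s%:E <= ell a t]].
Proof.
move=> sL t0.
have lbT : lbound (T s) a by move=> t [+ _]; rewrite in_itv/= => /andP[].
have Tb : T s b.
  by split; [rewrite in_itv/= ab lexx|rewrite curve_length_fin lee_fin].
have infT : has_inf (T s) by split; [exists b|exists a].
have at0 : (a <= t0)%R by apply: lb_le_inf => //; exists b.
have t0T t : T s t -> (t0 <= t)%R by move=> ?; apply: ge_inf => //; case: infT.
split.
- by rewrite at0/= t0T.
- move=> t /andP[at1 tt0]; rewrite ltNge; apply/negP => st.
  suff : (t0 <= t)%R by rewrite leNgt tt0.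
  have t0b := t0T _ Tb; apply: t0T; split => //.
  by rewrite in_itv/= at1 (le_trans (ltW tt0)).
- move=> d d0; have [t Tt ttd] := inf_adherent d0 infT.
  exists t; split; first by rewrite t0T.
    by case: Tt => + _; rewrite in_itv/= => /andP[].
  by case: Tt.
Qed.

Lemma arc_param_in s : (s <= L)%R ->
  exists2 t, (a <= t <= b)%R & arc_param gamma a b s = gamma t.
Proof. by move=> /arc_inf_ge[? _ _]; exists (inf (T s)). Qed.

(** Up to first-hitting times and continuity, the distance of two points of
    the arc is at most the length of the arc joining them. *)
Lemma arc_param_dist s1 s2 : (s1 <= s2)%R -> (s2 <= L)%R ->
  (mdist (arc_param gamma a b s1) (arc_param gamma a b s2) <= s2 - s1)%R.
Proof.
move=> s12 s2L; have s1L := le_trans s12 s2L.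
rewrite /arc_param -!/(ell _) -/(T s1) -/(T s2).
have [/andP[at1 t1b] lt1 ge1] := arc_inf_ge s1L.
have [/andP[at2 t2b] lt2 ge2] := arc_inf_ge s2L.
set t1 := inf (T s1) in at1 t1b lt1 ge1 *.
set t2 := inf (T s2) in at2 t2b lt2 ge2 *.
have [t12|t21] := ltP t1 t2; last first.
  suff -> : t1 = t2 by rewrite mdistxx subr_ge0.
  apply/eqP; rewrite eq_le t21 andbT leNgt; apply/negP => t2t1.
  have [|t [/andP[t2t tt1] tb st]] := ge2 (t1 - t2)%R; first by rewrite subr_gt0.
  rewrite (addrC t2) subrK in tt1.
  have := lt1 t; rewrite (le_trans at2 t2t) tt1 => /(_ isT).
  by rewrite ltNge (le_trans _ st).
apply/ler_addgt0Pr => e e0.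
have e20 : (0 < e / 2)%R by rewrite divr_gt0.
have [||d1 d10 c1] := @curve_continuous t1 (e / 2) => //.
  by rewrite in_itv/= at1.
have [||d2 d20 c2] := @curve_continuous t2 (e / 2) => //.
  by rewrite in_itv/= at2.
have [|t' [/andP[t1t' t'd] t'b st']] := ge1 (Num.min d1 (t2 - t1))%R.
  by rewrite lt_min d10 subr_gt0.
have t't2 : (t' < t2)%R.
  by rewrite (lt_le_trans t'd)// -lerBrDl ge_min lexx orbT.
have t'd1 : (t' < t1 + d1)%R.
  by rewrite (lt_le_trans t'd)// lerD2l ge_min lexx.
pose t'' := Num.max t' (t2 - d2 / 2)%R.
have t't'' : (t' <= t'')%R by rewrite le_max lexx.
have t''t2 : (t'' < t2)%R by rewrite gt_max t't2/= ltrBlDr ltrDl divr_gt0.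
have at' : (a <= t')%R by exact: le_trans t1t'.
have h1 : (mdist (gamma t1) (gamma t') < e / 2)%R.
  apply: c1; first by rewrite in_itv/= at'.
  by rewrite distrC ger0_norm ?subr_ge0// ltrBlDl.
have h2 : (mdist (gamma t2) (gamma t'') < e / 2)%R.
  apply: c2; first by rewrite in_itv/= (le_trans at')// (le_trans (ltW t''t2)).
  rewrite gtr0_norm ?subr_gt0//.
  have : (t2 - d2 / 2 <= t'')%R by rewrite le_max lexx orbT.
  by lra.
have h3 : (mdist (gamma t') (gamma t'') <= s2 - s1)%R.
  rewrite lerBrDl -lee_fin EFinD.
  apply: (@le_trans _ _ (ell a t' + ell t' t'')).
    by apply: leeD => //; exact: path_length_dist.
  rewrite /ell -path_lengthD ?at'//; apply/ltW; apply: lt2.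
  by rewrite (le_trans at').
have := metric_triangle (gamma t1) (gamma t') (gamma t2).
have := metric_triangle (gamma t') (gamma t'') (gamma t2).
rewrite (metric_sym (gamma t'') (gamma t2)); lra.
Qed.

Lemma arc_param0 : arc_param gamma a b 0 = gamma a.
Proof.
rewrite /arc_param -/(ell _) -/(T 0); congr gamma.
have [/andP[at0 _] lt0 _] := arc_inf_ge curve_length_ge0.
apply/eqP; rewrite eq_le at0 andbT leNgt; apply/negP => t0a.
by have := lt0 a; rewrite lexx t0a => /(_ isT); rewrite /ell path_lengthxx ltxx.
Qed.

Lemma arc_param_length : arc_param gamma a b L = gamma b.
Proof.
apply: mdist_positivity; apply/eqP; rewrite eq_le mdist_ge0 andbT.
rewrite /arc_param -/(ell _) -/(T L).
have [/andP[at0 t0b] _ ge0] := arc_inf_ge (lexx L).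
apply/ler_addgt0Pr => e e0; rewrite add0r.
have [||d d0 c] := @curve_continuous (inf (T L)) e => //.
  by rewrite in_itv/= at0.
have [t [/andP[t0t td] tb Lt]] := ge0 _ d0.
have at1 : (a <= t)%R by exact: le_trans t0t.
have : (mdist (gamma t) (gamma b) <= 0)%R.
  rewrite -(lerD2l L) addr0 -lee_fin EFinD -curve_length_fin.
  rewrite {2}/ell (@path_lengthD _ _ _ a t b) ?at1//.
  by apply: leeD; [rewrite curve_length_fin|exact: path_length_dist].
have := c t; rewrite in_itv/= at1 tb => /(_ isT).
rewrite distrC ger0_norm ?subr_ge0// ltrBlDl => /(_ td).
have := metric_triangle (gamma (inf (T L))) (gamma t) (gamma b); lra.
Qed.

Lemma arc_param_head e s : (a <= e <= b)%R -> s%:E <= ell a e ->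
  arc_param gamma a e s = arc_param gamma a b s.
Proof.
move=> /andP[ae eb] se; rewrite /arc_param; congr gamma.
have aeb : ell a e <= ell a b.
  by rewrite /ell (@path_lengthD _ _ _ a e b) ?ae// leeDl// path_length_ge0.
have sL : (s <= L)%R by rewrite -lee_fin -curve_length_fin (le_trans se).
have [/andP[at0 t0b] _ ge0] := arc_inf_ge sL.
have Te : T s e by split => //; rewrite in_itv/= ae.
set T' := [set t : R | t \in `[a, e] /\ s%:E <= path_length gamma a t].
have T'e : T' e by split => //; rewrite in_itv/= ae lexx.
have T'T : T' `<=` T s.
  move=> t [+ st]; rewrite in_itv/= => /andP[h1 h2]; split => //.
  by rewrite in_itv/= h1 (le_trans h2).
have lbT : has_lbound (T s).
  by exists a => t [+ _]; rewrite in_itv/= => /andP[].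
have lbT' : has_lbound T' by case: lbT => x h; exists x => t /T'T; exact: h.
apply/eqP; rewrite eq_le; apply/andP; split; last first.
  by apply: lb_le_inf; [exists e|move=> t /T'T; exact: ge_inf].
apply: lb_le_inf; [by exists e|move=> t Tt].
have [te|et] := leP t e.
  apply: ge_inf => //; case: Tt => + st; rewrite in_itv/= => /andP[h1 h2].
  by split => //; rewrite in_itv/= h1.
by rewrite (le_trans _ (ltW et))//; apply: ge_inf.
Qed.

End arc_param.

Lemma arc_param_tail gamma a b e s : rectifiable_path gamma a b ->
  (a <= e <= b)%R -> (0 <= s)%R ->
  arc_param gamma e b s =
  arc_param gamma a b (s + fine (path_length gamma a e))%R.
Proof.
move=> cg /andP[ae eb].
have cae := rectifiable_path_sub cg (lexx a) ae eb.
have ceb := rectifiable_path_sub cg ae eb (lexx b).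
rewrite le_eqVlt => /predU1P[<-|s0].
  rewrite add0r (arc_param0 ceb) -(@arc_param_head _ a b cg e) ?ae//.
    by rewrite (arc_param_length cae).
  by rewrite (curve_length_fin cae).
have aefin : path_length gamma a e \is a fin_num.
  by rewrite (curve_length_fin cae).
rewrite /arc_param; congr (gamma (inf _)).
apply/seteqP; split => t [] /=; rewrite !in_itv/= => /andP[h1 h2] st.
  split; first by rewrite (le_trans ae).
  rewrite (@path_lengthD _ _ _ a e t) ?ae// addeC EFinD fineK//.
  by apply: leeD.
have et : (e <= t)%R.
  rewrite leNgt; apply/negP => te; move: st.
  rewrite EFinD fineK// leNgt => /negP; apply.
  apply: (@le_lt_trans _ _ (path_length gamma a e)).
    rewrite (@path_lengthD _ _ gamma a t e) ?h1 ?(ltW te)// leeDl//.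
    by rewrite path_length_ge0// ltW.
  by rewrite lteDr// lte_fin.
split; first by rewrite et.
move: st; rewrite (@path_lengthD _ _ _ a e t) ?ae// EFinD fineK//.
by rewrite addeC leeD2lE.
Qed.

End arc_length.

(** * The pointwise Lipschitz constant as an upper gradient *)

Section lipschitz_line.
Context {R : realType}.
Local Notation lam := (@lebesgue_measure R).
Variables (k : R -> R) (M L : R).
Hypotheses (M0 : (0 < M)%R) (L0 : (0 <= L)%R).
Hypothesis kM : forall s t, (`|k s - k t| <= M * `|s - t|)%R.
Hypothesis kL : forall s, (L <= s)%R -> k s = k L.

Let mk : measurable_fun [set: R] k.
Proof.
apply: continuous_measurable_fun => s; apply/cvgrPdist_lt => e e0.
near=> t; rewrite (le_lt_trans (kM _ _))// mulrC -ltr_pdivlMr//.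
near: t; apply: cvgr_dist_lt; [exact: cvg_id|exact: divr_gt0].
Unshelve. all: by end_near. Qed.

Let F (d : R) s : \bar R := (`|k (s + d) - k s| / d)%:E.

Let mF (d : R) : measurable_fun [set: R] (F d).
Proof.
apply/measurable_EFinP; apply: measurable_funM => //.
apply: measurableT_comp => //; apply: measurable_funB => //.
by apply: measurableT_comp => //; exact: measurable_funD.
Qed.

Let F_ge0 (d : R) s : (0 < d)%R -> 0 <= F d s.
Proof. by move=> d0; rewrite lee_fin divr_ge0// ltW. Qed.

Let F_le (d : R) s : (0 < d)%R -> F d s <= M%:E.
Proof.
move=> d0; rewrite lee_fin ler_pdivrMr// (le_trans (kM _ _))//.
by rewrite addrAC subrr add0r gtr0_norm.
Qed.

(** Translating the integral of k shows that the mean of its difference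
    quotients over [0, L] is the difference of its means over two intervals of
    length d, one at each end. *)
Let increment_le (d : R) : (0 < d)%R ->
  (k L - k 0 - M * d)%:E <= \int[lam]_(s in `[0%R, L]) F d s.
Proof.
move=> d0; pose C : R := (`|k 0| + M * (L + d))%R.
pose K s := (k s + C)%:E.
have mK : measurable_fun [set: R] K.
  by apply/measurable_EFinP; exact: measurable_funD.
have K0 (s : R) : (0 <= s <= L + d)%R -> 0 <= K s.
  move=> /andP[s0 sL]; rewrite lee_fin /C.
  have := kM 0 s; rewrite sub0r normrN (ger0_norm s0) => h1.
  have h2 := ler_norm (k 0 - k s)%R; have h3 := ler_norm (- k 0)%R.
  rewrite normrN in h3.
  have h4 : (M * s <= M * (L + d))%R by rewrite ler_wpM2l// ltW.
  lra.
have sum_eq : \int[lam]_(s in `[0%R, d[) K s + \int[lam]_(s in `[d, (L + d)%R]) K s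
    = \int[lam]_(s in `[0%R, L[) K s + \int[lam]_(s in `[L, (L + d)%R]) K s.
  have U1 : `[0%R, d[%classic `|` `[d, (L + d)%R] = `[0%R, (L + d)%R]%classic.
    by rewrite -itv_bndbnd_setU// bnd_simp ?(ltW d0)// lerDr.
  have U2 : `[0%R, L[%classic `|` `[L, (L + d)%R] = `[0%R, (L + d)%R]%classic.
    by rewrite -itv_bndbnd_setU// bnd_simp// lerDl ltW.
  have dis (e f : R) : [disjoint `[0%R, e[%classic & `[e, f]%classic].
    apply/disj_setPS => s [] /=; rewrite !in_itv/= => /andP[_ h1] /andP[h2 _].
    by rewrite ltNge h2 in h1.
  have K0' s : `[0%R, (L + d)%R]%classic s -> 0 <= K s.
    by rewrite /= in_itv/=; exact: K0.
  by rewrite -!ge0_integral_setU// ?U1 ?U2//; exact: measurable_funS mK.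
have kC0 : (0 <= k 0 + C)%R.
  by rewrite -lee_fin; apply: K0; rewrite lexx addr_ge0// ltW.
have h1 : \int[lam]_(s in `[0%R, d[) K s <= ((k 0 + C + M * d) * d)%:E.
  apply: (@le_trans _ _ (\int[lam]_(s in `[0%R, d[) (k 0 + C + M * d)%:E)).
    apply: integral_le_nonmeasurable => //=.
    - move=> s; rewrite in_itv/= => /andP[s0 sd]; apply: K0.
      by rewrite s0 (le_trans (ltW sd))// lerDr.
    - move=> s _; rewrite lee_fin; apply: addr_ge0.
        exact: kC0.
      by rewrite mulr_ge0// ltW.
    - move=> s; rewrite in_itv/= => /andP[s0 sd]; rewrite lee_fin.
      have := kM s 0; rewrite subr0 (ger0_norm s0) => h.
      have h2 := ler_norm (k s - k 0)%R.
      have h4 : (M * s <= M * d)%R by rewrite ler_wpM2l// ltW.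
      lra.
  rewrite integral_cst//= lebesgue_measure_itv/= lte_fin d0 -EFinD -EFinM.
  by rewrite subr0.
have h2 : \int[lam]_(s in `[L, (L + d)%R]) K s = ((k L + C) * d)%:E.
  rewrite (eq_integral (cst (k L + C)%:E)).
    rewrite integral_cst//= lebesgue_measure_itv/= lte_fin ltrDl d0 -EFinD.
    by rewrite -EFinM (addrC L) addrK.
  by move=> s; rewrite inE/= in_itv/= => /andP[Ls _]; rewrite /K kL.
have h3 : \int[lam]_(s in `[d, (L + d)%R]) K s <=
    \int[lam]_(s in `[0%R, L]) K s + d%:E * \int[lam]_(s in `[0%R, L]) F d s.
  rewrite -ge0_integralZl//; last 3 first.
  - exact: measurable_funS (mF d).
  - by move=> s _; exact: F_ge0.
  - by rewrite lee_fin ltW.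
  rewrite -ge0_integralD//; last 4 first.
  - move=> s /=; rewrite in_itv/= => /andP[s0 sL]; apply: K0.
    by rewrite s0 (le_trans sL)// lerDl ltW.
  - exact: measurable_funS mK.
  - by move=> s _; rewrite mule_ge0 ?F_ge0// lee_fin ltW.
  - by apply: measurable_funeM; exact: measurable_funS (mF d).
  rewrite [leLHS]integral_mkcond.
  pose G := (fun s => K (s + d)%R) \_ `[0%R, L].
  have G0 s : 0 <= G s.
    rewrite /G patchE; case: ifPn => //; rewrite inE/= in_itv/= => /andP[s0 sL].
    by apply: K0; rewrite addr_ge0 ?(ltW d0)//= lerD2r.
  apply: (@le_trans _ _ (\int[lam]_x G (x + (- d))%R)).
    apply: integral_le_nonmeasurable => //.
    - move=> s _; rewrite patchE; case: ifPn => //; rewrite inE/= in_itv/=.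
      move=> /andP[ds sL]; apply: K0; rewrite sL andbT.
      exact: le_trans (ltW d0) ds.
    - move=> s _; rewrite /G !patchE; case: ifPn => [|_]; last first.
        by have := G0 (s - d)%R; rewrite /G patchE.
      rewrite inE/= in_itv/= => /andP[ds sL].
      by rewrite mem_set ?subrK//= in_itv/= subr_ge0 ds lerBlDr.
  apply: (le_trans (ge0_integral_translation _ G0)).
  rewrite /G -integral_mkcond; apply: integral_le_nonmeasurable => //=.
  - move=> s; rewrite in_itv/= => /andP[s0 sL]; apply: K0.
    by rewrite addr_ge0 ?(ltW d0)//= lerD2r.
  - move=> s; rewrite in_itv/= => /andP[s0 sL]; rewrite adde_ge0 ?K0//.
      by rewrite s0 (le_trans sL)// lerDl ltW.
    by rewrite mule_ge0 ?F_ge0// lee_fin ltW.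
  - move=> s; rewrite in_itv/= => /andP[s0 sL].
    rewrite -EFinM -EFinD lee_fin [leRHS]addrAC lerD2r mulrCA divff ?gt_eqF//.
    by rewrite mulr1 -lerBlDl ler_norm.
have KL : \int[lam]_(s in `[0%R, L[) K s = \int[lam]_(s in `[0%R, L]) K s.
  by apply: integral_itv_bndo_bndc; exact: measurable_funS mK.
have Kfin : \int[lam]_(s in `[0%R, L]) K s \is a fin_num.
  rewrite ge0_fin_numE; last first.
    apply: integral_ge0 => s /=; rewrite in_itv/= => /andP[s0 sL]; apply: K0.
    by rewrite s0 (le_trans sL)// lerDl ltW.
  apply: (@le_lt_trans _ _ (\int[lam]_(s in `[0%R, L]) (k 0 + C + M * L)%:E)).
    apply: integral_le_nonmeasurable => //=.
    - move=> s; rewrite in_itv/= => /andP[s0 sd]; apply: K0.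
      by rewrite s0 (le_trans sd)// lerDl ltW.
    - move=> s _; rewrite lee_fin; apply: addr_ge0.
        exact: kC0.
      by rewrite mulr_ge0// ltW.
    - move=> s; rewrite in_itv/= => /andP[s0 sd]; rewrite lee_fin.
      have := kM s 0; rewrite subr0 (ger0_norm s0) => h.
      have h5 := ler_norm (k s - k 0)%R.
      have h4 : (M * s <= M * L)%R by rewrite ler_wpM2l// ltW.
      lra.
  rewrite integral_cst//= lebesgue_measure_itv/= lte_fin.
  by case: ifPn => _; rewrite -?EFinD -?EFinM ?mule0 ltry.
have F0 : 0 <= \int[lam]_(s in `[0%R, L]) F d s.
  by apply: integral_ge0 => s _; exact: F_ge0.
move: (F0); rewrite le_eqVlt; rewrite le_eqVlt in F0.
have : \int[lam]_(s in `[0%R, L]) K s + ((k L + C) * d)%:E <=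
   ((k 0 + C + M * d) * d)%:E +
   (\int[lam]_(s in `[0%R, L]) K s + d%:E * \int[lam]_(s in `[0%R, L]) F d s).
  by rewrite -KL -h2 -sum_eq; rewrite KL; exact: leeD.
rewrite -(fineK Kfin); case: (\int[lam]_(s in `[0%R, L]) F d s) F0 => [r||] // _.
  rewrite -EFinM -!EFinD !lee_fin => h _.
  rewrite -(ler_pM2l d0); nra.
by rewrite leey.
Qed.

(** The fundamental theorem of calculus with an upper limit of difference
    quotients in place of the derivative: let d tend to 0 and apply dominated
    convergence to the suprema of the tails of the difference quotients. *)
Lemma lipschitz_increment_le :
  (k L - k 0)%:E <= \int[lam]_(s in `[0%R, L])
    limn_esup (fun n => (`|k (s + n.+1%:R^-1) - k s| / n.+1%:R^-1)%:E).
Proof.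
pose Fn n s := F n.+1%:R^-1 s.
pose G n s := esups (Fn ^~ s) n.
have G0 n s : 0 <= G n s.
  by apply: (@le_trans _ _ (Fn n s));
    [exact: F_ge0|apply: ereal_sup_ubound; exists n => /=].
have GM n s : G n s <= M%:E by apply: ge_ereal_sup => _ [m _ <-]; exact: F_le.
have mFn n : measurable_fun `[0%R, L] (Fn n).
  by apply: (measurable_funS _ (@subsetT _ _)) => //; exact: mF.
have mG n : measurable_fun `[0%R, L] (G n).
  exact: (measurable_fun_esups mFn).
have := @dominated_cvg _ _ _ lam `[0%R, L]%classic (measurable_itv _) G
  (fun s => limn_esup (Fn ^~ s)) (cst M%:E) mG.
move=> /(_ _ _ _ _)/cvg_lim <- //; last 3 first.
- by move=> s _; rewrite limn_esup_lim; exact: is_cvg_esups.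
- apply/integrableP; split; first exact: measurable_cst.
  rewrite (eq_integral (cst M%:E)); last by move=> s _ /=; rewrite gtr0_norm.
  rewrite integral_cst//= lebesgue_measure_itv/=.
  by case: ifPn => _; rewrite ?mule0// -EFinB -EFinM ltry.
- by move=> n s _; rewrite gee0_abs.
apply/lee_addgt0Pr => e e0; rewrite -leeBlDr//.
apply: lime_ge.
  apply: ereal_nonincreasing_is_cvgn => m n mn.
  apply: integral_le_nonmeasurable => // s _.
  exact: nonincreasing_esups.
near=> n.
have nM : (M * n.+1%:R^-1 <= e)%R.
  rewrite -ler_pdivlMl// mulrC ltW//; near: n.
  by have [N Ne] := invS_lt (divr_gt0 e0 M0); exists N.
apply: (@le_trans _ _ (\int[lam]_(s in `[0%R, L]) Fn n s)).
  apply: (le_trans _ (@increment_le n.+1%:R^-1 _)) => //.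
  by rewrite -EFinB lee_fin lerB.
apply: integral_le_nonmeasurable => // [s _|s _]; first exact: F_ge0.
by apply: ereal_sup_ubound; exists n => /=.
Unshelve. all: by end_near. Qed.

End lipschitz_line.

Section lip_upper_gradient.
Context {R : realType} {X : pmetricType R}.
Local Notation lam := (@lebesgue_measure R).

Let Lip_upper_along_le (gamma : R -> X) (a b : R) (u : X -> R) :
  Lipschitz u -> rectifiable_path gamma a b ->
  (u (gamma b) - u (gamma a))%:E <= line_integral gamma a b (Lip_upper u).
Proof.
move=> /Lipschitz_ge0[M M0 uM] cg.
rewrite /line_integral; set L := fine (path_length gamma a b).
pose arc := arc_param gamma a b.
pose clip (s : R) : R := Num.min (Num.max 0%R s) L.
have L0 : (0 <= L)%R := curve_length_ge0 cg.
have clip01 (s : R) : (0 <= clip s <= L)%R.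
  by rewrite /clip le_min le_max lexx L0/= ge_min lexx orbT.
have clipE (s : R) : (0 <= s <= L)%R -> clip s = s.
  by move=> /andP[s0 sL]; rewrite /clip max_r// min_l.
have clip_dist (s t : R) : (`|clip s - clip t| <= `|s - t|)%R.
  by rewrite (le_trans (dist_minr_le _ _ _))// dist_maxr_le.
have arc_dist (s t : R) : (0 <= s <= L)%R -> (0 <= t <= L)%R ->
    (mdist (arc s) (arc t) <= `|s - t|)%R.
  move=> /andP[s0 sL] /andP[t0 tL]; have [st|ts] := leP s t.
    by rewrite distrC ger0_norm ?subr_ge0//; exact: arc_param_dist.
  by rewrite metric_sym gtr0_norm ?subr_gt0//; apply: arc_param_dist => //; exact: ltW.
pose k s := u (arc (clip s)).
have kM s t : (`|k s - k t| <= M * `|s - t|)%R.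
  rewrite (le_trans (uM _ _))// ler_wpM2l ?(ltW M0)//.
  by apply: le_trans (clip_dist s t); exact: arc_dist.
have kL s : (L <= s)%R -> k s = k L.
  move=> Ls; rewrite /k; congr (u (arc _)).
  by rewrite (clipE L) ?L0 ?lexx// /clip max_r ?(le_trans L0)// min_r.
have := lipschitz_increment_le M0 L0 kM kL.
rewrite {1}/k clipE ?L0 ?lexx// /arc (arc_param_length cg).
rewrite {1}/k clipE ?L0 ?lexx// /arc (arc_param0 cg) => /le_trans; apply.
apply: integral_le_nonmeasurable => //.
- move=> s _; apply: limf_esup_ge0 => [|n]; last by rewrite lee_fin.
  exact: filter_not_empty.
- by move=> s _; exact: Lip_upper_ge0.
move=> s /=; rewrite in_itv/= => s0L.
have uL : Lipschitz u by exists M.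
apply/lee_addgt0Pr => e e0.
rewrite -(fineK (Lip_upper_fin (arc s) uL)) -EFinD; set c := (fine _ + e)%R.
have : Lip_upper u (arc s) < c%:E.
  by rewrite -(fineK (Lip_upper_fin (arc s) uL)) lte_fin ltrDl.
have c0 : (0 <= c)%R by rewrite addr_ge0 ?(ltW e0)// fine_ge0// Lip_upper_ge0.
move=> /Lip_upper_lt[d d0 dP].
have [N Nd] := invS_lt d0.
apply: (@le_trans _ _ (ereal_sup
    [set (`|k (s + n.+1%:R^-1) - k s| / n.+1%:R^-1)%:E | n in [set n | N <= n]%N])).
  by apply: ereal_inf_lbound; exists [set n | N <= n]%N => //; exists N.
apply: ge_ereal_sup => _ [n /= Nn <-]; rewrite lee_fin ler_pdivrMr//.
have n0 : (0 < n.+1%:R^-1 :> R)%R by [].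
have /arc_dist : (0 <= clip s <= L)%R by [].
move=> /(_ _ (clip01 (s + n.+1%:R^-1)%R)) h.
have {}h : (mdist (arc (clip s)) (arc (clip (s + n.+1%:R^-1))) <= n.+1%:R^-1)%R.
  rewrite (le_trans h)// (le_trans (clip_dist _ _))//.
  by rewrite opprD addrA subrr sub0r normrN gtr0_norm.
rewrite /k (clipE s)// in h *.
by rewrite (le_trans (dP _ (le_lt_trans h (Nd _ Nn))))// ler_wpM2l.
Qed.

(** Along the arc length parametrization the difference quotients of u are at
    most those of u as a function on X, since arcs are at least as long as the
    distance of their ends. *)
Lemma Lip_upper_gradient_along (gamma : R -> X) (a b : R) (u : X -> R) :
  Lipschitz u -> curve gamma a b ->
  upper_gradient_along gamma a b (EFin \o u) (Lip_upper u).
Proof.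
move=> uL /curve_rectifiable cg; split => //= _.
rewrite distrC.
have [ab|ba] := leP (u (gamma a)) (u (gamma b)).
  by rewrite ger0_norm ?subr_ge0//; exact: Lip_upper_along_le.
rewrite ltr0_norm ?subr_lt0// opprB.
have uN : Lipschitz (fun x => - u x)%R.
  by case: uL => M uM; exists M => x y; rewrite -opprD normrN.
have := Lip_upper_along_le uN cg; rewrite opprK addrC => /le_trans; apply.
apply: integral_le_nonmeasurable => // s _.
- exact: Lip_upper_ge0.
- exact: Lip_upper_ge0.
rewrite le_eqVlt; apply/orP; left; apply/eqP; congr limf_esup.
apply/funext => r; congr ereal_sup; apply: eq_imagel => y _.
by rewrite -opprD normrN.
Qed.

End lip_upper_gradient.

(** * Weak upper gradients and their restriction to open sets *)

Section subcurves.
Context {R : realType} {X : pmetricType R}.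
Implicit Types (gamma : R -> X) (a b c d e : R) (F : X -> \bar R).

Lemma line_integral_le gamma a b F G : rectifiable_path gamma a b ->
  (forall x, 0 <= F x) -> (forall x, 0 <= G x) ->
  (forall t, (a <= t <= b)%R -> F (gamma t) <= G (gamma t)) ->
  line_integral gamma a b F <= line_integral gamma a b G.
Proof.
move=> cg F0 G0 FG; apply: integral_le_nonmeasurable => // s /=.
rewrite in_itv/= => /andP[s0 sL].
by have [t tab ->] := arc_param_in cg sL; exact: FG.
Qed.

Lemma line_integral_head gamma a b e F : rectifiable_path gamma a b ->
  (forall x, 0 <= F x) -> (a <= e <= b)%R ->
  line_integral gamma a e F <= line_integral gamma a b F.
Proof.
move=> cg F0 /andP[ae eb].
have cae := rectifiable_path_sub cg (lexx a) ae eb.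
have h : (fine (path_length gamma a e) <= fine (path_length gamma a b))%R.
  rewrite -lee_fin -(curve_length_fin cg) -(curve_length_fin cae).
  by rewrite (@path_lengthD _ _ _ a e b) ?ae// leeDl// path_length_ge0.
apply: integral_le_nonmeasurable => // s /=; rewrite !in_itv/= => /andP[s0 se].
  by rewrite s0 (le_trans se).
rewrite (@arc_param_head _ _ _ a b cg e s) ?ae//.
by rewrite (curve_length_fin cae) lee_fin.
Qed.

Lemma line_integral_tail gamma a b e F : rectifiable_path gamma a b ->
  (forall x, 0 <= F x) -> (a <= e <= b)%R ->
  line_integral gamma e b F <= line_integral gamma a b F.
Proof.
move=> cg F0 /andP[ae eb].
have cae := rectifiable_path_sub cg (lexx a) ae eb.
have ceb := rectifiable_path_sub cg ae eb (lexx b).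
rewrite /line_integral.
set l := fine (path_length gamma e b); set L := fine (path_length gamma a b).
have lL : (l + fine (path_length gamma a e) = L)%R.
  apply: EFin_inj; rewrite EFinD -(curve_length_fin cg) -(curve_length_fin ceb).
  rewrite -(curve_length_fin cae) addeC (@path_lengthD _ _ _ a e b) ?ae//.
have c0 := curve_length_ge0 cae.
have FA0 s : 0 <= (F \o arc_param gamma a b) s by exact: F0.
have lL' : (l + fine (path_length gamma a e) <= L)%R by rewrite lL.
apply: (le_trans _ (ge0_integral_translation_itv FA0 c0 lL')).
apply: integral_le_nonmeasurable => [s _|s _|//|s /=]; [exact: F0|exact: F0|].
by rewrite in_itv/= => /andP[s0 _]; rewrite (arc_param_tail cg) ?ae.
Qed.

End subcurves.

Section weak_upper_gradients.
Context {R : realType} {X : pmetricType R}.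
Implicit Types (mu : {outer_measure set X -> \bar R}) (u f : X -> R)
  (g : X -> \bar R).

Lemma open_caratheodory mu (U : set X) : metric_measure mu -> open U ->
  mu.-cara.-measurable U.
Proof. by move=> [h _ _] oU; apply: h; exact: sub_sigma_algebra. Qed.

Lemma borel_measurable_function mu g : metric_measure mu -> borel_fun g ->
  measurable_function mu g.
Proof.
move=> [h _ _] bg _ B mB; have := bg measurableT B mB.
by rewrite !setTI => ?; exact: h.
Qed.

(** No curve is exceptional, so rho = 0 serves. *)
Lemma Lip_upper_weak_upper_gradient mu p u : metric_measure mu ->
  (0 < p)%R -> Lipschitz u ->
  weak_upper_gradient mu p (EFin \o u) (Lip_upper u).
Proof.
move=> mmu p0 uL; split.
- by apply: borel_measurable_function => //; exact: borel_Lip_upper.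
- by move=> x; exact: Lip_upper_ge0.
exists (cst 0); split => //.
- exact: measurable_cst.
- rewrite (eq_integral (cst 0)) ?integral0// => x _ /=.
  by rewrite powR0// gt_eqF.
- by move=> gamma a b cg; have := Lip_upper_gradient_along uL cg.
Qed.

Lemma weak_upper_gradient_contraction mu p f g (phi : R -> R) :
  (forall s t, (`|phi s - phi t| <= `|s - t|)%R) ->
  weak_upper_gradient mu p (EFin \o f) g ->
  weak_upper_gradient mu p (EFin \o (phi \o f)) g.
Proof.
move=> phi1 [mg g0 [rho [brho rho0 rhofin rhog]]]; split => //.
exists rho; split => // gamma a b cg nug; apply: rhog => // -[h _].
apply: nug; split => //= _; apply: le_trans (h _) => //.
by rewrite lee_fin.
Qed.

(** A curve joining two points along which f is nonzero and which meets the
    complement of Omega is cut shortly before its first exit and shortly after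
    its last return, where f is small: only the first and the last piece of the
    curve matter, and they stay in Omega. *)
Lemma weak_upper_gradient_restrict mu p f g (Omega : set X) :
  metric_measure mu -> Lip0 Omega f -> open Omega -> (forall x, 0 <= f x)%R ->
  weak_upper_gradient mu p (EFin \o f) g ->
  weak_upper_gradient mu p (EFin \o f) (g \_ Omega).
Proof.
move=> mmu [/Lipschitz_ge0[M M0 fM] fout] oO f0 [mg g0 [rho [brho rho0 rhofin rhog]]].
have gO0 x : 0 <= (g \_ Omega) x by rewrite patchE; case: ifPn.
split => //.
  have mO : measurable (Omega : set (caratheodory_type mu)).
    exact: open_caratheodory.
  apply: (measurable_restrictT _ mO).1.
  exact: measurable_funS mg.
exists rho; split => // gamma a b cg nug; apply: contrapT => rhofin'.
apply: nug; split => //= _.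
have rg := curve_rectifiable cg.
have ab : (a <= b)%R by case: rg.
have sub c d : (a <= c)%R -> (c <= d)%R -> (d <= b)%R ->
    line_integral gamma c d rho <= line_integral gamma a b rho ->
    line_integral gamma c d (g \_ Omega) <=
      line_integral gamma a b (g \_ Omega) ->
    (forall t, (c <= t <= d)%R -> Omega (gamma t)) ->
    `|f (gamma c) - f (gamma d)|%:E <= line_integral gamma a b (g \_ Omega).
  move=> ac cd db rhole gle cdO.
  have rcd := rectifiable_path_sub rg ac cd db.
  have [nc|nconst] := pselect (exists s t,
      [/\ s \in `[c, d], t \in `[c, d] & gamma s <> gamma t]); last first.
    have -> : gamma c = gamma d.
      apply: contrapT => h; apply: nconst; exists c, d; split => //.
        by rewrite in_itv/= lexx.
      by rewrite in_itv/= lexx andbT.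
    by rewrite subrr normr0; exact: integral_ge0.
  have ccd : curve gamma c d by case: rcd => ? ? ?; split.
  have [|/(rhog _ _ _ ccd) h] :=
    pselect (upper_gradient_along gamma c d (EFin \o f) g); last first.
    by exfalso; apply: rhofin'; apply/eqP; rewrite -leye_eq -h.
  move=> [/= /(_ isT) h _]; apply: (le_trans h); apply: le_trans gle.
  by apply: line_integral_le => // t /cdO tO; rewrite patchE mem_set.
have [allO|/existsNP[t0 /not_implyP[t0ab t0O]]] :=
    pselect (forall t, (a <= t <= b)%R -> Omega (gamma t)).
  exact: sub.
have small (t e : R) : (a <= t <= b)%R -> (0 < e)%R ->
    exists2 d : R, (0 < d)%R & forall s, (a <= s <= b)%R ->
      (`|t - s| < d)%R -> (`|f (gamma t) - f (gamma s)| < e)%R.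
  move=> tab e0; have eM0 : (0 < e / M)%R by rewrite divr_gt0.
  have tab' : t \in `[a, b] by rewrite in_itv.
  have [d d0 dP] := curve_continuous rg tab' eM0.
  exists d => // s sab ts; rewrite (le_lt_trans (fM _ _))// mulrC -ltr_pdivlMr//.
  by apply: dP => //; rewrite in_itv.
have head : (f (gamma a))%:E <= line_integral gamma a b (g \_ Omega).
  pose T := [set t | (a <= t <= b)%R /\ ~ Omega (gamma t)].
  have Tt0 : T t0 by [].
  have infT : has_inf T by split; [exists t0|exists a => t [/andP[]]].
  have aT : (a <= inf T)%R by apply: lb_le_inf; [exists t0|move=> t [/andP[]]].
  have Tb : (inf T <= b)%R.
    by apply: (le_trans (ge_inf _ Tt0)); [case: infT|case/andP: t0ab].
  have fT : f (gamma (inf T)) = 0%R.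
    apply/eqP; rewrite eq_le f0 andbT; apply/ler_addgt0Pr => e e0.
    have [|d d0 dP] := small (inf T) e _ e0; first by rewrite aT.
    have [t [tab tO] td] := inf_adherent d0 infT.
    have Tt : (inf T <= t)%R by apply: ge_inf => //; case: infT.
    have := dP t tab; rewrite (fout _ tO) subr0 distrC ger0_norm ?subr_ge0//.
    rewrite ltrBlDl => /(_ td) /ltW /(le_trans (ler_norm _)).
    by rewrite add0r.
  move: aT; rewrite le_eqVlt => /predU1P[->|aT].
    by rewrite fT; exact: integral_ge0.
  apply/lee_addgt0Pr => e e0.
  have [|d d0 dP] := small (inf T) e _ e0; first by rewrite (ltW aT).
  pose t := Num.max a (inf T - d / 2)%R.
  have at_ : (a <= t)%R by rewrite le_max lexx.
  have tT : (t < inf T)%R by rewrite gt_max aT/= ltrBlDr ltrDl divr_gt0.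
  have tb : (t <= b)%R by rewrite (le_trans (ltW tT)).
  have h1 : (`|f (gamma (inf T)) - f (gamma t)| < e)%R.
    apply: dP; first by rewrite at_.
    rewrite gtr0_norm ?subr_gt0//.
    have : (inf T - d / 2 <= t)%R by rewrite le_max lexx orbT.
    by lra.
  have h2 : `|f (gamma a) - f (gamma t)|%:E <=
      line_integral gamma a b (g \_ Omega).
    have atb : (a <= t <= b)%R by rewrite at_.
    apply: (sub a t (lexx a) at_ tb).
    - exact: line_integral_head rg rho0 atb.
    - exact: line_integral_head rg gO0 atb.
    move=> s /andP[as_ st]; apply: contrapT => sO.
    have : T s by split => //; rewrite as_ (le_trans st).
    move=> /(ge_inf infT.2); rewrite leNgt => /negP; apply.
    exact: le_lt_trans tT.
  apply: (le_trans _ (leeD2r _ h2)); rewrite -EFinD lee_fin.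
  rewrite fT sub0r normrN in h1.
  have := ler_norm (f (gamma a) - f (gamma t))%R; have := ler_norm (f (gamma t)).
  by lra.
have tail : (f (gamma b))%:E <= line_integral gamma a b (g \_ Omega).
  pose T := [set t | (a <= t <= b)%R /\ ~ Omega (gamma t)].
  have Tt0 : T t0 by [].
  have supT : has_sup T by split; [exists t0|exists b => t [/andP[]]].
  have Tb : (sup T <= b)%R by apply: ge_sup; [exists t0|move=> t [/andP[]]].
  have aT : (a <= sup T)%R.
    by apply: (le_trans _ (ub_le_sup supT.2 Tt0)); case/andP: t0ab.
  have fT : f (gamma (sup T)) = 0%R.
    apply/eqP; rewrite eq_le f0 andbT; apply/ler_addgt0Pr => e e0.
    have [|d d0 dP] := small (sup T) e _ e0; first by rewrite aT.
    have [t [tab tO] td] := sup_adherent d0 supT.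
    have Tt : (t <= sup T)%R by apply: ub_le_sup => //; case: supT.
    have := dP t tab; rewrite (fout _ tO) subr0 ger0_norm ?subr_ge0//.
    rewrite ltrBlDr -ltrBlDl => /(_ td) /ltW /(le_trans (ler_norm _)).
    by rewrite add0r.
  move: Tb; rewrite le_eqVlt => /predU1P[<-|Tb].
    by rewrite fT; exact: integral_ge0.
  apply/lee_addgt0Pr => e e0.
  have [|d d0 dP] := small (sup T) e _ e0; first by rewrite aT ltW.
  pose t := Num.min b (sup T + d / 2)%R.
  have tb : (t <= b)%R by rewrite ge_min lexx.
  have tT : (sup T < t)%R by rewrite lt_min Tb/= ltrDl divr_gt0.
  have at_ : (a <= t)%R by rewrite (le_trans _ (ltW tT)).
  have h1 : (`|f (gamma (sup T)) - f (gamma t)| < e)%R.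
    apply: dP; first by rewrite at_.
    rewrite ltr0_norm ?subr_lt0// opprB.
    have : (t <= sup T + d / 2)%R by rewrite ge_min lexx orbT.
    by lra.
  have h2 : `|f (gamma t) - f (gamma b)|%:E <=
      line_integral gamma a b (g \_ Omega).
    have atb : (a <= t <= b)%R by rewrite at_.
    apply: (sub t b at_ tb (lexx b)).
    - exact: line_integral_tail rg rho0 atb.
    - exact: line_integral_tail rg gO0 atb.
    move=> s /andP[ts sb]; apply: contrapT => sO.
    have : T s by split => //; rewrite sb (le_trans _ ts).
    move=> /(ub_le_sup supT.2); rewrite leNgt => /negP; apply.
    exact: lt_le_trans ts.
  apply: (le_trans _ (leeD2r _ h2)); rewrite -EFinD lee_fin.
  rewrite fT sub0r normrN in h1.
  have := ler_norm (f (gamma b) - f (gamma t))%R; have := ler_norm (f (gamma t)).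
  by rewrite (distrC (f (gamma b))); lra.
have [fab|fba] := leP (f (gamma a)) (f (gamma b)).
  apply: le_trans tail; rewrite lee_fin distrC ger0_norm ?subr_ge0//.
  by rewrite lerBlDr lerDl.
apply: le_trans head; rewrite lee_fin gtr0_norm ?subr_gt0//.
by rewrite lerBlDr lerDl.
Qed.

End weak_upper_gradients.

(** * The Poincare inequality for Lipschitz functions *)

Local Close Scope ereal_scope.

Lemma open_metric_ball {R : realType} {X : pmetricType R} (x : X) (r : R) :
  open (ball x r).
Proof.
rewrite openE => y /ballP xy; have e0 : 0 < r - mdist x y by rewrite subr_gt0.
apply: filterS (nbhsx_ballx y _ e0) => z /ballP yz; apply/ballP.
by rewrite (le_lt_trans (metric_triangle _ y _))// -ltrBrDl.
Qed.

Section poincare_lipschitz.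
Context {R : realType} {X : pmetricType R}.
Variable mu : {outer_measure set X -> \bar R}.
Hypothesis mm : metric_measure mu.
Local Notation m := (cara_measure mu).

Lemma measurable_ball_cara (x : X) (r : R) : mu.-cara.-measurable (ball x r).
Proof. by apply: open_caratheodory => //; exact: open_metric_ball. Qed.

Lemma mu_ball_gt0 (x : X) (r : R) : 0 < r -> (0 < mu (ball x r))%E.
Proof. by move=> r0; have [_ _ /(_ x r r0)/andP[]] := mm. Qed.

Lemma mu_ball_fin (x : X) (r : R) : 0 < r -> mu (ball x r) \is a fin_num.
Proof.
move=> r0; have [_ _ /(_ x r r0)/andP[h1 h2]] := mm.
by rewrite ge0_fin_numE// ltW.
Qed.

Lemma lipschitz_measurable (f : X -> R) : Lipschitz f ->
  measurable_fun [set: caratheodory_type mu] (f : caratheodory_type mu -> R).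
Proof.
move=> /Lipschitz_ge0[L L0 fL].
apply: (measurability _ (RGenOInfty.measurableE R)) => //.
move=> _ [_ [a ->] <-]; rewrite setTI; apply: open_caratheodory => //.
rewrite openE => x /=; rewrite in_itv/= andbT => afx.
have e0 : 0 < (f x - a) / L by rewrite divr_gt0// subr_gt0.
apply: filterS (nbhsx_ballx x _ e0) => y /ballP.
rewrite ltr_pdivlMr// mulrC => xy /=; rewrite in_itv/= andbT.
have := fL x y; have := ler_norm (f x - f y); lra.
Qed.

Lemma diam_ball_le (x : X) (r : R) : 0 < r -> (diam (ball x r) <= (2 * r)%:E)%E.
Proof.
move=> r0; apply: ge_ereal_sup => _ [[y z] [/= /ballP xy /ballP xz] <-] /=.
rewrite lee_fin (le_trans (metric_triangle _ x _))// (metric_sym y).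
by rewrite mulr2n mulrDl mul1r lerD// ltW.
Qed.

Lemma bounded_integral_fin (f : X -> R) (B : R) (x : X) (r : R) : 0 < r ->
  0 <= B -> (forall y, ball x r y -> 0 <= f y <= B) ->
  (\int[m]_(y in ball x r) (f y)%:E)%E \is a fin_num.
Proof.
move=> r0 B0 fB.
have f0 : (0 <= \int[m]_(y in ball x r) (f y)%:E)%E.
  by apply: integral_ge0 => y /fB /andP[h _]; rewrite lee_fin.
rewrite ge0_fin_numE//.
apply: (@le_lt_trans _ _ (\int[m]_(y in ball x r) B%:E)%E).
  apply: integral_le_nonmeasurable => //= y; rewrite ?lee_fin//.
    by move=> /fB /andP[].
  by move=> /fB/andP[].
rewrite integral_cst/=; last exact: measurable_ball_cara.
by rewrite -(fineK (mu_ball_fin x r0)) -EFinM ltry.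
Qed.

(** The averages may be replaced by integrals because the ball on the right is
    the larger one, and c is the mean value. *)
Lemma poincare_lipschitz (q CP tau : R) (f : X -> R) (g : X -> \bar R) (z : X)
    (s : R) : 0 < q -> 0 < CP -> 1 <= tau -> poincare mu q CP tau ->
  Lipschitz f -> weak_upper_gradient mu q (EFin \o f) g -> 0 < s ->
  exists c : R, (\int[m]_(x in ball z s) (`|f x - c| `^ q)%:E <=
    (CP * (2 * s) `^ q)%:E * \int[m]_(x in ball z (tau * s)) (g x `^ q))%E.
Proof.
move=> q0 CP0 tau1 PI fL fg s0.
have ts0 : 0 < tau * s by rewrite mulr_gt0// (lt_le_trans _ tau1).
have mB : mu.-cara.-measurable (ball z s) by exact: measurable_ball_cara.
have mtB : mu.-cara.-measurable (ball z (tau * s)) by exact: measurable_ball_cara.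
have mf := lipschitz_measurable fL.
have [L L0 fL'] := Lipschitz_ge0 fL.
pose K : R := `|f z| + L * s.
have K0 : 0 <= K by rewrite addr_ge0// mulr_ge0// ltW.
have fK x : ball z s x -> `|f x| <= K.
  move=> /ballP zx; rewrite -(subrK (f z) (f x)) (le_trans (ler_normD _ _))//.
  rewrite addrC lerD2l (le_trans (fL' _ _))// ler_wpM2l ?(ltW L0)//.
  by rewrite metric_sym ltW.
have fint : m.-integrable (ball z s) (EFin \o f).
  apply/integrableP; split.
    by apply/measurable_EFinP; apply: measurable_funS mf.
  rewrite -ge0_fin_numE; last exact: integral_ge0.
  by apply: (@bounded_integral_fin _ K) => // x /fK ->; rewrite andbT.
have avd : average_defined mu (ball z s) (EFin \o f).
  by left; exact: integral_funepos_lt_pinfty fint.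
have mEf : measurable_function mu (EFin \o f) by exact/measurable_EFinP.
have := PI z s s0 (EFin \o f) g mEf fg.
have [mg g0 _] := fg.
rewrite /oscillation asboolT//.
have afin : average mu (ball z s) (EFin \o f) \is a fin_num.
  rewrite /average -(fineK (mu_ball_fin z s0)) inver gt_eqF; last first.
    by rewrite fine_gt0// mu_ball_gt0// -ge0_fin_numE ?mu_ball_fin.
  by rewrite fin_numM// integrable_fin_num.
rewrite -(fineK afin); set c := fine _ => h; exists c.
have gq0 x : (0 <= g x `^ q)%E by exact: poweR_ge0.
have [->|I2oo] := eqVneq (\int[m]_(x in ball z (tau * s)) (g x `^ q))%E +oo%E.
  have K1 : 0 < CP * (2 * s) `^ q by apply: mulr_gt0 => //; apply: powR_gt0; lra.
  by rewrite gt0_muley ?leey// lte_fin.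
have I2fin : (\int[m]_(x in ball z (tau * s)) (g x `^ q))%E \is a fin_num.
  by rewrite ge0_fin_numE ?lt_neqAle ?I2oo ?leey// integral_ge0.
have I1fin : (\int[m]_(x in ball z s) (`|f x - c| `^ q)%:E)%E \is a fin_num.
  apply: (@bounded_integral_fin _ ((K + `|c|) `^ q)) => //.
    exact: powR_ge0.
  move=> x /fK fxK; rewrite powR_ge0/=; apply: powR_le; rewrite ?(ltW q0)//.
  by rewrite (le_trans (ler_normB _ _))// lerD2r.
move: h; rewrite /average.
rewrite -[X in (_ * X <= _)%E -> _]/(\int[m]_(x in ball z s)
  (`|f x - c| `^ q)%:E)%E.
have diamfin : diam (ball z s) \is a fin_num.
  rewrite fin_real// (le_lt_trans (diam_ball_le z s0)) ?ltry// andbT.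
  apply: (@lt_le_trans _ _ 0%E) => //; apply: ereal_sup_ubound.
  by exists (z, z); rewrite /= ?mdistxx//; split; exact: ballxx.
have := diam_ball_le z s0.
have diam0 : (0 <= diam (ball z s))%E.
  apply: ereal_sup_ubound.
  by exists (z, z); rewrite /= ?mdistxx//; split; exact: ballxx.
rewrite -(fineK diamfin) lee_fin in diam0 *.
rewrite -(fineK I1fin) -(fineK I2fin).
set dm := fine (diam _) in diam0 *; set I1 := fine _; set I2 := fine _.
have m1 : 0 < fine (mu (ball z s)).
  by rewrite fine_gt0// mu_ball_gt0// -ge0_fin_numE ?mu_ball_fin.
have m2 : 0 < fine (mu (ball z (tau * s))).
  by rewrite fine_gt0// mu_ball_gt0// -ge0_fin_numE ?mu_ball_fin.
have m12 : fine (mu (ball z s)) <= fine (mu (ball z (tau * s))).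
  rewrite fine_le ?mu_ball_fin//; apply: le_outer_measure; apply: le_ball.
  by rewrite ler_peMl// ltW.
rewrite -(fineK (mu_ball_fin z s0)) -(fineK (mu_ball_fin z ts0)).
move: m1 m2 m12; set m1 := fine _; set m2 := fine _ => m10 m20 m12.
rewrite !lee_fin => dm2.
rewrite !inver !gt_eqF// poweR_EFin -!EFinM !lee_fin => h.
have I20 : 0 <= I2 by rewrite fine_ge0// integral_ge0.
have dmq : dm `^ q <= (2 * s) `^ q.
  by apply: powR_le => //; exact: ltW.
have : I1 <= m1 * (CP * dm `^ q * (m2^-1 * I2)).
  by rewrite -ler_pdivrMl.
move=> /le_trans; apply.
rewrite [leLHS](_ : _ = CP * dm `^ q * ((m1 / m2) * I2)); last by ring.
have h1 : m1 / m2 * I2 <= I2 by rewrite ler_piMl// ler_pdivrMr// mul1r.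
have h2 : 0 <= m1 / m2 * I2 by rewrite mulr_ge0// divr_ge0// ltW.
by apply: ler_pM => //; [rewrite mulr_ge0 ?powR_ge0// ltW|rewrite ler_wpM2l// ltW].
Qed.

End poincare_lipschitz.

(** * A lower bound for the capacity of a ball *)

Section capacity_lower_bound.
Context {R : realType} {X : pmetricType R}.
Variable mu : {outer_measure set X -> \bar R}.
Hypothesis mm : metric_measure mu.
Local Notation m := (cara_measure mu).
Local Notation bm x r := (fine (mu (ball x r))).

Lemma mu_ballE (x : X) (r : R) : 0 < r -> mu (ball x r) = (bm x r)%:E.
Proof. by move=> r0; rewrite fineK// mu_ball_fin. Qed.

Lemma bm_gt0 (x : X) (r : R) : 0 < r -> 0 < bm x r.
Proof.
move=> r0; rewrite fine_gt0// mu_ball_gt0//=.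
by rewrite -ge0_fin_numE ?mu_ball_fin.
Qed.

Lemma sub_ball (x y : X) (r s : R) : mdist x y + r <= s -> ball y r `<=` ball x s.
Proof.
move=> h z /ballP yz; apply/ballP; rewrite (le_lt_trans (metric_triangle _ y _))//.
by rewrite (lt_le_trans _ h)// ltrD2l.
Qed.

Lemma ball_measure_le (CD : R) (x y : X) (r s : R) (n : nat) : doubling mu CD ->
  0 <= CD -> 0 < s -> mdist x y + s <= 2 ^+ n * r -> bm y s <= CD ^+ n * bm x r.
Proof.
move=> dbl CD0 s0 h.
have r0 : 0 < r.
  have : 0 < 2 ^+ n * r by rewrite (lt_le_trans _ h)// ltr_wpDl// mdist_ge0.
  by rewrite pmulr_rgt0// exprn_gt0.
have nr0 k : 0 < 2 ^+ k * r by rewrite mulr_gt0// exprn_gt0.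
apply: (@le_trans _ _ (bm x (2 ^+ n * r))).
  by rewrite fine_le ?mu_ball_fin//; apply: le_outer_measure; exact: sub_ball.
elim: n {h} => [|n IH]; first by rewrite !expr0 !mul1r.
have := dbl x (2 ^+ n * r) (nr0 n).
rewrite mulrA -exprS (mu_ballE _ (nr0 n.+1)) (mu_ballE _ (nr0 n)) -EFinM lee_fin.
by move=> /le_trans; apply; rewrite exprS -mulrA ler_wpM2l.
Qed.

Lemma const_le_integral (A B : set X) (F : X -> \bar R) (a : R) :
  mu.-cara.-measurable A -> A `<=` B -> 0 <= a ->
  (forall x, B x -> (0 <= F x)%E) -> (forall x, A x -> (a%:E <= F x)%E) ->
  (a%:E * mu A <= \int[m]_(x in B) F x)%E.
Proof.
move=> mA AB a0 F0 aF.
rewrite -[leLHS](@integral_cst _ _ _ m A mA).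
by apply: integral_le_nonmeasurable => //= x _; rewrite lee_fin.
Qed.

(** The tent function of height 1 that is 1 for distances to x up to (k - 1) r
    and 0 from k r on. *)
Definition cutoff (x : X) (r k : R) (z : X) : R :=
  Num.min (Num.max 0 (k - mdist x z / r)) 1.

Lemma cutoff_lip (x : X) (r k : R) : 0 < r -> forall y z,
  `|cutoff x r k y - cutoff x r k z| <= r^-1 * mdist y z.
Proof.
move=> r0 y z; rewrite /cutoff (le_trans (dist_minr_le _ _ _))//.
rewrite (le_trans (dist_maxr_le _ _ _))//.
have -> : k - mdist x y / r - (k - mdist x z / r) =
  r^-1 * (mdist x z - mdist x y) by ring.
rewrite normrM gtr0_norm ?invr_gt0// ler_wpM2l ?invr_ge0 ?(ltW r0)//.
have := metric_triangle x y z; have := metric_triangle x z y.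
by rewrite ler_norml (metric_sym z y) => h1 h2; apply/andP; split; lra.
Qed.

Lemma cutoff1 (x : X) (r k : R) z : 0 < r -> mdist x z <= (k - 1) * r ->
  cutoff x r k z = 1.
Proof.
move=> r0 h; rewrite /cutoff min_r// le_max; apply/orP; right.
by rewrite lerBrDl -lerBrDr ler_pdivrMr.
Qed.

Lemma cutoff0 (x : X) (r k : R) z : 0 < r -> k * r <= mdist x z ->
  cutoff x r k z = 0.
Proof.
move=> r0 h; rewrite /cutoff max_l ?min_l//.
by rewrite subr_le0 ler_pdivlMr.
Qed.

Lemma cutoff_itv (x : X) (r k : R) z : 0 <= cutoff x r k z <= 1.
Proof. by rewrite /cutoff le_min ler01 le_max lexx/= ge_min lexx orbT. Qed.

Section test_functions.
Variables (q CP tau : R).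
Hypotheses (q0 : 0 < q) (CP0 : 0 < CP) (tau1 : 1 <= tau).
Hypothesis PI : poincare mu q CP tau.

(** Otherwise the space splits into a ball and a part at positive distance
    from it, so that a locally constant function violates the Poincare
    inequality. *)
Lemma annulus_nonempty (x y : X) (r : R) : 0 < r -> 4 * r <= mdist x y ->
  exists z, 3 * r <= mdist x z < 4 * r.
Proof.
move=> r0 xy; apply: contrapT => /forallNP empty.
have alt z : mdist x z < 3 * r \/ 4 * r <= mdist x z.
  have [h|h] := ltP (mdist x z) (3 * r); first by left.
  have [h'|h'] := ltP (mdist x z) (4 * r); last by right.
  by exfalso; apply: (empty z); rewrite h h'.
pose f := cutoff x r 4.
have f1 z : mdist x z < 3 * r -> f z = 1.
  by move=> h; apply: cutoff1 => //; lra.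
have f0 z : 4 * r <= mdist x z -> f z = 0 by exact: cutoff0.
have fL : Lipschitz f by exists r^-1; exact: cutoff_lip.
have lip0 z : Lip_upper f z = 0%E.
  apply/eqP; rewrite eq_le Lip_upper_ge0 andbT.
  have r20 : 0 < r / 2 by rewrite divr_gt0.
  apply: (@Lip_upper_le _ _ _ _ 0 (r / 2)) => // t zt.
  suff -> : f t = f z by rewrite subrr normr0 mul0r.
  have := metric_triangle x z t; have := metric_triangle x t z.
  rewrite (metric_sym t z) => h1 h2.
  case: (alt z) => hz; case: (alt t) => ht; [|lra|lra|].
    by rewrite !f1.
  by rewrite !f0.
have R0 : 0 < mdist x y + r by rewrite ltr_wpDl// mdist_ge0.
have [c] := poincare_lipschitz mm x q0 CP0 tau1 PI fL
  (Lip_upper_weak_upper_gradient mm q0 fL) R0.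
rewrite [X in (_ * X)%E]integral0_eq ?mule0; last first.
  by move=> z _; rewrite lip0 poweR_EFin powR0// gt_eqF.
move=> h.
have const_on a z : (forall t, ball z r t -> f t = a) ->
    ball z r `<=` ball x (mdist x y + r) -> a = c.
  move=> fa sub; apply/eqP; rewrite -subr_eq0 -normr_le0 leNgt; apply/negP => ac.
  have : ((`|a - c| `^ q)%:E * mu (ball z r) <= 0)%E.
    apply: le_trans h; apply: const_le_integral => //.
      exact: measurable_ball_cara.
    by move=> t /fa ->.
  by rewrite leNgt mule_gt0// ?mu_ball_gt0// lte_fin powR_gt0.
have c1 : 1 = c.
  apply: (const_on 1 x) => [t /ballP xt|]; first by apply: f1; lra.
  by apply: sub_ball; rewrite mdistxx add0r lerDr mdist_ge0.
have c0 : 0 = c.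
  apply: (const_on 0 y) => [t /ballP yt|]; last exact: sub_ball.
  apply: f0; have := metric_triangle x t y; rewrite (metric_sym t y) => h1.
  by case: (alt t) => // ht; lra.
by move: (oner_neq0 R); rewrite c1 -c0 eqxx.
Qed.

(** Truncating a test function and cutting its gradient off outside the
    condenser leaves a function that is 1 on one ball and 0 on another ball of
    comparable size and distance, to which the Poincare inequality applies. *)
Lemma capacity_ball_ge (CD : R) (x : X) (r : R) : doubling mu CD -> 1 <= CD ->
  0 < r -> (r%:E < 8^-1%:E * diam [set: X])%E ->
  (((CP * (10 * r) `^ q * 2 `^ q * CD ^+ 3)^-1 * bm x r)%:E <=
    capacity mu q (closure (ball x r)) (ball x (2 * r)))%E.
Proof.
move=> dbl CD1 r0 rdiam.
have CD0 : 0 < CD by rewrite (lt_le_trans _ CD1).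
have [y xy] : exists y, 4 * r <= mdist x y.
  apply: contrapT => /forallNP h; move: rdiam; rewrite ltNge => /negP; apply.
  rewrite muleC lee_pdivrMr// -EFinM; apply: ge_ereal_sup => _ [[s t] _ <-] /=.
  rewrite lee_fin (le_trans (metric_triangle _ x _))// (metric_sym s).
  have /negP := h s; have /negP := h t; rewrite -!ltNge; lra.
have [z /andP[xz1 xz2]] := annulus_nonempty r0 xy.
apply: le_ereal_inf_tmp => _ [u [g [u0 u1 ug ->]]].
pose phi (t : R) : R := Num.min (Num.max 0 t) 1.
have phi1 s t : `|phi s - phi t| <= `|s - t|.
  by rewrite (le_trans (dist_minr_le _ _ _))// dist_maxr_le.
pose f := phi \o u.
have fL : Lip0 (ball x (2 * r)) f.
  case: u0 => -[L uL] u0; split.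
    by exists L => s t; rewrite (le_trans (phi1 _ _)).
  by move=> t /u0 /= ut; rewrite /f /= ut /phi max_l// min_l.
have f0 t : 0 <= f t by rewrite /f /= /phi le_min ler01 le_max lexx.
have fg := weak_upper_gradient_restrict mm fL (@open_metric_ball _ _ _ _) f0
  (weak_upper_gradient_contraction phi1 ug).
have r5 : 0 < 5 * r by rewrite mulr_gt0.
have [c hc] := poincare_lipschitz mm x q0 CP0 tau1 PI fL.1 fg r5.
have mO := measurable_ball_cara mm x (2 * r).
have [mg g0 _] := ug.
have hO : (\int[m]_(t in ball x (tau * (5 * r))) ((g \_ (ball x (2 * r))) t `^ q)
    <= \int[m]_(t in ball x (2 * r)) (g t `^ q))%E.
  rewrite [leLHS]integral_mkcond [leRHS]integral_mkcond.
  apply: integral_le_nonmeasurable => // t _; rewrite !patchE.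
  - by case: ifPn => // _; exact: poweR_ge0.
  - by case: ifPn => // _; exact: poweR_ge0.
  - case: ifPn => [_|_]; last by case: ifPn => // _; exact: poweR_ge0.
    by case: ifPn => // _; rewrite poweR_EFin powR0// gt_eqF.
have B0 := bm_gt0 x r0.
have [v [a [fa ac vsub Bv]]] : exists v a,
    [/\ forall t, ball v r t -> f t = a, 2^-1 <= `|a - c|,
     ball v r `<=` ball x (5 * r) & bm x r <= CD ^+ 3 * bm v r].
  have [c2|c2] := leP (2^-1) `|1 - c|.
    exists x, 1; split => //.
    - move=> t xt; have ut : 1 <= u t by apply: u1; exact: subset_closure.
      by rewrite /f /= /phi max_r ?min_r// (le_trans _ ut).
    - by apply: le_ball; lra.
    - by rewrite ler_peMl ?(ltW B0)// exprn_ege1.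
  exists z, 0; split.
  - move=> t /ballP zt; apply: fL.2 => /ballP xt.
    by have := metric_triangle x t z; rewrite (metric_sym t z); lra.
  - have := ler_norm (1 - c); have := ler_norm (c - 1).
    by have := ler_norm (- (0 - c)); rewrite normrN; lra.
  - by apply: sub_ball; lra.
  - apply: ball_measure_le => //; first exact: ltW.
    have -> : 2 ^+ 3 = 8 :> R by rewrite -natrX.
    by rewrite metric_sym; lra.
have h1 : ((2^-1 `^ q)%:E * mu (ball v r) <=
    \int[m]_(t in ball x (5 * r)) (`|f t - c| `^ q)%:E)%E.
  apply: const_le_integral => //; first exact: measurable_ball_cara.
  by move=> t /fa ->; rewrite lee_fin; apply: powR_le; rewrite ?(ltW q0)// invr_ge0.
have {h1 hc}h1 := le_trans h1 hc.
have K0 : 0 < CP * (10 * r) `^ q.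
  by apply: mulr_gt0 => //; apply: powR_gt0; lra.
have {hO}h2 : ((2^-1 `^ q)%:E * mu (ball v r) <= (CP * (10 * r) `^ q)%:E *
    \int[m]_(t in ball x (2 * r)) (g t `^ q))%E.
  apply: (le_trans h1); rewrite mulrA -natrM.
  by rewrite lee_pmul2l// lte_fin.
move: h2; set J := (\int[m]_(t in _) _)%E => h2.
have J0 : (0 <= J)%E by apply: integral_ge0 => t _; exact: poweR_ge0.
case: J J0 h2 => [j| |]// j0 h2; last by rewrite leey.
move: j0 h2.
rewrite (mu_ballE _ r0) -EFinM -EFinM !lee_fin => j0 h2.
rewrite ler_pdivrMl; last first.
  apply: mulr_gt0; last exact: exprn_gt0.
  by apply: mulr_gt0 => //; exact: powR_gt0.
apply: (le_trans Bv).
have two0 : 0 < 2 `^ q :> R by rewrite powR_gt0.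
rewrite [leRHS](_ : _ = CD ^+ 3 * (2 `^ q * (CP * (10 * r) `^ q * j))); last by ring.
rewrite ler_wpM2l ?exprn_ge0 ?(ltW CD0)//.
have e : 2^-1 `^ q * 2 `^ q = 1 :> R.
  by rewrite -powRM// mulVf// powR1.
have -> : bm v r = 2 `^ q * (2^-1 `^ q * bm v r) by rewrite mulrA (mulrC (2 `^ q)) e mul1r.
by rewrite ler_wpM2l// ltW.
Qed.

End test_functions.
End capacity_lower_bound.

(** * Covering and the weak type estimate *)

(** For each n only finitely many of the sets have measure above 1 / (n + 1). *)
Lemma trivIset_positive_measure_countable d (T : measurableType d)
    (R : realType) (m : {measure set T -> \bar R}) (I : pointedType) (D : set I)
    (B : I -> set T) (O : set T) : measurable O -> (m O < +oo)%E ->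
  (forall i, D i -> [/\ measurable (B i), B i `<=` O & (0 < m (B i))%E]) ->
  trivIset D B -> countable D.
Proof.
move=> mO Ofin DB tB.
have mBfin i : D i -> m (B i) \is a fin_num.
  move=> /DB[mB BO _]; rewrite ge0_fin_numE//.
  by apply: le_lt_trans Ofin; apply: le_measure => //; rewrite inE.
rewrite [X in countable X](_ : _ =
    \bigcup_n [set i | D i /\ n.+1%:R^-1 < fine (m (B i))]); last first.
  apply/seteqP; split => [i Di|i [n _ []]//].
  have [mB BO B0] := DB _ Di.
  have /invS_lt[n /(_ _ (leqnn n)) nB] : 0 < fine (m (B i)).
    by rewrite fine_gt0// B0/= -ge0_fin_numE ?mBfin.
  by exists n.
apply: bigcup_countable => // n _; apply: finite_set_countable.
apply: contrapT => /infiniteP/pcard_leP/injfunPex[/= f fD finj].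
have Df k : D (f k) by have [] := fD k Logic.I.
have fn k : n.+1%:R^-1 < fine (m (B (f k))) by have [] := fD k Logic.I.
have tBf : trivIset setT (B \o f).
  move=> j k _ _ jk; apply: finj; rewrite ?inE//.
  by apply: tB jk; exact: Df.
have mU : measurable (\bigcup_k B (f k)).
  by apply: bigcup_measurable => k _; have [] := DB _ (Df k).
have UO : \bigcup_k B (f k) `<=` O.
  by move=> x [k _]; have [_ + _] := DB _ (Df k); exact.
have : (m (\bigcup_k B (f k)) <= m O)%E by apply: le_measure; rewrite ?inE.
rewrite leNgt => /negP; apply.
have mBf k : measurable (B (f k)) by have [] := DB _ (Df k).
have -> : (m (\bigcup_k B (f k)) = \sum_(0 <= k <oo) m (B (f k)))%E.
  by rewrite measure_bigcup//; apply: eq_eseriesl => k; rewrite in_setT.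
pose N := (Num.truncn (n.+1%:R * fine (m O))).+1.
apply: (@lt_le_trans _ _ (\sum_(0 <= k < N) (n.+1%:R^-1)%:E)%E).
  rewrite sumEFin sumr_const_nat subn0 -[X in (X < _)%E]fineK ?ge0_fin_numE//.
  rewrite lte_fin -(mulr_natl (n.+1%:R^-1) N) ltr_pdivlMr// mulrC.
  exact: truncnS_gt.
apply: le_trans (nneseries_lim_ge N _) => //.
apply: lee_sum => k _; rewrite -(fineK (mBfin _ (Df k))) lee_fin.
exact: ltW.
Qed.

Section covering.
Context {R : realType} {X : pmetricType R}.

(** A maximal disjoint family among
    those that contain, with every ball of F that they meet, a competitor of at
    least half its radius, must meet every ball of F: otherwise a ball of nearly
    maximal radius among those missed could be added. *)
Lemma vitali_metric (F : set (X * R)) (S : R) :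
  (forall i, F i -> 0 < i.2 <= S) ->
  exists G : set (X * R), [/\ G `<=` F, trivIset G (fun i => ball i.1 i.2) &
    forall i, F i -> exists2 j, G j & ball i.1 i.2 `<=` ball j.1 (5 * j.2)].
Proof.
move=> FS.
pose B (i : X * R) := ball i.1 i.2.
have Bc i : F i -> B i i.1 by move=> /FS/andP[i0 _]; exact: ballxx.
pose P (G : set (X * R)) := [/\ G `<=` F, trivIset G B &
  forall i, F i -> (exists2 j, G j & B i `&` B j !=set0) ->
  exists j, [/\ G j, B i `&` B j !=set0 & i.2 <= 2 * j.2]].
have [G [[GF tG Ghalf] Gmax]] : exists G, P G /\ forall H, G `<` H -> ~ P H.
  apply: Zorn_bigcup => C CP Ctot; split.
  - by move=> i [G /CP[+ _ _]]; exact.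
  - move=> i j [G1 CG1 G1i] [G2 CG2 G2j].
    have [G12|G21] := Ctot _ _ CG1 CG2.
      by have [_ t2 _] := CP _ CG2; apply: t2 => //; exact: G12.
    by have [_ t1 _] := CP _ CG1; apply: t1 => //; exact: G21.
  - move=> i Fi [j [G CG Gj] ij]; have [_ _ h] := CP _ CG.
    have [|k [Gk ik ik2]] := h i Fi; first by exists j.
    by exists k; split => //; exists G.
exists G; split => // i Fi.
suff meets : exists2 j, G j & B i `&` B j !=set0.
  have [j [Gj [x [/ballP ix /ballP jx]] ij]] := Ghalf i Fi meets.
  exists j => //; apply: sub_ball.
  have := metric_triangle j.1 x i.1; rewrite (metric_sym x); lra.
apply: contrapT => nomeet.
pose N := [set j | F j /\ ~ exists2 k, G k & B j `&` B k !=set0].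
have Ni : N i by [].
pose rads := [set j.2 | j in N].
have hs : has_sup rads.
  split; first by exists i.2, i.
  by exists S => _ [j [Fj _] <-]; case/andP: (FS _ Fj).
have i0 : 0 < i.2 by case/andP: (FS _ Fi).
have s0 : 0 < sup rads.
  by rewrite (lt_le_trans i0)//; apply: ub_le_sup; [case: hs|exists i].
have [_ [i1 [Fi1 nom1] <-] hi1] := sup_adherent (divr_gt0 s0 (ltr0n R 2)) hs.
have supN j : N j -> j.2 <= 2 * i1.2.
  move=> Nj; have : j.2 <= sup rads by apply: ub_le_sup; [case: hs|exists j].
  by move: hi1; lra.
have nG : ~ G i1.
  by move=> Gi1; apply: nom1; exists i1 => //; exists i1.1; split; exact: Bc.
apply: (Gmax (G `|` [set i1])).
  split; first by move=> j Gj; left.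
  by move=> h; apply: nG; apply: h; right.
split.
- by move=> j [/GF//|->].
- move=> j k [Gj|->] [Gk|->] // jk; first exact: tG.
  + by exfalso; apply: nom1; exists j => //; rewrite setIC.
  + by exfalso; apply: nom1; exists k.
- move=> j Fj [k Gk jk].
  have [[k' Gk' jk']|nj] := pselect (exists2 k, G k & B j `&` B k !=set0).
    have [|l [Gl jl jl2]] := Ghalf j Fj; first by exists k'.
    by exists l; split => //; left.
  case: Gk jk => [Gk|->] jk; first by exfalso; apply: nj; exists k.
  by exists i1; split => //; [right|exact: supN].
Qed.

Variable mu : {outer_measure set X -> \bar R}.
Hypothesis mm : metric_measure mu.
Local Notation m := (cara_measure mu).

(** The covering lemma is applied to the balls enlarged by tau, so that the
    integrals over the selected balls add up. *)
Lemma covering_weak_type (CD tau S K R0 : R) (n : nat) (x0 : X)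
    (F : set (X * R)) (phi : X -> \bar R) :
  doubling mu CD -> 1 <= CD -> 1 <= tau -> 5 * tau <= 2 ^+ n -> 0 <= K ->
  0 < R0 -> measurable_function mu phi -> (forall x, (0 <= phi x)%E) ->
  (forall i, F i -> [/\ 0 < i.2 <= S,
    ball i.1 (tau * i.2) `<=` ball x0 R0 &
    (mu (ball i.1 i.2) <= K%:E * \int[m]_(x in ball i.1 (tau * i.2)) phi x)%E]) ->
  (mu (\bigcup_(i in F) ball i.1 i.2) <=
    (CD ^+ n * K)%:E * \int[m]_(x in ball x0 R0) phi x)%E.
Proof.
move=> dbl CD1 tau1 taun K0 R00 mphi phi0 FP.
have CD0 : 0 <= CD by lra.
have tau0 : 0 < tau by lra.
pose T (i : X * R) := (i.1, tau * i.2).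
have FS i : (T @` F) i -> 0 < i.2 <= tau * S.
  move=> [j /FP[/andP[j0 jS] _ _] <-] /=.
  by rewrite mulr_gt0//= ler_wpM2l// ltW.
have [G0 [G0F tG0 G0cov]] := vitali_metric FS.
pose G := [set i | F i /\ G0 (T i)].
have tG : trivIset G (fun i => ball i.1 (tau * i.2)).
  move=> i j [Fi Gi] [Fj Gj] ij; have := tG0 _ _ Gi Gj ij.
  case: i j {Fi Fj Gi Gj ij} => [i1 i2] [j1 j2] [-> /=].
  by move/(mulfI (lt0r_neq0 tau0)) => ->.
have cov i : F i -> exists2 j, G j & ball i.1 i.2 `<=` ball j.1 (5 * tau * j.2).
  move=> Fi; have [|j' G0j' sub] := G0cov (T i); first by exists i.
  have [j Fj jj'] := G0F _ G0j'; subst j'.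
  exists j; first by [].
  move=> x ix; rewrite -mulrA; apply: sub => /=; apply: le_ball ix.
  by have [/andP[i0 _] _ _] := FP _ Fi; rewrite ler_peMl// ltW.
have cG : countable G.
  apply: (@trivIset_positive_measure_countable _ (caratheodory_type mu) _ m _ _
    (fun i => ball i.1 (tau * i.2)) (ball x0 R0)) => //.
  - exact: measurable_ball_cara.
  - by rewrite /= (mu_ballE mm)// ltry.
  - move=> i [/FP[/andP[i0 _] sub _] _]; split => //.
      exact: measurable_ball_cara.
    by apply: mu_ball_gt0; rewrite ?mulr_gt0.
have /countable_injP[f finj] := cG.
pose A k := \bigcup_(i in [set i | G i /\ f i = k]) ball i.1 (tau * i.2).
pose A5 k := \bigcup_(i in [set i | G i /\ f i = k]) ball i.1 (5 * tau * i.2).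
have AE i : G i -> A (f i) = ball i.1 (tau * i.2) /\
    A5 (f i) = ball i.1 (5 * tau * i.2).
  move=> Gi; split; apply/seteqP; split => x.
  - by move=> [j /= [Gj /finj ->]]; rewrite ?inE.
  - by move=> ix; exists i.
  - by move=> [j /= [Gj /finj ->]]; rewrite ?inE.
  - by move=> ix; exists i.
have A0 k : ~ (exists2 i, G i & f i = k) -> A k = set0 /\ A5 k = set0.
  move=> h; split; apply/seteqP; split => // x [j /= [Gj fj]]; exfalso;
    by apply: h; exists j.
have mA k : measurable (A k : set (caratheodory_type mu)).
  have [[i Gi <-]|/A0[-> _]] := pselect (exists2 i, G i & f i = k); last first.
    exact: measurable0.
  by have [-> _] := AE _ Gi; exact: measurable_ball_cara.
have tA : trivIset setT A.
  move=> k l _ _ [x [[i [Gi fi] ix] [j [Gj fj] jx]]].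
  by rewrite -fi -fj; congr f; apply: tG => //; exists x.
have AO : \bigcup_k A k `<=` ball x0 R0.
  by move=> x [k _ [i [[/FP[_ sub _] _] _] ix]]; exact: sub.
have K1 : 0 <= CD ^+ n * K by rewrite mulr_ge0// exprn_ge0.
have A5A k : (mu (A5 k) <= (CD ^+ n * K)%:E * \int[m]_(x in A k) phi x)%E.
  have [[i Gi <-]|/A0[-> ->]] := pselect (exists2 i, G i & f i = k); last first.
    by rewrite integral_set0 mule0 outer_measure0.
  have [-> ->] := AE _ Gi; have [/FP[/andP[i0 _] _ h] _] := Gi.
  have ti0 : 0 < 5 * tau * i.2 by rewrite !mulr_gt0.
  apply: (@le_trans _ _ ((CD ^+ n)%:E * mu (ball i.1 i.2))%E).
    rewrite (mu_ballE mm _ i0) (mu_ballE mm _ ti0) -EFinM lee_fin.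
    apply: ball_measure_le => //.
    by rewrite mdistxx add0r ler_wpM2r// ltW.
  by rewrite EFinM -muleA lee_wpmul2l// lee_fin exprn_ge0.
apply: (@le_trans _ _ (mu (\bigcup_k A5 k))).
  apply: le_outer_measure => x [i /cov[j Gj sub] ix].
  by exists (f j) => //; exists j => //; exact: sub.
apply: (le_trans (outer_measure_sigma_subadditive mu A5)).
apply: (@le_trans _ _ (\sum_(k <oo) ((CD ^+ n * K)%:E * \int[m]_(x in A k) phi x)%E)%E).
  by apply: lee_nneseries => k _ //; exact: outer_measure_ge0.
rewrite nneseriesZl; last by move=> k _; exact: integral_ge0.
rewrite lee_wpmul2l// -ge0_integral_bigcup//; last first.
  by apply: measurable_funS mphi => //; exact: measurableT.
apply: integral_le_nonmeasurable => //.
Qed.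

End covering.

(** * Functions vanishing on a closed set *)

Section density.
Context {R : realType} {X : pmetricType R}.
Variable mu : {outer_measure set X -> \bar R}.
Hypothesis mm : metric_measure mu.
Variable CD : R.
Hypotheses (dbl : doubling mu CD) (CD1 : 1 <= CD).
Local Notation m := (cara_measure mu).

(** If the difference quotients of f do not tend to 0 at x, then f is nonzero,
    so that U fills a fixed proportion, on balls around x of arbitrarily small
    radius; these balls lie near the complement of U, where the measure of U
    is as small as desired. *)
Lemma Lip_upper_zero_ae (w : X) (r : R) (U : set X) (f : X -> R) : 0 < r ->
  open U -> Lipschitz f -> (forall x, ball w r x -> ~ U x -> f x = 0) ->
  mu [set x | [/\ ball w r x, ~ U x & (0 < Lip_upper f x)%E]] = 0%E.
Proof.
move=> r0 oU fL fU.
have CD0 : 0 <= CD := le_trans ler01 CD1.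
pose N k := [set x | [/\ ball w r x, ~ U x & (k.+1%:R^-1%:E < Lip_upper f x)%E]].
suff N0 k : mu (N k) = 0%E.
  apply/eqP; rewrite eq_le outer_measure_ge0 andbT.
  apply: (@le_trans _ _ (mu (\bigcup_k N k))).
    apply: le_outer_measure => x [wx Ux fx].
    have ffin := Lip_upper_fin x fL.
    have /invS_lt[n /(_ _ (leqnn n)) nf] : 0 < fine (Lip_upper f x).
      by rewrite fine_gt0// fx/= ltey_eq ffin.
    by exists n => //; split => //; rewrite -(fineK ffin) lte_fin.
  apply: (le_trans (outer_measure_sigma_subadditive mu N)).
  by rewrite eseries0.
have [L0 L00 fL0] := Lipschitz_ge0 fL.
pose L := L0 + 1.
have L1 : 1 <= L by rewrite /L lerDr ltW.
have fL' x y : `|f x - f y| <= L * mdist x y.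
  by rewrite (le_trans (fL0 x y))// ler_wpM2r ?mdist_ge0// /L lerDl.
pose c : R := k.+1%:R^-1.
have c0 : 0 < c by rewrite /c.
have c1 : c <= 1 by rewrite /c invf_le1// ler1n.
pose t := c / L.
have t0 : 0 < t by rewrite divr_gt0//; lra.
have t1 : t <= 1 by rewrite /t ler_pdivrMr ?mul1r; lra.
have [j tj] : exists j : nat, 3 <= 2 ^+ j * t.
  exists (Num.truncn (3 / t)).+1; rewrite -ler_pdivrMr//.
  rewrite (le_trans (ltW (truncnS_gt _)))// -natrX ler_nat ltnW//.
  exact: ltn_expl.
pose H n := [set z | [/\ ball w r z, U z &
  exists2 x, ~ U x & ball x n.+1%:R^-1 z]].
have oH n : open (H n).
  have -> : H n = ball w r `&` U `&` \bigcup_(x in ~` U) ball x n.+1%:R^-1.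
    apply/seteqP; split => z; first by case=> h1 h2 [x Ux xz]; split=> //; exists x.
    by move=> [[h1 h2] [x Ux xz]]; split => //; exists x.
  apply: openI; first by apply: openI => //; exact: open_metric_ball.
  by apply: bigcup_open => x _; exact: open_metric_ball.
have mH n : measurable (H n : set (caratheodory_type mu)).
  exact: open_caratheodory.
have Hw n : H n `<=` ball w r by move=> z [].
have bound n : (mu (N k) <= (CD ^+ 3 * CD ^+ j)%:E * mu (H n))%E.
  pose F := [set i : X * R | [/\ 0 < i.2 <= 1, ball i.1 i.2 `<=` ball w r &
    (mu (ball i.1 i.2) <= (CD ^+ j)%:E *
       \int[m]_(x in ball i.1 i.2) (\1_(H n) x)%:E)%E]].
  apply: (@le_trans _ _ (mu (\bigcup_(i in F) ball i.1 i.2))).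
    apply: le_outer_measure => x [wx Ux fx].
    have fx0 : f x = 0 by exact: fU.
    pose d := Num.min (n.+1%:R^-1 / 2) ((r - mdist w x) / 2).
    have d0 : 0 < d.
      by rewrite lt_min divr_gt0//= divr_gt0// subr_gt0; apply/ballP.
    have d1 : d <= n.+1%:R^-1 / 2 by rewrite ge_min lexx.
    have d2 : d <= (r - mdist w x) / 2 by rewrite ge_min lexx orbT.
    have n1 : n.+1%:R^-1 <= 1 :> R by rewrite invf_le1// ler1n.
    have [y [xy fy]] : exists y, mdist x y < d /\ c * mdist x y < `|f y|.
      apply: contrapT => /forallNP h; move: fx; rewrite ltNge => /negP; apply.
      apply: (@Lip_upper_le _ _ _ _ c d) => //; first exact: ltW.
      move=> y xyd; rewrite fx0 subr0 leNgt; apply/negP => h'.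
      by apply: (h y).
    have e0 : 0 < mdist x y.
      rewrite lt_neqAle mdist_ge0 andbT; apply/eqP => /esym /mdist_positivity xy0.
      by move: fy; rewrite -xy0 fx0 normr0 mdistxx mulr0 ltxx.
    set e := mdist x y in xy fy e0.
    have e2n : 2 * e <= n.+1%:R^-1.
      by rewrite mulrC -ler_pdivlMr// ltW// (lt_le_trans xy).
    have te0 : 0 < t * e by rewrite mulr_gt0.
    have te : t * e <= e by rewrite ler_piMl// ltW.
    have sub1 : ball x (2 * e) `<=` ball w r by apply: sub_ball; lra.
    have sub2 : ball y (t * e) `<=` ball x (2 * e).
      by apply: sub_ball; rewrite -/e; lra.
    have sub3 : ball y (t * e) `<=` H n.
      move=> z yz; have wz := sub1 _ (sub2 _ yz).
      have fz : f z != 0.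
        rewrite -normr_gt0; have := fL' y z; have := ler_norm (`|f y| - `|f z|).
        have := ler_dist_dist (f y) (f z); move/ballP: yz.
        rewrite -(@ltr_pM2l _ L); last lra.
        have -> : L * (t * e) = c * e by rewrite /t; field; lra.
        lra.
      split => //; last first.
        by exists x => //; apply: le_ball (sub2 _ yz).
      by apply: contrapT => Uz; move: fz; rewrite fU ?eqxx.
    exists (x, 2 * e); last by apply: ballxx; rewrite mulr_gt0.
    have e20 : 0 < 2 * e by rewrite mulr_gt0.
    split => //=; first by rewrite e20/= (le_trans e2n).
    apply: (@le_trans _ _ ((CD ^+ j)%:E * mu (ball y (t * e)))%E).
      rewrite (mu_ballE mm _ te0) (mu_ballE mm _ e20) -EFinM lee_fin.
      apply: ball_measure_le => //; rewrite metric_sym -/e mulrA.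
      by have := ler_wpM2r (ltW e0) tj; lra.
    rewrite lee_wpmul2l ?lee_fin ?exprn_ge0// -[leLHS]mul1e.
    apply: const_le_integral => //.
    - exact: measurable_ball_cara.
    - by move=> z /sub3 Hz; rewrite lee_fin indicE mem_set.
  apply: (le_trans (@covering_weak_type _ _ _ mm CD 1 1 (CD ^+ j) r 3 w F
    (fun x => (\1_(H n) x)%:E) _ _ _ _ _ _ _ _ _)) => //.
  - by rewrite mulr1 -natrX ler_nat.
  - by rewrite exprn_ge0.
  - by apply/measurable_EFinP; exact: measurable_indic.
  - by move=> i [h1 h2 h3]; rewrite !mul1r.
  rewrite integral_indic//; last exact: measurable_ball_cara.
  by rewrite setIidl.
have Hcvg : m (H n) @[n --> \oo] --> 0%E.
  have -> : 0%E = m (\bigcap_n H n).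
    rewrite (_ : \bigcap_n H n = set0) ?measure0//; apply/seteqP; split => // z Hz.
    have [_ Uz _] := Hz 0%N Logic.I.
    have : nbhs z U by exact: open_nbhs_nbhs.
    move=> /nbhs_ballP[d /= d0 dU].
    have [n /(_ _ (leqnn n)) nd] := invS_lt d0.
    have [_ _ [x Ux /ball_sym xz]] := Hz n Logic.I.
    by apply: Ux; apply: dU; apply: le_ball xz; exact: ltW.
  apply: nonincreasing_cvg_mu => //.
  - rewrite (@le_lt_trans _ _ (mu (ball w r)))//; first exact: le_outer_measure.
    by rewrite (mu_ballE mm)// ltry.
  - exact: bigcapT_measurable.
  - move=> n1 n2 n12; apply/subsetPset => z [h1 h2 [x Ux xz]]; split => //.
    exists x => //; apply: le_ball xz.
    by rewrite lef_pV2 ?posrE// ler_nat ltnS.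
apply/eqP; rewrite eq_le outer_measure_ge0 andbT.
have Cfin : (CD ^+ 3 * CD ^+ j)%:E \is a fin_num by [].
have := cvgeZl Cfin Hcvg; rewrite mule0 => Ccvg.
rewrite -(cvg_lim _ Ccvg)//; apply: lime_ge; first exact: cvgP Ccvg.
by apply: nearW => n; exact: bound.
Qed.

End density.

(** * Powers, pointwise Lipschitz constants and integral bounds *)

Section powR_inequalities.
Context {R : realType}.
Implicit Types a b c p q : R.

Lemma powRD_le a b q : 0 <= q -> 0 <= a -> 0 <= b ->
  (a + b) `^ q <= 2 `^ q * (a `^ q + b `^ q).
Proof.
move=> q0 a0 b0; wlog ab : a b a0 b0 / a <= b.
  move=> H; have [|/ltW ba] := leP a b; first exact: H.
  by rewrite addrC (addrC (a `^ q)); exact: H.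
apply: (@le_trans _ _ ((2 * b) `^ q)).
  by apply: powR_le => //; [rewrite addr_ge0|lra].
rewrite powRM// ler_wpM2l ?powR_ge0// lerDr.
exact: powR_ge0.
Qed.

Lemma powRD3_le a b c q : 0 <= q -> 0 <= a -> 0 <= b -> 0 <= c ->
  (a + b + c) `^ q <= 3 `^ q * (a `^ q + b `^ q + c `^ q).
Proof.
move=> q0 a0 b0 c0; pose M := Num.max a (Num.max b c).
have aM : a <= M by rewrite le_max lexx.
have bM : b <= M by rewrite !le_max lexx orbT.
have cM : c <= M by rewrite !le_max lexx !orbT.
apply: (@le_trans _ _ ((3 * M) `^ q)).
  by apply: powR_le => //; [rewrite !addr_ge0|lra].
rewrite powRM//; last exact: le_trans aM.
rewrite ler_wpM2l ?powR_ge0//.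
have := powR_ge0 a q; have := powR_ge0 b q; have := powR_ge0 c q.
have [->|[->|->]] : M = a \/ M = b \/ M = c; last 3 first.
- lra.
- lra.
- lra.
rewrite /M; case: (leP b c) => _; case: leP => _; tauto.
Qed.

Lemma powRV a q : 0 <= a -> a^-1 `^ q = (a `^ q)^-1.
Proof. by move=> a0; rewrite -powR_inv1// -powRrM mulN1r powRN. Qed.

Lemma powR_split a p q : 0 < p -> a `^ p = a `^ (p - q) * a `^ q.
Proof. by move=> p0; rewrite -powRD subrK// gt_eqF. Qed.

(** A sum over distinct powers of 2 is at most twice its largest term. *)
Lemma dyadic_sum_powR_le (P : nat -> bool) (k : nat) p : 0 < p ->
  (\sum_(j < k) 2 ^+ j * (P j)%:R) `^ p <=
  2 `^ p * \sum_(j < k) (2 ^+ j) `^ p * (P j)%:R :> R.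
Proof.
move=> p0; have p0' := ltW p0.
have sum_le n : \sum_(j < n) 2 ^+ j * (P j)%:R <= 2 ^+ n :> R.
  elim: n => [|n IH]; first by rewrite big_ord0 ler01.
  have -> : 2 ^+ n.+1 = 2 ^+ n + 2 ^+ n :> R by rewrite exprS; ring.
  rewrite big_ord_recr/= lerD// ler_piMr ?exprn_ge0//.
  by case: (P n).
have sum_ge0 n : 0 <= \sum_(j < n) (2 ^+ j) `^ p * (P j)%:R :> R.
  by apply: sumr_ge0 => j _; rewrite mulr_ge0 ?powR_ge0.
elim: k => [|k IH]; first by rewrite !big_ord0 mulr0 powR0// gt_eqF.
rewrite !big_ord_recr/=.
case: (P k) => /=; last by rewrite !mulr0 !addr0.
rewrite !mulr1; apply: (@le_trans _ _ ((2 * 2 ^+ k) `^ p)).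
  apply: powR_le => //; last by have := sum_le k; lra.
  by rewrite addr_ge0 ?exprn_ge0// sumr_ge0// => j _; rewrite mulr_ge0 ?exprn_ge0.
rewrite powRM ?exprn_ge0// ler_wpM2l ?powR_ge0// lerDr.
exact: sum_ge0.
Qed.

End powR_inequalities.

Section lip_upper_calculus.
Context {R : realType} {X : pmetricType R}.
Implicit Types (f h : X -> R) (x : X).

Lemma Lip_upper_le_eps f x (l : R) : (Lip_upper f x <= l%:E)%E -> forall e, 0 < e ->
  exists2 d : R, 0 < d & forall y, mdist x y < d ->
    `|f y - f x| <= (l + e) * mdist x y.
Proof.
move=> fl e e0; apply: Lip_upper_lt; apply: le_lt_trans fl _.
by rewrite lte_fin ltrDl.
Qed.

(** This form contains the rules for contractions, multiples, sums and products
    at once; b collects the factors of which only a Lipschitz constant is used. *)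
Lemma Lip_upper_dominated f h1 h2 x (l1 l2 a1 a2 b : R) :
  0 <= a1 -> 0 <= a2 -> 0 <= b ->
  (Lip_upper h1 x <= l1%:E)%E -> (Lip_upper h2 x <= l2%:E)%E ->
  (forall y, `|f y - f x| <=
    a1 * `|h1 y - h1 x| + a2 * `|h2 y - h2 x| + b * mdist x y) ->
  (Lip_upper f x <= (a1 * l1 + a2 * l2 + b)%:E)%E.
Proof.
move=> a10 a20 b0 h1l h2l fh; apply/lee_addgt0Pr => e e0.
have l10 : 0 <= l1 by rewrite -lee_fin (le_trans (Lip_upper_ge0 h1 x)).
have l20 : 0 <= l2 by rewrite -lee_fin (le_trans (Lip_upper_ge0 h2 x)).
pose a := a1 + a2 + 1; have a0 : 0 < a by rewrite /a; lra.
have ea0 : 0 < e / a by rewrite divr_gt0.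
have [d1 d10 H1] := Lip_upper_le_eps h1l ea0.
have [d2 d20 H2] := Lip_upper_le_eps h2l ea0.
rewrite -EFinD; apply: (@Lip_upper_le _ _ _ _ _ (Num.min d1 d2)).
- by rewrite !addr_ge0 ?mulr_ge0// ltW.
- by rewrite lt_min d10.
move=> y; rewrite lt_min => /andP[/H1 {}H1 /H2 {}H2].
apply: (le_trans (fh y)).
have m0 : 0 <= mdist x y := mdist_ge0 x y.
have K1 := ler_wpM2l a10 H1; have K2 := ler_wpM2l a20 H2.
have K3 : (a1 + a2) * (e / a) <= e.
  by rewrite mulrA ler_pdivrMr// mulrC ler_wpM2l ?(ltW e0)// /a lerDl.
have := ler_wpM2r m0 K3; nra.
Qed.

Lemma Lip_upper_sum (h : nat -> X -> R) (l : nat -> R) x (k : nat) :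
  (forall j, (j < k)%N -> (Lip_upper (h j) x <= (l j)%:E)%E) ->
  (Lip_upper (fun y => \sum_(j < k) h j y)%R x <= (\sum_(j < k) l j)%:E)%E.
Proof.
elim: k => [_|k IH hl].
  rewrite big_ord0; apply: (@Lip_upper_le _ _ _ _ 0 1) => // y _.
  by rewrite !big_ord0 subrr normr0 mul0r.
rewrite big_ord_recr/=.
have := @Lip_upper_dominated (fun y => \sum_(j < k.+1) h j y)
  (fun y => \sum_(j < k) h j y) (h k) x _ _ 1 1 0 ler01 ler01 (lexx 0)
  (IH (fun j jk => hl j (ltnW jk))) (hl k (ltnSn k)).
rewrite !mul1r addr0; apply => y.
rewrite !big_ord_recr/= mul0r addr0 !mul1r opprD addrACA.
exact: ler_normD.
Qed.

(** The lower envelope of the cones v y + L d(y, x), for y in F. *)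
Lemma mcshane_extension (F : set X) (v : X -> R) (L : R) : F !=set0 -> 0 <= L ->
  (forall x, F x -> 0 <= v x) ->
  (forall x y, F x -> F y -> `|v x - v y| <= L * mdist x y) ->
  exists w : X -> R, [/\ forall x y, `|w x - w y| <= L * mdist x y,
    forall x, F x -> w x = v x & forall x, 0 <= w x].
Proof.
move=> [x0 Fx0] L0 v0 vL.
pose T x := [set v y + L * mdist y x | y in F].
have T0 x : T x !=set0 by exists (v x0 + L * mdist x0 x), x0.
have lbT x : lbound (T x) 0.
  by move=> _ [y Fy <-]; rewrite addr_ge0 ?v0// mulr_ge0 ?mdist_ge0.
have hT x : has_inf (T x) by split => //; exists 0.
pose w x := inf (T x).
have wle x y : w x <= w y + L * mdist x y.
  rewrite -lerBlDr; apply: lb_le_inf => // _ [z Fz <-].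
  rewrite lerBlDr -addrA -mulrDr.
  apply: (@le_trans _ _ (v z + L * mdist z x)).
    by apply: ge_inf; [case: (hT x)|exists z].
  by rewrite lerD2l ler_wpM2l// (metric_sym x) metric_triangle.
exists w; split.
- move=> x y; rewrite ler_norml; have := wle x y; have := wle y x.
  by rewrite (metric_sym y) => h1 h2; apply/andP; split; lra.
- move=> x Fx; apply/eqP; rewrite eq_le; apply/andP; split.
    by apply: ge_inf; [case: (hT x)|exists x; rewrite // mdistxx mulr0 addr0].
  apply: lb_le_inf => // _ [y Fy <-].
  have := vL x y Fx Fy; have := ler_norm (v x - v y).
  by rewrite (metric_sym y); lra.
- by move=> x; apply: lb_le_inf.
Qed.

End lip_upper_calculus.

Section bounded_integrals.
Context d (T : measurableType d) (R : realType) (m : {measure set T -> \bar R}).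
Variables (D : set T) (mD : measurable D).

(** Measurability and nonnegativity are carried along because sums and multiples
    of such bounds need them. *)
Definition integral_bound (F : T -> R) (I : R) : Prop :=
  [/\ measurable_fun [set: T] F, forall x, 0 <= F x &
    (\int[m]_(x in D) (F x)%:E <= I%:E)%E].

Lemma integral_boundD F G (I J : R) : integral_bound F I -> integral_bound G J ->
  integral_bound (fun x => F x + G x) (I + J).
Proof.
move=> [mF F0 FI] [mG G0 GJ]; split.
- exact: measurable_funD.
- by move=> x; rewrite addr_ge0.
under eq_integral do rewrite EFinD.
rewrite ge0_integralD//; first by rewrite EFinD leeD.
- by move=> x _; rewrite lee_fin.
- by apply/measurable_EFinP; apply: measurable_funS mF.
- by move=> x _; rewrite lee_fin.
- by apply/measurable_EFinP; apply: measurable_funS mG.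
Qed.

Lemma integral_boundZ F (I c : R) : 0 <= c -> integral_bound F I ->
  integral_bound (fun x => c * F x) (c * I).
Proof.
move=> c0 [mF F0 FI]; split.
- by apply: measurable_funM.
- by move=> x; rewrite mulr_ge0.
under eq_integral do rewrite EFinM.
rewrite ge0_integralZl_EFin//; first by rewrite EFinM lee_wpmul2l.
- by move=> x _; rewrite lee_fin.
- by apply/measurable_EFinP; apply: measurable_funS mF.
Qed.

Lemma integral_bound_sum (F : nat -> T -> R) (I : nat -> R) (k : nat) :
  (forall j, integral_bound (F j) (I j)) ->
  integral_bound (fun x => \sum_(j < k) F j x) (\sum_(j < k) I j).
Proof.
move=> FI; elim: k => [|k IH].
  rewrite big_ord0 (_ : (fun x => _) = cst 0); last first.
    by apply/funext => x; rewrite big_ord0.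
  split; [exact: measurable_cst|by []|by rewrite integral0].
rewrite big_ord_recr/= (_ : (fun x => _) = (fun x => \sum_(j < k) F j x + F k x)).
  exact: integral_boundD.
by apply/funext => x; rewrite big_ord_recr.
Qed.

Lemma integral_bound_indic U (I : R) : measurable U -> (m U <= I%:E)%E ->
  integral_bound (\1_U) I.
Proof.
move=> mU UI; split.
- exact: measurable_indic.
- by move=> x; rewrite indicE.
by rewrite integral_indic//; apply: le_trans UI; apply: le_measure;
  rewrite ?inE//; exact: measurableI.
Qed.

End bounded_integrals.

Section metric_measure_facts.
Context {R : realType} {X : pmetricType R}.
Variable mu : {outer_measure set X -> \bar R}.
Hypothesis mm : metric_measure mu.

Lemma null_negligible (N : set X) : mu N = 0%E -> (cara_measure mu).-negligible N.
Proof.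
move=> N0; have [bm reg _] := mm; have [B [bB NB muB]] := reg N.
by exists B; split; [exact: bm|rewrite -N0|].
Qed.

Lemma closure_ball_le (w : X) (r : R) z : closure (ball w r) z -> mdist w z <= r.
Proof.
move=> wz; apply/ler_addgt0Pr => e e0.
have [y [/ballP wy /ballP zy]] := wz _ (nbhsx_ballx z e e0).
rewrite (le_trans (metric_triangle _ y _))// lerD ?ltW//.
by rewrite metric_sym.
Qed.

(** Only the part of h below the level a counts for the pointwise Lipschitz
    constant of the cutoff: at a point where h >= a the product vanishes and
    grows no faster than h / a decreases. *)
Lemma Lip_upper_cutoff_tent (w x : X) (h : X -> R) (rho a l : R) :
  0 < rho -> 0 < a -> (forall z, 0 <= h z) -> (Lip_upper h x <= l%:E)%E ->
  (Lip_upper (fun z => (cutoff w rho 2 z * Num.max 0 (1 - h z / a))%R) x <=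
    (a^-1 * l + (h x < a)%R%:R / rho)%:E)%E.
Proof.
move=> rho0 a0 h0 hl.
set psi := fun z => Num.max 0 (1 - h z / a).
have psi0 z : 0 <= psi z by rewrite /psi le_max lexx.
have psi1 z : psi z <= 1.
  by rewrite /psi ge_max ler01 gerBl divr_ge0// ltW.
have psiL y : `|psi y - psi x| <= a^-1 * `|h y - h x|.
  rewrite (le_trans (dist_maxr_le _ _ _))//.
  have -> : 1 - h y / a - (1 - h x / a) = a^-1 * (h x - h y) by ring.
  by rewrite normrM gtr0_norm ?invr_gt0// distrC.
have l0 : 0 <= l by rewrite -lee_fin (le_trans (Lip_upper_ge0 h x)).
have a'0 : 0 <= a^-1 by rewrite invr_ge0 ltW.
have b0 : 0 <= (h x < a)%R%:R / rho :> R by rewrite divr_ge0// ltW.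
have := @Lip_upper_dominated _ _ (fun z => cutoff w rho 2 z * psi z) h h x l l
  a^-1 0 ((h x < a)%R%:R / rho) a'0 (lexx 0) b0 hl hl.
rewrite mul0r addr0; apply => y; rewrite mul0r addr0.
have /andP[c0 c1] := cutoff_itv w rho 2 y.
have [hxa|hxa] := ltP (h x) a.
  have -> : cutoff w rho 2 y * psi y - cutoff w rho 2 x * psi x =
    cutoff w rho 2 y * (psi y - psi x) +
    (cutoff w rho 2 y - cutoff w rho 2 x) * psi x by ring.
  rewrite (le_trans (ler_normD _ _))// lerD//.
    rewrite normrM (ger0_norm c0) (le_trans _ (psiL y))// ler_piMl//.
  rewrite mul1r normrM (ger0_norm (psi0 x)) -[leRHS]mulr1 ler_pM//.
  by rewrite (metric_sym x); exact: cutoff_lip.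
rewrite mul0r mul0r addr0.
have -> : psi x = 0.
  by rewrite /psi max_l// subr_le0 ler_pdivlMr// mul1r.
rewrite mulr0 subr0 ger0_norm ?mulr_ge0//.
apply: le_trans (psiL y); have -> : psi x = 0.
  by rewrite /psi max_l// subr_le0 ler_pdivlMr// mul1r.
by rewrite subr0 ger0_norm// ler_piMl.
Qed.

End metric_measure_facts.

(** * Good points *)

Section good_points.
Context {R : realType} {X : pmetricType R}.
Variable mu : {outer_measure set X -> \bar R}.
Hypothesis mm : metric_measure mu.
Local Notation m := (cara_measure mu).
Local Notation bm x r := (fine (mu (ball x r))).
Variables (CD CP tau q A : R) (u g : X -> R) (E : set X).
Hypotheses (dbl : doubling mu CD) (CD1 : 1 <= CD).
Hypotheses (CP0 : 0 < CP) (tau1 : 1 <= tau) (q1 : 1 <= q) (A0 : 0 <= A).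
Hypothesis PI : poincare mu q CP tau.
Hypotheses (uL : Lipschitz u) (uE : forall x, E x -> u x = 0).
Hypothesis u0 : forall x, 0 <= u x.
Hypothesis mg : measurable_fun [set: caratheodory_type mu] (g : caratheodory_type mu -> R).
Hypothesis gbd : exists G : R, forall x, g x <= G.
Hypothesis lipg : forall x, (Lip_upper u x <= (g x)%:E)%E.

Let q0 : 0 < q. Proof. exact: lt_le_trans ltr01 q1. Qed.
Let CD0 : 0 <= CD. Proof. exact: le_trans ler01 CD1. Qed.
Let tau0 : 0 < tau. Proof. exact: lt_le_trans ltr01 tau1. Qed.

Let mgq : measurable_function mu (fun x => (g x `^ q)%:E).
Proof.
apply/measurable_EFinP.
exact: (measurableT_comp (measurable_powR q) mg).
Qed.

Definition energy (z : X) (s : R) : R :=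
  fine (\int[m]_(x in ball z s) (g x `^ q)%:E)%E.
Local Notation nu := energy.

Lemma g_ge0 x : 0 <= g x.
Proof. by rewrite -lee_fin (le_trans (Lip_upper_ge0 u x)). Qed.

Lemma energyE z (s : R) : 0 < s -> (\int[m]_(x in ball z s) (g x `^ q)%:E)%E = (nu z s)%:E.
Proof.
move=> s0; rewrite fineK//; have [G gG] := gbd.
apply: (@bounded_integral_fin _ _ _ mm _ (`|G| `^ q)) => //.
move=> x _; rewrite powR_ge0/=; apply: powR_le; rewrite ?(ltW q0) ?g_ge0//.
exact: le_trans (gG x) (ler_norm G).
Qed.

Lemma energy_ge0 z s : 0 <= nu z s.
Proof.
by rewrite fine_ge0// integral_ge0// => x _; rewrite lee_fin powR_ge0.
Qed.

Lemma poincare_energy z (s : R) : 0 < s -> exists c : R,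
  (\int[m]_(x in ball z s) (`|u x - c| `^ q)%:E <=
    (CP * (2 * s) `^ q * nu z (tau * s))%:E)%E.
Proof.
move=> s0; have [c hc] := poincare_lipschitz mm z q0 CP0 tau1 PI uL
  (Lip_upper_weak_upper_gradient mm q0 uL) s0.
exists c; apply: (le_trans hc); rewrite [leRHS]EFinM -energyE ?mulr_gt0//.
rewrite lee_wpmul2l ?lee_fin ?mulr_ge0 ?(ltW CP0) ?powR_ge0//.
apply: integral_le_nonmeasurable => // x _.
- exact: poweR_ge0.
- by rewrite lee_fin powR_ge0.
have := lipg x; rewrite -(fineK (Lip_upper_fin x uL)) poweR_EFin !lee_fin => h.
by apply: powR_le; rewrite ?(ltW q0) ?fine_ge0 ?Lip_upper_ge0.
Qed.

(** The points where a maximal function of the energy, over the radii up to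
    2 rho, is at most t. The factor A + 1 makes t ^ q times the measure a
    bound for the energy, as used with the Poincare inequality, and for A times
    the energy, as used with the a priori inequality. *)
Definition good (t rho : R) (x : X) : Prop := forall z (s : R), 0 < s <= 2 * rho ->
  ball z s x -> (A + 1) * nu z (tau * s) <= t `^ q * bm z s.

(** The centres stay near w so that all balls concerned lie in a fixed multiple
    of the ball of radius rho about w, whose energy bounds the measure. *)
Definition bad_set (t rho : R) (w : X) : set X :=
  \bigcup_(i in [set i : X * R | [/\ 0 < i.2 <= 2 * rho, mdist w i.1 < 4 * rho &
     t `^ q * bm i.1 i.2 < (A + 1) * nu i.1 (tau * i.2)]]) ball i.1 i.2.

Lemma open_bad_set t rho w : open (bad_set t rho w).
Proof. by apply: bigcup_open => i _; exact: open_metric_ball. Qed.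

Lemma not_bad_good t rho w x : ball w (2 * rho) x -> ~ bad_set t rho w x ->
  good t rho x.
Proof.
move=> /ballP wx xbad z s /andP[s0 s2] zx; rewrite leNgt; apply/negP => h.
apply: xbad; exists (z, s) => //; split => //=; first by rewrite s0.
move/ballP: zx; have := metric_triangle w x z; rewrite (metric_sym x z).
lra.
Qed.

Lemma bad_set_le t t' rho w : 0 <= t -> t <= t' ->
  bad_set t' rho w `<=` bad_set t rho w.
Proof.
move=> t0 tt' x [i [h1 h2 h3] ix]; exists i => //; split => //.
apply: le_lt_trans h3; rewrite ler_wpM2r// ?fine_ge0 ?outer_measure_ge0//.
by apply: powR_le => //; exact: ltW.
Qed.

(** On each bad ball the measure is at most (A + 1) / t ^ q times the energy of
    the enlarged ball. *)
Lemma bad_set_measure (t rho r : R) w n : 0 < t -> 0 < rho -> 6 * rho <= r ->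
  5 * tau <= 2 ^+ n ->
  (mu (bad_set t rho w) <=
    (CD ^+ n * ((A + 1) / t `^ q) * nu w (tau * r))%:E)%E.
Proof.
move=> t0 rho0 rr tn.
have tr0 : 0 < tau * r by rewrite mulr_gt0//; lra.
have A10 : 0 <= A + 1 by rewrite addr_ge0.
have tq0 : 0 < t `^ q by exact: powR_gt0.
rewrite EFinM -energyE//.
apply: (@covering_weak_type _ _ _ mm CD tau (2 * rho)) => //.
- by rewrite divr_ge0// ltW.
- by move=> x; rewrite lee_fin powR_ge0.
move=> [z s] /= [/andP[s0 s2] wz h]; split; first by rewrite s0.
  apply: sub_ball; apply: (@le_trans _ _ (tau * (4 * rho + s))); last first.
    by rewrite ler_wpM2l ?(ltW tau0)//; lra.
  rewrite mulrDr lerD2r (le_trans (ltW wz))// ler_peMl//; lra.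
have ts0 : 0 < tau * s by rewrite mulr_gt0.
rewrite energyE// (mu_ballE mm _ s0) -EFinM lee_fin.
by rewrite mulrAC ler_pdivlMr// mulrC ltW.
Qed.

(** Mean oscillation in L^q at most a, multiplied out to avoid a quotient. *)
Definition osc (z : X) (s c a : R) : Prop :=
  (\int[m]_(x in ball z s) (`|u x - c| `^ q)%:E <= (a `^ q * bm z s)%:E)%E.

Let measurable_dev z s (c : R) :
  measurable_fun (ball z s : set (caratheodory_type mu))
    (fun x => (`|u x - c| `^ q)%:E).
Proof.
apply/measurable_EFinP; apply: (measurable_funS measurableT) => //.
apply: (measurableT_comp (measurable_powR q)).
apply: measurableT_comp => //; apply: measurable_funB => //.
exact: lipschitz_measurable.
Qed.

(** On the smaller ball u is close in the mean both to c and to c'. *)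
Let osc_compare z (s : R) z' (s' c c' a M : R) : 0 < s -> 0 < s' -> 0 <= a -> 1 <= M ->
  ball z' s' `<=` ball z s -> bm z s <= M * bm z' s' ->
  osc z s c a -> osc z' s' c' a -> `|c - c'| <= 4 * M * a.
Proof.
move=> s0 s0' a0 M1 sub bM oc oc'.
have b0' := bm_gt0 mm z' s0'.
have M0 : 0 <= M by exact: le_trans ler01 M1.
rewrite leNgt; apply/negP => h.
have : ((`|c - c'| `^ q)%:E * mu (ball z' s') <=
    (2 `^ q)%:E * ((a `^ q * bm z s)%:E + (a `^ q * bm z' s')%:E))%E.
  apply: (@le_trans _ _ (\int[m]_(x in ball z' s')
      ((2 `^ q)%:E * ((`|u x - c| `^ q)%:E + (`|u x - c'| `^ q)%:E)))%E).
    apply: const_le_integral => //; first exact: measurable_ball_cara.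
      by move=> x _; rewrite mule_ge0// adde_ge0.
    move=> x _; rewrite -EFinD -EFinM lee_fin.
    apply: le_trans (powRD_le (ltW q0) (normr_ge0 _) (normr_ge0 _)).
    apply: powR_le => //; first exact: ltW.
    by rewrite (distrC (u x)) -[X in `|X|](subrKA (u x)) (le_trans (ler_normD _ _)).
  rewrite ge0_integralZl//; last 3 first.
  - exact: measurable_ball_cara.
  - by apply: emeasurable_funD; exact: measurable_dev.
  - by move=> x _; rewrite adde_ge0.
  rewrite lee_wpmul2l ?lee_fin ?powR_ge0//.
  have mB := measurable_ball_cara mm z' s'.
  rewrite (ge0_integralD m mB _ (@measurable_dev z' s' c) _ (@measurable_dev z' s' c'))//.
  apply: leeD => //; apply: le_trans oc.
  by apply: integral_le_nonmeasurable.
rewrite (mu_ballE mm _ s0') -EFinD -!EFinM lee_fin leNgt => /negP; apply.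
apply: (@le_lt_trans _ _ ((4 * M * a) `^ q * bm z' s')); last first.
  rewrite ltr_pM2r// gt0_ltr_powR ?nnegrE//.
  by rewrite !mulr_ge0.
rewrite -mulrDr mulrA powRM ?mulr_ge0// (_ : 4 * M = 2 * (2 * M)); last by ring.
rewrite (powRM _ (_ : 0 <= 2)) ?mulr_ge0// -!mulrA ler_wpM2l ?powR_ge0//.
rewrite mulrCA ler_wpM2l ?powR_ge0//.
apply: (@le_trans _ _ (2 * M * bm z' s')); last first.
  rewrite ler_wpM2r ?(ltW b0')// -[leLHS]powRr1 ?mulr_ge0//.
  by rewrite ler_powR//; lra.
have := ler_wpM2r (ltW b0') M1; lra.
Qed.

Let osc_le z (s c a b : R) : 0 < s -> 0 <= a -> a <= b -> osc z s c a -> osc z s c b.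
Proof.
move=> s0 a0 ab h; apply: (le_trans h); rewrite lee_fin ler_wpM2r//.
  by rewrite ltW// bm_gt0.
by apply: powR_le => //; exact: ltW.
Qed.

Definition osc_const : R := 2 * (CP + 1).
Local Notation Q := osc_const.

Let Q2 : 2 <= Q. Proof. by rewrite /osc_const; have := CP0; lra. Qed.
Let Q0 : 0 <= Q. Proof. exact: le_trans Q2. Qed.

Let good_osc (t rho s : R) x z : 0 <= t -> good t rho x -> 0 < s <= 2 * rho ->
  ball z s x -> exists c, osc z s c (Q * t * s).
Proof.
move=> t0 gx ss zx; have /andP[s0 _] := ss.
have [c hc] := poincare_energy z s0; exists c; apply: (le_trans hc).
rewrite lee_fin; have b0 := bm_gt0 mm z s0.
have h : nu z (tau * s) <= t `^ q * bm z s.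
  apply: le_trans (gx _ _ ss zx); rewrite ler_peMl ?energy_ge0//.
  by rewrite lerDr.
have P0 : 0 <= CP * (2 * s) `^ q by rewrite mulr_ge0 ?powR_ge0 ?(ltW CP0).
apply: (le_trans (ler_wpM2l P0 h)); rewrite mulrA ler_wpM2r ?(ltW b0)//.
have s2 : 0 <= 2 * s by rewrite mulr_ge0// ltW.
have -> : Q * t * s = (CP + 1) * (2 * s) * t by rewrite /osc_const; ring.
have CP1 : 0 <= CP + 1 by have := CP0; lra.
rewrite (powRM _ (mulr_ge0 CP1 s2) t0) (powRM _ CP1 s2) ler_wpM2r ?powR_ge0//.
rewrite ler_wpM2r ?powR_ge0// (@le_trans _ _ (CP + 1)) ?lerDl//.
rewrite -[leLHS]powRr1// ler_powR// lerDr; exact: ltW.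
Qed.

Let lip_const : exists2 L : R, 0 <= L & forall x y, `|u x - u y| <= L * mdist x y.
Proof. by have [L /ltW] := Lipschitz_ge0 uL; exists L. Qed.

(** Telescoping over the concentric balls of radii s / 2 ^ n. *)
Let good_osc_center (t rho s c : R) x : 0 <= t -> good t rho x -> 0 < s <= 2 * rho ->
  osc x s c (Q * t * s) -> `|c - u x| <= 8 * CD * Q * t * s.
Proof.
move=> t0 gx ss oc; have [L L0 uLip] := lip_const.
have Qt0 : 0 <= Q * t by rewrite mulr_ge0.
(* The base case uses that u is Lipschitz; each halving of the radius halves
   its error, of which the weaker decay 1 / (n + 1) is recorded. *)
have claim n : forall (s c : R), 0 < s <= 2 * rho -> osc x s c (Q * t * s) ->
    `|c - u x| <= 8 * CD * Q * t * s + 4 * (Q * t + L) * s * n.+1%:R^-1.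
  elim: n => [|n IH] {ss oc c}s c ss oc; have /andP[s0 s2] := ss.
    have h : osc x s (u x) ((Q * t + L) * s).
      rewrite /osc EFinM -(mu_ballE mm)//.
      rewrite -[leRHS](integral_cst m (measurable_ball_cara mm x s)).
      apply: integral_le_nonmeasurable => // y /ballP xy; rewrite /= lee_fin ?powR_ge0//.
      apply: powR_le => //; first exact: ltW.
      rewrite distrC (le_trans (uLip _ _))// (@le_trans _ _ (L * s))//.
        by rewrite ler_wpM2l// ltW.
      by rewrite ler_wpM2r ?(ltW s0)// lerDr.
    have a0 : 0 <= (Q * t + L) * s by rewrite mulr_ge0 ?addr_ge0// ltW.
    have h1 : osc x s c ((Q * t + L) * s).
      apply: osc_le oc => //; first by rewrite mulr_ge0// ltW.
      by rewrite ler_wpM2r ?(ltW s0)// lerDl.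
    have := osc_compare s0 s0 a0 (lexx 1) (@subset_refl _ _) _ h1 h.
    rewrite mul1r mulr1 invr1 mulr1 mulrA => /(_ (lexx _)) h2.
    apply: (le_trans h2); rewrite lerDr mulr_ge0 ?(ltW s0)//.
    by rewrite -(mulrA _ Q t) mulr_ge0// mulr_ge0.
  have s20 : 0 < s / 2 by lra.
  have ss' : 0 < s / 2 <= 2 * rho by rewrite s20; lra.
  have xx : ball x (s / 2) x by exact: ballxx.
  have [c' oc'] := good_osc t0 gx ss' xx.
  have h1 := IH _ _ ss' oc'.
  have a0 : 0 <= Q * t * s by rewrite mulr_ge0 ?(ltW s0).
  have sub : ball x (s / 2) `<=` ball x s by apply: le_ball; lra.
  have bM : bm x s <= CD * bm x (s / 2).
    rewrite -[CD]expr1; apply: (ball_measure_le mm dbl CD0 s0).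
    by rewrite mdistxx expr1; lra.
  have oc2 : osc x (s / 2) c' (Q * t * s).
    apply: osc_le oc' => //; first by rewrite mulr_ge0// ltW.
    by rewrite ler_wpM2l//; lra.
  have h2 := osc_compare s0 s20 a0 CD1 sub bM oc oc2.
  have -> : c - u x = (c - c') + (c' - u x) by ring.
  apply: (le_trans (ler_normD _ _)); apply: (le_trans (lerD h2 h1)).
  have n2 : n.+1%:R^-1 <= 2 * n.+2%:R^-1 :> R.
    rewrite ler_pdivlMr// mulrC ler_pdivrMr//.
    by rewrite -natrM ler_nat mul2n -addnn addSn !ltnS leq_addl.
  have K0 : 0 <= 4 * (Q * t + L) * (s / 2).
    by rewrite !mulr_ge0 ?addr_ge0// ltW.
  have := ler_wpM2l K0 n2; move: (n.+1%:R^-1) (n.+2%:R^-1) => i j; lra.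
apply/ler_addgt0Pr => e e0.
pose K := 4 * (Q * t + L) * s.
have K0 : 0 <= K.
  by case/andP: ss => s0 _; rewrite /K mulr_ge0 ?(ltW s0)// mulr_ge0 ?addr_ge0.
have K1 : 0 < K + 1 by rewrite ltr_wpDl.
have [N HN] := invS_lt (divr_gt0 e0 K1).
apply: (le_trans (claim N _ _ ss oc)); rewrite lerD2l -/K.
have := ler_wpM2l K0 (ltW (HN N (leqnn _))) => h; apply: (le_trans h).
by rewrite mulrCA ger_pMr// ler_pdivrMr// mul1r lerDl.
Qed.

Definition good_lip : R := 32 * CD ^+ 2 * Q.
Local Notation C3 := good_lip.

Let CD2 : CD <= CD ^+ 2. Proof. by rewrite expr2 ler_peMl. Qed.

(** The telescoping sums at x and y are joined by comparing the ball of radius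
    2 d about x with the ball of radius d about y which it contains. *)
Lemma good_lipschitz (t rho : R) x y : 0 <= t -> good t rho x -> good t rho y ->
  mdist x y < rho -> `|u x - u y| <= C3 * t * mdist x y.
Proof.
move=> t0 gx gy dr; have [L L0 uLip] := lip_const.
have [d0|d0] := eqVneq (mdist x y) 0.
  by rewrite d0 mulr0; have := uLip x y; rewrite d0 mulr0.
have {}d0 : 0 < mdist x y by rewrite lt_neqAle eq_sym d0 mdist_ge0.
set d := mdist x y in dr d0 *.
have s1 : 0 < 2 * d <= 2 * rho by lra.
have s2 : 0 < d <= 2 * rho by lra.
have d20 : 0 < 2 * d by lra.
have [c oc] := good_osc t0 gx s1 (ballxx x d20).
have [c' oc'] := good_osc t0 gy s2 (ballxx y d0).
have h1 := good_osc_center t0 gx s1 oc.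
have h2 := good_osc_center t0 gy s2 oc'.
have Qt0 : 0 <= Q * t by rewrite mulr_ge0.
have a0 : 0 <= Q * t * (2 * d) by rewrite mulr_ge0// ltW.
have sub : ball y d `<=` ball x (2 * d) by apply: sub_ball; rewrite -/d; lra.
have bM : bm x (2 * d) <= CD ^+ 2 * bm y d.
  apply: (ball_measure_le mm dbl CD0 d20).
  by rewrite metric_sym -/d expr2; lra.
have oc2 : osc y d c' (Q * t * (2 * d)).
  apply: osc_le oc' => //; first by rewrite mulr_ge0// ltW.
  by rewrite ler_wpM2l//; lra.
have CDs1 : 1 <= CD ^+ 2 by exact: le_trans CD1 CD2.
have h3 := osc_compare d20 d0 a0 CDs1 sub bM oc oc2.
have -> : u x - u y = (c - c') - (c - u x) + (c' - u y) by ring.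
apply: (le_trans (ler_normD _ _)); apply: (le_trans (lerD (ler_normB _ _) h2)).
apply: (le_trans (lerD (lerD h3 h1) (lexx _))).
have Qd0 : 0 <= Q * t * d by rewrite mulr_ge0// ltW.
by have := ler_wpM2r Qd0 CD2; rewrite /good_lip; lra.
Qed.

Hypothesis apriori : forall y (s : R), E y -> 0 < s ->
  (\int[m]_(x in ball y s) (u x `^ q)%:E <= (A * s `^ q * nu y (tau * s))%:E)%E.

(** On the ball of radius 2 d about y the a priori inequality shows that u has
    mean oscillation at most 2 d t around 0. *)
Lemma good_dist_le (t rho : R) x y : 0 <= t -> good t rho x -> E y ->
  mdist x y < rho -> u x <= C3 * t * mdist x y.
Proof.
move=> t0 gx Ey dr; have [L L0 uLip] := lip_const.
have [d0|d0] := eqVneq (mdist x y) 0.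
  have := uLip x y; rewrite d0 !mulr0 (uE Ey) subr0 => h.
  exact: le_trans (ler_norm _) h.
have {}d0 : 0 < mdist x y by rewrite lt_neqAle eq_sym d0 mdist_ge0.
set d := mdist x y in dr d0 *.
have s1 : 0 < 2 * d <= 2 * rho by lra.
have s2 : 0 < d <= 2 * rho by lra.
have d20 : 0 < 2 * d by lra.
have yx : ball y (2 * d) x by apply/ballP; rewrite metric_sym -/d; lra.
have [c' oc'] := good_osc t0 gx s2 (ballxx x d0).
have h2 := good_osc_center t0 gx s2 oc'.
have Qt0 : 0 <= Q * t by rewrite mulr_ge0.
have Qd0 : 0 <= Q * t * d by rewrite mulr_ge0// ltW.
have oc : osc y (2 * d) 0 (Q * t * d).
  rewrite /osc; under eq_integral do rewrite subr0 ger0_norm//.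
  apply: (le_trans (apriori Ey d20)); rewrite lee_fin.
  have h : A * nu y (tau * (2 * d)) <= t `^ q * bm y (2 * d).
    apply: le_trans (gx _ _ s1 yx); rewrite ler_wpM2r ?energy_ge0//.
    by rewrite lerDl.
  rewrite mulrAC (le_trans (ler_wpM2r (powR_ge0 _ _) h))//.
  rewrite mulrAC -powRM ?(ltW d20)// ler_wpM2r ?(ltW (bm_gt0 mm y d20))//.
  apply: powR_le; [exact: ltW|by rewrite mulr_ge0// ltW|].
  have td0 : 0 <= t * d by rewrite mulr_ge0// ltW.
  by have := ler_wpM2r td0 Q2; lra.
have sub : ball x d `<=` ball y (2 * d).
  by apply: sub_ball; rewrite metric_sym -/d; lra.
have bM : bm y (2 * d) <= CD ^+ 2 * bm x d.
  apply: (ball_measure_le mm dbl CD0 d20).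
  by rewrite -/d expr2; lra.
have CDs1 : 1 <= CD ^+ 2 by exact: le_trans CD1 CD2.
have := osc_compare d20 d0 Qd0 CDs1 sub bM oc oc'.
rewrite sub0r normrN => h3.
have -> : u x = c' - (c' - u x) by ring.
apply: (le_trans (ler_norm _)); apply: (le_trans (ler_normB _ _)).
apply: (le_trans (lerD h3 h2)).
have CDQ := ler_wpM2r Qd0 CD2; have CDQ2 : 0 <= CD ^+ 2 * (Q * t * d).
  by rewrite mulr_ge0// exprn_ge0.
by rewrite /good_lip; lra.
Qed.

(** * Extension of the truncations *)

Let C30 : 0 <= C3. Proof. by rewrite /good_lip mulr_ge0// mulr_ge0// exprn_ge0. Qed.

Lemma good_lip_ge1 : 1 <= C3.
Proof.
have CDs1 : 1 <= CD ^+ 2 by exact: le_trans CD1 CD2.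
have Q1 : 1 <= Q by apply: le_trans Q2; rewrite ler1n.
rewrite /good_lip -[leLHS]mul1r; apply: ler_pM => //.
by rewrite -[leLHS]mul1r; apply: ler_pM => //; rewrite ler1n.
Qed.

(** Off the bad set the truncation is Lipschitz with a constant proportional to
    the level, so McShane's extension replaces it on the bad set only. *)
Lemma truncation_extension (t rho b : R) (w : X) : 0 <= t -> 0 < rho -> 0 < b ->
  b <= t * rho -> E w ->
  exists om : X -> R, [/\ forall x y, `|om x - om y| <= C3 * t * mdist x y,
    forall x, 0 <= om x,
    forall x, E x -> om x = 0,
    forall x, ball w (2 * rho) x -> ~ bad_set t rho w x -> om x = Num.min (u x) b &
    mu [set x | [/\ ball w (2 * rho) x, ~ bad_set t rho w x &
      ~ (Lip_upper om x <= (g x)%:E)%E]] = 0%E].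
Proof.
move=> t0 rho0 b0 btr Ew.
pose G := ball w (2 * rho) `\` bad_set t rho w.
have Ggood x : G x -> good t rho x by move=> [wx xU]; exact: not_bad_good wx xU.
pose v x := Num.min (u x) b.
have vE x : E x -> v x = 0 by move=> Ex; rewrite /v uE// min_l// ltW.
have v0 x : 0 <= v x by rewrite /v le_min u0 ltW.
have vb x : v x <= b by rewrite /v ge_min lexx orbT.
have C3t0 : 0 <= C3 * t by rewrite mulr_ge0.
have vfar x y : rho <= mdist x y -> `|v x - v y| <= C3 * t * mdist x y.
  move=> d; apply: (@le_trans _ _ b).
    rewrite ler_norml; have := v0 x; have := v0 y; have := vb x; have := vb y.
    by move=> *; apply/andP; split; lra.
  apply: (le_trans btr); rewrite -mulrA -[leLHS]mul1r ler_pM ?good_lip_ge1//.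
    by rewrite mulr_ge0// ltW.
  by rewrite ler_wpM2l.
have vGE x y : G x -> E y -> `|v x - v y| <= C3 * t * mdist x y.
  move=> Gx Ey; have [dr|dr] := ltP (mdist x y) rho; last exact: vfar.
  rewrite (vE y)// subr0 ger0_norm//.
  apply: le_trans (good_dist_le t0 (Ggood _ Gx) Ey dr).
  by rewrite /v ge_min lexx.
have [om [omL omv om0]] : exists om : X -> R,
    [/\ forall x y, `|om x - om y| <= C3 * t * mdist x y,
      forall x, (G `|` E) x -> om x = v x & forall x, 0 <= om x].
  apply: mcshane_extension => //; first by exists w; right.
  move=> x y [Gx|Ex] [Gy|Ey].
  - have [dr|dr] := ltP (mdist x y) rho; last exact: vfar.
    apply: (le_trans (dist_minr_le _ _ _)).
    exact: good_lipschitz t0 (Ggood _ Gx) (Ggood _ Gy) dr.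
  - exact: vGE.
  - by rewrite distrC metric_sym; exact: vGE.
  - by rewrite !vE// subrr normr0 mulr_ge0// mdist_ge0.
exists om; split => //.
- by move=> x Ex; rewrite omv ?vE//; right.
- by move=> x wx xU; rewrite omv//; left.
pose f x := om x - v x.
have [L L0 uLip] := lip_const.
have fL : Lipschitz f.
  exists (C3 * t + L) => x y.
  have -> : f x - f y = (om x - om y) - (v x - v y) by rewrite /f; ring.
  rewrite (le_trans (ler_normB _ _))// mulrDl lerD//.
  exact: le_trans (dist_minr_le _ _ _) (uLip x y).
have f0 x : ball w (2 * rho) x -> ~ bad_set t rho w x -> f x = 0.
  by move=> wx xU; rewrite /f omv ?subrr//; left.
have r0 : 0 < 2 * rho by lra.
have := Lip_upper_zero_ae mm dbl CD1 r0 (@open_bad_set t rho w) fL f0.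
move=> N0; apply/eqP; rewrite eq_le outer_measure_ge0 andbT -N0.
apply: le_outer_measure => x /= [wx xU h]; split => //.
rewrite ltNge; apply/negP => f00; apply: h.
have := Lip_upper_dominated ler01 ler01 (lexx 0) f00 (lipg x) (f := om).
rewrite mulr0 add0r addr0 mul1r; apply => y.
rewrite mul0r addr0 !mul1r.
have -> : om y - om x = (f y - f x) + (v y - v x) by rewrite /f; ring.
apply: (le_trans (ler_normD _ _)); rewrite lerD2l.
exact: dist_minr_le.
Qed.

(** * The test function *)

Variables (p : R) (n : nat).
Hypotheses (qp : q <= p) (taun : 5 * tau <= 2 ^+ n).

Let p0 : 0 < p. Proof. exact: lt_le_trans q0 qp. Qed.

Section test_function.
Variables (w : X) (rho s T : R) (k : nat).
Hypotheses (Ew : E w) (rho0 : 0 < rho) (s0 : 0 < s) (T1 : 1 <= T) (k0 : (0 < k)%N).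

Let T0 : 0 < T. Proof. exact: lt_le_trans ltr01 T1. Qed.
Let lev j : R := 2 ^+ j * T * s.
Local Notation U j := (bad_set (lev j) rho w).
Let I : R := nu w (tau * (32 * rho)).

Hypothesis dev : (\int[m]_(x in ball w (32 * rho)) (`|u x - s * rho| `^ q)%:E <=
  (CP * (64 * rho) `^ q * I)%:E)%E.

(** The four terms come from the gradients of the extensions on the bad sets,
    from their gradients elsewhere, and from the gradient of the cutoff, which
    counts on the bad set of the lowest level and where u is far from s rho. *)
Definition test_energy : R :=
  (4 * C3 / k%:R) `^ p * (k%:R * (2 ^+ k * T) `^ (p - q) * (CD ^+ n * (A + 1))) +
  2 `^ p * (C3 * (2 ^+ k * T)) `^ (p - q) +
  (CD ^+ n * (A + 1) / T `^ q + CP * 128 `^ q).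

Let lev_gt0 j : 0 < lev j. Proof. by rewrite /lev !mulr_gt0// exprn_gt0. Qed.

Let lev_mono i j : (i <= j)%N -> lev i <= lev j.
Proof.
move=> ij; rewrite /lev -!mulrA ler_wpM2r ?mulr_ge0 ?(ltW T0) ?(ltW s0)//.
by rewrite ler_weXn2l// ler1n.
Qed.

Let om_exists : exists om : nat -> X -> R, forall j,
  [/\ forall x y, `|om j x - om j y| <= C3 * lev j * mdist x y,
    forall x, 0 <= om j x,
    forall x, E x -> om j x = 0,
    forall x, ball w (2 * rho) x -> ~ U j x -> om j x = Num.min (u x) (s * rho) &
    mu [set x | [/\ ball w (2 * rho) x, ~ U j x &
      ~ (Lip_upper (om j) x <= (g x)%:E)%E]] = 0%E].
Proof.
suff /choice[om omP] : forall j, exists om : X -> R,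
  [/\ forall x y, `|om x - om y| <= C3 * lev j * mdist x y,
    forall x, 0 <= om x,
    forall x, E x -> om x = 0,
    forall x, ball w (2 * rho) x -> ~ U j x -> om x = Num.min (u x) (s * rho) &
    mu [set x | [/\ ball w (2 * rho) x, ~ U j x &
      ~ (Lip_upper om x <= (g x)%:E)%E]] = 0%E] by exists om.
move=> j; apply: truncation_extension => //; first exact: ltW.
  exact: mulr_gt0.
rewrite ler_wpM2r ?(ltW rho0)//; apply: le_trans (lev_mono (leq0n j)).
by rewrite /lev expr0 mul1r ler_peMl// ltW.
Qed.

(** Since the levels are dyadic, the p-th power of the sum over them is bounded
    by the sum of the p-th powers. The function min(gx, C3 lev k) is where the
    exponent p is traded for q. *)
Let pointwise (gx chi dv : R) (P : nat -> bool) :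
  0 <= gx -> 0 <= chi -> chi `^ p <= (P 0%N)%:R + (2 / (s * rho)) `^ q * dv ->
  (rho^-1 * (2 * C3 * T / k%:R * (\sum_(j < k) 2 ^+ j * (P j)%:R) +
     2 / s * Num.min gx (C3 * lev k) + chi)) `^ p <=
  3 `^ p * (rho `^ p)^-1 *
    ((4 * C3 / k%:R * T) `^ p * (\sum_(j < k) (2 ^+ j) `^ p * (P j)%:R) +
     2 `^ p * (C3 * (2 ^+ k * T)) `^ (p - q) / s `^ q * gx `^ q +
     ((P 0%N)%:R + (2 / (s * rho)) `^ q * dv)).
Proof.
move=> g0 c0 hc.
have kR0 : 0 < k%:R :> R by rewrite ltr0n.
have sum0 : 0 <= \sum_(j < k) 2 ^+ j * (P j)%:R :> R.
  by apply: sumr_ge0 => j _; rewrite mulr_ge0 ?exprn_ge0.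
have al0 : 0 <= 2 * C3 * T / k%:R.
  by rewrite divr_ge0 ?(ltW kR0)// mulr_ge0 ?(ltW T0)// mulr_ge0.
have C3k0 : 0 <= C3 * lev k by rewrite mulr_ge0// ltW.
have m0 : 0 <= Num.min gx (C3 * lev k) by rewrite le_min g0.
have s20 : 0 <= 2 / s by rewrite divr_ge0// ltW.
have b10 := mulr_ge0 al0 sum0; have b20 := mulr_ge0 s20 m0.
have ri0 : 0 <= rho^-1 by rewrite invr_ge0 ltW.
rewrite [leLHS]powRM ?addr_ge0// powRV ?(ltW rho0)//.
rewrite [leRHS]mulrAC [leLHS]mulrC ler_wpM2r ?invr_ge0 ?powR_ge0//.
apply: (le_trans (powRD3_le (ltW p0) b10 b20 c0)).
rewrite ler_wpM2l ?powR_ge0// lerD// ?lerD//.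
  rewrite [leLHS]powRM// (_ : 4 * C3 / k%:R * T = 2 * C3 * T / k%:R * 2); last by ring.
  rewrite [in leRHS]powRM// -[leRHS]mulrA ler_wpM2l ?powR_ge0//.
  exact: dyadic_sum_powR_le.
rewrite [leLHS]powRM// (powR_split (Num.min _ _) q p0).
rewrite [(2 / s) `^ p]powRM ?invr_ge0 ?(ltW s0)//.
rewrite powRV ?(ltW s0)//.
have h1 : Num.min gx (C3 * lev k) `^ q <= gx `^ q.
  by apply: powR_le; rewrite ?(ltW q0)// ge_min lexx.
have h2 : Num.min gx (C3 * lev k) `^ (p - q) <=
    (C3 * (2 ^+ k * T)) `^ (p - q) * (s `^ p / s `^ q).
  rewrite (powR_split s q p0) mulfK ?gt_eqF ?powR_gt0// -powRM ?(ltW s0)//; last first.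
    by rewrite mulr_ge0// mulr_ge0 ?exprn_ge0// ltW.
  apply: powR_le; rewrite ?subr_ge0// ge_min; apply/orP; right.
  by rewrite /lev !mulrA.
have := ler_pM (powR_ge0 _ _) (powR_ge0 _ _) h2 h1 => h.
have D0 : 0 <= 2 `^ p / s `^ p by rewrite divr_ge0// powR_ge0.
apply: (le_trans (ler_wpM2l D0 h)).
rewrite le_eqVlt; apply/orP; left; apply/eqP.
by field; rewrite !gt_eqF ?powR_gt0.
Qed.

(** The bad set of level 2 ^ j T s contributes (2 ^ j T) ^ p times its measure,
    that is a power p - q of the level, which is largest for j = k. *)
Let test_energy_bound : exists2 Phi : R,
  integral_bound m (ball w (2 * rho)) (fun x => 3 `^ p * (rho `^ p)^-1 *
    ((4 * C3 / k%:R * T) `^ p * (\sum_(j < k) (2 ^+ j) `^ p * \1_(U j) x) +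
     2 `^ p * (C3 * (2 ^+ k * T)) `^ (p - q) / s `^ q * g x `^ q +
     (\1_(U 0) x + (2 / (s * rho)) `^ q * `|u x - s * rho| `^ q))) Phi &
  Phi <= 3 `^ p / rho `^ p * (I / s `^ q) * test_energy.
Proof.
have r60 : 6 * rho <= 32 * rho by rewrite ler_wpM2r ?(ltW rho0)// ler_nat.
have r20 : 2 * rho <= 32 * rho by rewrite ler_wpM2r ?(ltW rho0)// ler_nat.
have r320 : 0 < 32 * rho by rewrite mulr_gt0.
have mB : measurable (ball w (2 * rho) : set (caratheodory_type mu)).
  exact: measurable_ball_cara.
have bU j : integral_bound m (ball w (2 * rho)) (\1_(U j))
    (CD ^+ n * ((A + 1) / lev j `^ q) * I).
  apply: integral_bound_indic => //.
    by apply: open_caratheodory => //; exact: open_bad_set.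
  exact: bad_set_measure.
have bg : integral_bound m (ball w (2 * rho)) (fun x => g x `^ q) I.
  split; first exact: (measurableT_comp (measurable_powR q) mg).
    by move=> x; rewrite powR_ge0.
  rewrite /I -energyE ?mulr_gt0//; apply: integral_le_nonmeasurable => //.
  - by move=> x _; rewrite lee_fin powR_ge0.
  - by move=> x _; rewrite lee_fin powR_ge0.
  apply: le_ball; rewrite (le_trans r20)// ler_peMl// ltW//.
have bd : integral_bound m (ball w (2 * rho)) (fun x => `|u x - s * rho| `^ q)
    (CP * (64 * rho) `^ q * I).
  split.
  - apply: (measurableT_comp (measurable_powR q)).
    apply: measurableT_comp => //; apply: measurable_funB => //.
    exact: lipschitz_measurable.
  - by move=> x; rewrite powR_ge0.
  by apply: le_trans dev; apply: integral_le_nonmeasurable => //; exact: le_ball.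
have c10 : 0 <= (4 * C3 / k%:R * T) `^ p by exact: powR_ge0.
have c20 : 0 <= 2 `^ p * (C3 * (2 ^+ k * T)) `^ (p - q) / s `^ q.
  by rewrite divr_ge0 ?powR_ge0// mulr_ge0 ?powR_ge0.
have c30 : 0 <= (2 / (s * rho)) `^ q by exact: powR_ge0.
have c00 : 0 <= 3 `^ p * (rho `^ p)^-1 by rewrite divr_ge0 ?powR_ge0.
have bS := integral_bound_sum mB k
  (fun j => integral_boundZ mB (powR_ge0 (2 ^+ j) p) (bU j)).
eexists; first exact: (integral_boundZ mB c00 (integral_boundD mB
  (integral_boundD mB (integral_boundZ mB c10 bS) (integral_boundZ mB c20 bg))
  (integral_boundD mB (bU 0) (integral_boundZ mB c30 bd)))).
rewrite -[leRHS]mulrA ler_wpM2l//.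
have I0 : 0 <= I by exact: energy_ge0.
have V0 : 0 <= CD ^+ n * (A + 1) by rewrite mulr_ge0 ?exprn_ge0 ?addr_ge0.
have Iq0 : 0 <= I / s `^ q by rewrite divr_ge0 ?powR_ge0.
have kR0 : 0 < k%:R :> R by rewrite ltr0n.
rewrite /test_energy; set V := CD ^+ n * (A + 1) in V0 *.
rewrite !mulrDr; apply: lerD; last apply: lerD.
- apply: lerD; last first.
    by rewrite le_eqVlt; apply/orP; left; apply/eqP; ring.
  rewrite [(4 * C3 / k%:R * T) `^ p]powRM ?(ltW T0)//; last first.
    by rewrite divr_ge0 ?(ltW kR0)// mulr_ge0.
  rewrite [leRHS]mulrCA -[leLHS]mulrA ler_wpM2l ?powR_ge0// mulr_sumr.
  rewrite (_ : I / _ * _ = \sum_(j < k) (2 ^+ k * T) `^ (p - q) *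
    (V * (I / s `^ q))); last first.
    by rewrite sumr_const card_ord -mulr_natl; ring.
  apply: ler_sum => j _.
  have Tj0 : 0 < 2 ^+ j * T by rewrite mulr_gt0// exprn_gt0.
  rewrite (_ : T `^ p * _ = (2 ^+ j * T) `^ (p - q) * (V * (I / s `^ q))).
    apply: ler_wpM2r; first exact: mulr_ge0.
    apply: powR_le; rewrite ?subr_ge0 ?(ltW Tj0)//.
    by rewrite ler_wpM2r ?(ltW T0)// ler_weXn2l ?ler1n// ltnW.
  rewrite mulrA -[T `^ p * _]powRM ?(ltW T0) ?exprn_ge0// (mulrC T).
  rewrite (powR_split _ q p0) /lev (powRM _ (ltW Tj0) (ltW s0)).
  by rewrite /V; field; rewrite !gt_eqF ?powR_gt0.
- rewrite /V /lev expr0 mul1r powRM ?(ltW T0) ?(ltW s0)//.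
  by rewrite le_eqVlt; apply/orP; left; apply/eqP; field; rewrite !gt_eqF ?powR_gt0.
- rewrite (_ : 2 / (s * rho) = 128 / s / (64 * rho)); last first.
    by field; rewrite !gt_eqF.
  have z0 : 0 < 64 * rho by rewrite mulr_gt0.
  move: (64 * rho) z0 => z z0.
  have s1280 : 0 <= 128 / s by rewrite divr_ge0// ltW.
  rewrite (powRM _ s1280) ?invr_ge0 ?(ltW z0)// powRV ?(ltW z0)//.
  rewrite powRM ?invr_ge0 ?(ltW s0)// powRV ?(ltW s0)//.
  by rewrite le_eqVlt; apply/orP; left; apply/eqP; field; rewrite !gt_eqF ?powR_gt0.
Qed.

(** The average of the extensions over the k levels has, almost everywhere, a
    pointwise Lipschitz constant of at most the mean of the levels at which the
    point is bad, plus the truncated g. *)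
Lemma test_function : exists f : X -> R, [/\ Lip0 (ball w (2 * rho)) f,
  forall x, 0 <= f x,
  forall x, E x -> mdist w x <= rho -> f x = 1 &
  (\int[m]_(x in ball w (2 * rho)) (Lip_upper f x `^ p) <=
    (3 `^ p / rho `^ p * (I / s `^ q) * test_energy)%:E)%E].
Proof.
have kR0 : 0 < k%:R :> R by rewrite ltr0n.
have C3l0 j : 0 <= C3 * lev j by rewrite mulr_ge0// ltW.
have [om omP] := om_exists.
pose h x := k%:R^-1 * \sum_(j < k) om j x.
have h0 x : 0 <= h x.
  rewrite /h mulr_ge0 ?invr_ge0 ?(ltW kR0)// sumr_ge0// => j _.
  by have [] := omP j.
have hL x y : `|h x - h y| <= C3 * lev k * mdist x y.
  rewrite /h -mulrBr normrM ger0_norm ?invr_ge0 ?(ltW kR0)//.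
  rewrite mulrC ler_pdivrMr// -sumrB (le_trans (ler_norm_sum _ _ _))//.
  rewrite mulrC mulr_natl -[X in _ *+ X](card_ord k) -sumr_const ler_sum// => j _.
  have [omL _ _ _ _] := omP j; rewrite (le_trans (omL x y))//.
  by rewrite ler_wpM2r ?mdist_ge0// ler_wpM2l// lev_mono// ltnW.
pose a := s * rho / 2; have a0 : 0 < a by rewrite /a divr_gt0// mulr_gt0.
pose f z := cutoff w rho 2 z * Num.max 0 (1 - h z / a).
have psi0 z : 0 <= Num.max 0 (1 - h z / a) by rewrite le_max lexx.
have psi1 z : Num.max 0 (1 - h z / a) <= 1.
  by rewrite ge_max ler01 gerBl divr_ge0// ltW.
have f0 x : 0 <= f x.
  by rewrite /f mulr_ge0//; case/andP: (cutoff_itv w rho 2 x).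
have fL : Lipschitz f.
  exists (rho^-1 + a^-1 * (C3 * lev k)) => x y.
  have -> : f x - f y = cutoff w rho 2 x *
     (Num.max 0 (1 - h x / a) - Num.max 0 (1 - h y / a)) +
    (cutoff w rho 2 x - cutoff w rho 2 y) * Num.max 0 (1 - h y / a).
    by rewrite /f; ring.
  rewrite addrC [leRHS]mulrDl (le_trans (ler_normD _ _))// lerD//.
    rewrite normrM (ger0_norm (psi0 y)) -[leRHS]mulr1 ler_pM//.
    exact: cutoff_lip.
  rewrite normrM -[leRHS]mul1r ler_pM//.
    by have /andP[c0 c1] := cutoff_itv w rho 2 x; rewrite ger0_norm.
  rewrite (le_trans (dist_maxr_le _ _ _))//.
  have -> : 1 - h x / a - (1 - h y / a) = a^-1 * (h y - h x) by ring.
  rewrite normrM gtr0_norm ?invr_gt0// -mulrA ler_wpM2l ?invr_ge0 ?(ltW a0)//.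
  by rewrite distrC.
exists f; split => //.
- split => // x nx; rewrite /f cutoff0 ?mul0r// leNgt; apply/negP => wx.
  by apply: nx; apply/ballP.
- move=> x Ex wx; rewrite /f cutoff1//; last by rewrite (_ : 2 - 1 = 1) ?mul1r//; ring.
  rewrite /h big1; last by move=> j _; have [_ _ ->] := omP j.
  by rewrite mulr0 mul0r subr0 mul1r max_r.
have [Phi [mPhi Phi0 iPhi] PhiE] := test_energy_bound.
apply: (@le_trans _ _ Phi%:E); last by rewrite lee_fin.
apply: le_trans iPhi.
have mL : measurable_function mu (Lip_upper f).
  by have [] := Lip_upper_weak_upper_gradient mm p0 fL.
apply: ae_ge0_le_integral => //.
- exact: measurable_ball_cara.
- by move=> x _; exact: poweR_ge0.
- apply: (measurable_funS measurableT) => //.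
  exact: (measurableT_comp (measurable_poweR p) mL).
- by move=> x _; rewrite lee_fin.
- by apply: (measurable_funS measurableT) => //; apply/measurable_EFinP.
(* Off the null sets N j, the bound by g holds at every level at which x is
   good. *)
pose N j := [set x | [/\ ball w (2 * rho) x, ~ U j x &
  ~ (Lip_upper (om j) x <= (g x)%:E)%E]].
have negN : m.-negligible (\bigcup_j N j).
  by apply: negligible_bigcup => j; apply: null_negligible => //; have [] := omP j.
apply: negligibleS negN => x /= xN; apply: contrapT => nN; apply: xN => wx.
have Lom j : (j < k)%N ->
    (Lip_upper (om j) x <= (C3 * lev j * \1_(U j) x + Num.min (g x) (C3 * lev k))%:E)%E.
  move=> jk; have [omL _ _ _ _] := omP j.
  have LC := Lip_upper_Lip x (C3l0 j) omL.
  have m0 : 0 <= Num.min (g x) (C3 * lev k) by rewrite le_min g_ge0 C3l0.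
  rewrite indicE; case: (boolP (x \in U j)) => [|/negP] xU.
    by rewrite mulr1 (le_trans LC)// lee_fin lerDl.
  rewrite mulr0 add0r EFin_min le_min; apply/andP; split.
    apply: contrapT => h'; apply: nN; exists j => //; split => //.
    by move=> xU'; apply: xU; rewrite inE.
  by rewrite (le_trans LC)// lee_fin ler_wpM2l// lev_mono// ltnW.
have Lh : (Lip_upper h x <= (C3 * T * s / k%:R * (\sum_(j < k) 2 ^+ j * \1_(U j) x) +
    Num.min (g x) (C3 * lev k))%:E)%E.
  have LS := Lip_upper_sum Lom.
  have k'0 : 0 <= k%:R^-1 :> R by rewrite invr_ge0 ltW.
  have := Lip_upper_dominated k'0 (lexx 0) (lexx 0) LS LS (f := h).
  rewrite mul0r !addr0 big_split/= sumr_const card_ord.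
  have -> : \sum_(j < k) C3 * lev j * \1_(U j) x =
      C3 * T * s * \sum_(j < k) 2 ^+ j * \1_(U j) x.
    by rewrite mulr_sumr; apply: eq_bigr => j _; rewrite /lev; ring.
  move: (\sum_(j < k) 2 ^+ j * \1_(U j) x) (Num.min _ _) => S mn.
  have -> : k%:R^-1 * (C3 * T * s * S + mn *+ k) = C3 * T * s / k%:R * S + mn.
    by rewrite -[mn *+ k]mulr_natl; field; rewrite gt_eqF.
  apply=> y; rewrite !mul0r !addr0 /h -mulrBr normrM ger0_norm//.
have := Lip_upper_cutoff_tent w rho0 a0 h0 Lh; rewrite -/f.
set L := (X in (_ <= X%:E)%E) => Lf.
apply: (@le_trans _ _ (L `^ p)%:E).
  have Lf0 := Lip_upper_ge0 f x.
  rewrite -(fineK (Lip_upper_fin x fL)) poweR_EFin lee_fin.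
  apply: powR_le; rewrite ?(ltW p0) ?fine_ge0//.
  by rewrite -lee_fin fineK ?Lip_upper_fin.
rewrite lee_fin.
have -> : L = rho^-1 * (2 * C3 * T / k%:R * (\sum_(j < k) 2 ^+ j * (x \in U j)%:R) +
    2 / s * Num.min (g x) (C3 * lev k) + (h x < a)%R%:R).
  rewrite /L /a; have -> : \sum_(j < k) 2 ^+ j * \1_(U j) x =
    \sum_(j < k) 2 ^+ j * (x \in U j)%:R by [].
  move: (\sum_(j < k) _) (Num.min _ _) (h x < _)%R%:R => S mn chi.
  by field; rewrite !gt_eqF.
apply: (@pointwise _ _ _ (fun j => x \in U j)) => //; first exact: g_ge0.
have [hxa|hxa] := ltP (h x) a; last first.
  by rewrite powR0 ?gt_eqF// addr_ge0// mulr_ge0// powR_ge0.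
rewrite powR1; case: (boolP (x \in U 0)) => [|/negP] xU.
  by rewrite lerDl mulr_ge0// powR_ge0.
(* At a good point of the lowest level all extensions equal min(u, s rho). *)
have usr : u x < a.
  apply: contrapT => /negP; rewrite -leNgt => au; move: hxa; apply/negP; rewrite -leNgt.
  rewrite /h mulrC ler_pdivlMr// mulrC mulr_natl -[X in _ *+ X](card_ord k) -sumr_const.
  apply: ler_sum => j _; have [_ _ _ -> //] := omP j.
    rewrite le_min au /a ler_pdivrMr// ler_peMr ?ler1n// ltW// mulr_gt0//.
  move=> xUj; apply: xU; rewrite inE; apply: bad_set_le xUj => //; first exact: ltW.
  by rewrite lev_mono.
rewrite add0r -powRM// ?divr_ge0 ?mulr_ge0 ?(ltW s0) ?(ltW rho0)//.
rewrite [leLHS](_ : 1 = 1 `^ q); last by rewrite powR1.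
apply: powR_le => //; first exact: ltW.
rewrite mulrAC ler_pdivlMr ?mulr_gt0// mul1r distrC.
have := ler_norm (s * rho - u x); move: usr; rewrite /a; lra.
Qed.

End test_function.

(** * Improvement of the a priori constant *)

Variable c0 : R.
Hypotheses (c00 : 0 < c0) (fat : uniformly_fat mu p c0 E).
Hypothesis PIp : poincare mu p CP tau.

(** The constant of the upper bound for the energy, divided by that of the lower
    bound for the capacity of E. *)
Definition fat_const : R := 3 `^ p * (CP * 10 `^ p * 2 `^ p * CD ^+ 3) / c0.

(** The capacity of E in the ball is at most the energy of the test function,
    and at least a fixed part of the capacity of the ball. *)
Let capacity_estimate (w : X) (rho s T : R) (k : nat) : E w -> 0 < rho -> 0 < s ->
  1 <= T -> (0 < k)%N -> (rho%:E < 8^-1%:E * diam [set: X])%E ->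
  (\int[m]_(x in ball w (32 * rho)) (`|u x - s * rho| `^ q)%:E <=
    (CP * (64 * rho) `^ q * nu w (tau * (32 * rho)))%:E)%E ->
  s `^ q * bm w rho <= fat_const * nu w (tau * (32 * rho)) * test_energy T k.
Proof.
move=> Ew rho0 s0 T1 k0 rdiam dev.
have CPp0 : 0 < CP * (10 * rho) `^ p * 2 `^ p * CD ^+ 3.
  rewrite mulr_gt0 ?exprn_gt0//; last exact: lt_le_trans CD1.
  by rewrite mulr_gt0 ?powR_gt0// mulr_gt0// powR_gt0// mulr_gt0.
have [f [f0 fp fE]] := test_function Ew rho0 s0 T1 k0 dev.
set I := nu _ _; set B := test_energy _ _ => fI.
have fL : Lipschitz f by have [] := f0.
have [_ /(_ w rho Ew rho0 rdiam) hfat] := fat.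
have cap1 := capacity_ball_ge mm p0 CP0 tau1 PIp w dbl CD1 rho0 rdiam.
have cap2 : (capacity mu p (E `&` closure (ball w rho)) (ball w (2 * rho)) <=
    (3 `^ p / rho `^ p * (I / s `^ q) * B)%:E)%E.
  apply: le_trans fI; apply: ereal_inf_lbound.
  exists f, (Lip_upper f); split => //.
    by move=> x [Ex wx]; rewrite fE//; exact: closure_ball_le.
  exact: Lip_upper_weak_upper_gradient.
have := le_trans hfat cap2; move/(le_trans (lee_wpmul2l _ cap1)).
rewrite lee_fin => /(_ (ltW c00)); rewrite -EFinM lee_fin => h.
have sq0 : 0 < s `^ q by rewrite powR_gt0.
have rp0 : 0 < rho `^ p by rewrite powR_gt0.
move: h CPp0; rewrite (powRM _ _ (ltW rho0))//.
have -> : CP * (10 `^ p * rho `^ p) * 2 `^ p * CD ^+ 3 =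
  CP * 10 `^ p * 2 `^ p * CD ^+ 3 * rho `^ p by ring.
rewrite /fat_const (pmulr_lgt0 _ rp0); move: (CP * 10 `^ p * 2 `^ p * CD ^+ 3) => K h K0.
have D0 : 0 <= s `^ q * (K * rho `^ p) / c0.
  by rewrite divr_ge0 ?(ltW c00)// !mulr_ge0// ltW.
have -> : s `^ q * bm w rho =
    s `^ q * (K * rho `^ p) / c0 * (c0 * ((K * rho `^ p)^-1 * bm w rho)).
  by field; rewrite !gt_eqF.
apply: (le_trans (ler_wpM2l D0 h)); rewrite le_eqVlt; apply/orP; left; apply/eqP.
by field; rewrite !gt_eqF.
Qed.

Let test_energy_ge0 (T : R) k : 0 <= T -> 0 <= test_energy T k.
Proof.
move=> T0; have V0 : 0 <= CD ^+ n * (A + 1) by rewrite mulr_ge0 ?exprn_ge0 ?addr_ge0.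
rewrite /test_energy; apply: addr_ge0; last first.
  by rewrite addr_ge0 ?divr_ge0 ?powR_ge0// mulr_ge0 ?powR_ge0// ltW.
apply: addr_ge0; last by rewrite mulr_ge0 ?powR_ge0.
by rewrite mulr_ge0 ?powR_ge0// mulr_ge0// mulr_ge0 ?powR_ge0.
Qed.

Lemma fat_const_gt0 : 0 < fat_const.
Proof.
rewrite divr_gt0// mulr_gt0 ?powR_gt0// mulr_gt0 ?exprn_gt0//; last first.
  exact: lt_le_trans CD1.
by rewrite mulr_gt0 ?powR_gt0// mulr_gt0// powR_gt0.
Qed.

(** The Poincare inequality on the large ball reduces the claim to a bound for
    the constant c that u is compared with. *)
Lemma energy_step (w : X) (r T : R) (k : nat) : E w -> 0 < r -> 1 <= T ->
  (0 < k)%N -> ((r / 32)%:E < 8^-1%:E * diam [set: X])%E ->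
  (\int[m]_(x in ball w r) (u x `^ q)%:E <=
    (2 `^ q * (CP * 2 `^ q + CD ^+ 5 * (fat_const * test_energy T k)) *
      r `^ q * nu w (tau * r))%:E)%E.
Proof.
move=> Ew r0 T1 k0 rdiam; pose rho := r / 32.
have rho0 : 0 < rho by rewrite divr_gt0.
have r32 : 32 * rho = r by rewrite /rho; field.
have r64 : 64 * rho = 2 * r by rewrite /rho; field.
have T0 : 0 <= T by exact: le_trans ler01 T1.
have I0 : 0 <= nu w (tau * r) by exact: energy_ge0.
set I := nu w (tau * r) in I0 *.
have B0 := test_energy_ge0 k T0; set B := test_energy T k in B0 *.
have F0 := ltW fat_const_gt0.
have [c hc] := poincare_energy w r0; rewrite powRM ?(ltW r0)// in hc.
have rq0 : 0 <= r `^ q by exact: powR_ge0.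
have K0 : 0 <= CD ^+ 5 * (fat_const * B) by rewrite mulr_ge0 ?exprn_ge0// mulr_ge0.
have C20 : 0 <= CP * 2 `^ q by rewrite mulr_ge0 ?powR_ge0// ltW.
have twoq : 1 <= 2 `^ q :> R.
  have h12 : 1 <= 2 :> R by rewrite ler1n.
  by have := powR_le (ltW q0) ler01 h12; rewrite powR1.
(* For c <= 0, u is at most its distance from c. *)
have [c_le0|c_gt0] := leP c 0.
  apply: le_trans (le_trans hc _).
    apply: integral_le_nonmeasurable => // x _; rewrite lee_fin ?powR_ge0//.
    apply: powR_le; rewrite ?(ltW q0)//.
    by have := ler_norm (u x - c); lra.
  rewrite lee_fin ler_wpM2r// mulrA ler_wpM2r//.
  rewrite -[leLHS]mul1r; apply: ler_pM => //; by rewrite lerDl.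
pose s := c / rho; have s0 : 0 < s by rewrite divr_gt0.
have sr : s * rho = c by rewrite /s divfK// gt_eqF.
have dev : (\int[m]_(x in ball w (32 * rho)) (`|u x - s * rho| `^ q)%:E <=
    (CP * (64 * rho) `^ q * nu w (tau * (32 * rho)))%:E)%E.
  by rewrite sr r32 r64 powRM// ltW.
have := capacity_estimate Ew rho0 s0 T1 k0 rdiam dev; rewrite r32 -/I -/B => hcap.
have cq : c `^ q * bm w r <= CD ^+ 5 * (fat_const * B) * r `^ q * I.
  have br : bm w r <= CD ^+ 5 * bm w rho.
    apply: (ball_measure_le mm dbl CD0 r0).
    by rewrite mdistxx add0r -r32 -natrX.
  have := ler_wpM2l (powR_ge0 c q) br => /le_trans; apply.
  rewrite -sr (powRM _ (ltW s0) (ltW rho0)).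
  have rr : rho `^ q <= r `^ q.
    by apply: powR_le; rewrite ?(ltW q0) ?(ltW rho0)// -r32 ler_peMl ?(ltW rho0)// ler1n.
  have CD50 : 0 <= CD ^+ 5 by rewrite exprn_ge0.
  rewrite [leLHS](_ : _ = CD ^+ 5 * rho `^ q * (s `^ q * bm w rho)); last by ring.
  rewrite [leRHS](_ : _ = CD ^+ 5 * r `^ q * (fat_const * I * B)); last by ring.
  apply: ler_pM => //; first by rewrite mulr_ge0 ?powR_ge0.
    by rewrite mulr_ge0 ?powR_ge0// ltW// bm_gt0.
  by rewrite ler_wpM2l.
have mB : measurable (ball w r : set (caratheodory_type mu)).
  exact: measurable_ball_cara.
have b1 : integral_bound m (ball w r) (fun x => `|u x - c| `^ q)
    (CP * (2 `^ q * r `^ q) * I).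
  split => //.
  apply: (measurableT_comp (measurable_powR q)).
  apply: measurableT_comp => //; apply: measurable_funB => //.
  exact: lipschitz_measurable.
have b2 : integral_bound m (ball w r) (cst (c `^ q)) (c `^ q * bm w r).
  split => //; first by move=> x; exact: powR_ge0.
  by rewrite EFinM -mu_ballE// -[leRHS](integral_cst m mB).
have [_ _ b3] := integral_boundZ mB (powR_ge0 2 q) (integral_boundD mB b1 b2).
apply: le_trans (le_trans b3 _).
  apply: integral_le_nonmeasurable => // x _; rewrite lee_fin ?powR_ge0//.
    by rewrite mulr_ge0 ?addr_ge0 ?powR_ge0.
  apply: le_trans (powRD_le (ltW q0) (normr_ge0 _) (ltW c_gt0)).
  apply: powR_le; rewrite ?(ltW q0)//.
  by have := ler_norm (u x - c); lra.
rewrite lee_fin -(mulrA (2 `^ q) _ (r `^ q)) -(mulrA (2 `^ q) _ I).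
rewrite ler_wpM2l ?powR_ge0//; move: cq.
by move: (CD ^+ 5 * (fat_const * B)) => K; lra.
Qed.

Definition improved_const (T : R) (k : nat) : R :=
  2 `^ q * (CP * 2 `^ q + CD ^+ 5 * (fat_const * test_energy T k)).

(** A ball of radius at least 4 diam X is the whole space, and so is the
    concentric ball of radius 2 diam X, to which the previous lemma applies. *)
Lemma energy_improvement (w : X) (r T : R) (k : nat) : E w -> 0 < r -> 1 <= T ->
  (0 < k)%N ->
  (\int[m]_(x in ball w r) (u x `^ q)%:E <=
    (improved_const T k * r `^ q * nu w (tau * r))%:E)%E.
Proof.
move=> Ew r0 T1 k0.
have T0 : 0 <= T by exact: le_trans ler01 T1.
have K0 : 0 <= improved_const T k.
  rewrite mulr_ge0 ?powR_ge0// addr_ge0//; first by rewrite mulr_ge0 ?powR_ge0// ltW.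
  by rewrite mulr_ge0 ?exprn_ge0// mulr_ge0 ?test_energy_ge0// ltW// fat_const_gt0.
have [rdiam|rdiam] := ltP (r / 32)%:E (8^-1%:E * diam [set: X])%E.
  exact: energy_step.
have dist_le (x y : X) : ((mdist x y)%:E <= diam [set: X])%E.
  by apply: ereal_sup_ubound; exists (x, y).
have dfin : diam [set: X] \is a fin_num.
  rewrite ge0_fin_numE.
    rewrite ltey; apply/eqP => dy; move: rdiam; rewrite dy.
    by rewrite gt0_muley ?lte_fin ?invr_gt0// leye_eq.
  by apply: le_trans (dist_le w w); rewrite lee_fin mdist_ge0.
set d := fine (diam [set: X]).
have dE : diam [set: X] = d%:E by rewrite fineK.
have {}dist_le (x y : X) : mdist x y <= d by rewrite -lee_fin -dE.
rewrite dE -EFinM lee_fin in rdiam.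
have [d_le0|d0] := leP d 0.
  have H0 : 0 <= improved_const T k * r `^ q * nu w (tau * r).
    by rewrite mulr_ge0 ?energy_ge0// mulr_ge0 ?powR_ge0.
  rewrite integral0_eq ?lee_fin//.
  move=> x _; have [L L0 uLip] := lip_const.
  suff -> : u x = 0 by rewrite powR0// gt_eqF.
  have := uLip x w; rewrite (uE Ew) subr0 => h.
  have m0 : mdist x w = 0.
    by apply/eqP; rewrite eq_le mdist_ge0 (le_trans (dist_le _ _)).
  by apply/eqP; rewrite -normr_le0 (le_trans h)// m0 mulr0.
have d20 : 0 < 2 * d by rewrite mulr_gt0.
have d2r : 2 * d <= r by move: rdiam; lra.
have sub : ball w r `<=` ball w (2 * d).
  by move=> x _; apply/ballP; rewrite (le_lt_trans (dist_le _ _))//; lra.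
have ddiam : ((2 * d / 32)%:E < 8^-1%:E * diam [set: X])%E.
  by rewrite dE -EFinM lte_fin; lra.
apply: (@le_trans _ _ (\int[m]_(x in ball w (2 * d)) (u x `^ q)%:E)%E).
  by apply: integral_le_nonmeasurable => // x _; rewrite lee_fin powR_ge0.
apply: (le_trans (energy_step Ew d20 T1 k0 ddiam)).
rewrite lee_fin -/(improved_const T k) -[leLHS]mulrA -[leRHS]mulrA.
apply: ler_wpM2l => //; apply: ler_pM; rewrite ?powR_ge0 ?energy_ge0//.
  by apply: powR_le => //; exact: ltW.
rewrite -lee_fin -!energyE ?mulr_gt0//; apply: integral_le_nonmeasurable => //.
- by move=> x _; rewrite lee_fin powR_ge0.
- by move=> x _; rewrite lee_fin powR_ge0.
by apply: le_ball; rewrite ler_wpM2l// ltW.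
Qed.

End good_points.

(** * Choice of the parameters and iteration *)

Section hardy_inequality.
Context {R : realType}.
Variables (p p0 CD CP tau c0 : R).
Hypotheses (hp0 : 1 < p0) (hp0p : p0 < p) (CD1 : 1 <= CD) (CP0 : 0 < CP).
Hypotheses (tau1 : 1 <= tau) (c00 : 0 < c0).

Let p1 : 1 < p. Proof. exact: lt_trans hp0p. Qed.

Let powR_le1 (a s t : R) : 1 <= a -> s <= t -> a `^ s <= a `^ t.
Proof. by move=> a1 st; rewrite ler_powR. Qed.

(** First T makes the set where the energy is large negligible, then k makes
    the average of k truncations cheap, and last eps makes the power of the
    highest level 2 ^ k T harmless. *)
Let choose_parameters (M V G : R) : 0 < M -> 0 < V -> 0 < G ->
  exists (eps T : R) (k : nat), [/\ 0 < eps < p - p0, 1 <= T, (0 < k)%N,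
    M * (V / T) <= 4^-1 &
    M * ((G / k%:R) `^ p * (k%:R * 2 * V)) <= 4^-1 /\ (2 ^+ k * T) `^ eps <= 2].
Proof.
move=> M0 V0 G0; have p_gt0 : 0 < p by exact: lt_trans p1.
pose T := Num.max 1 (4 * (M * V)).
have T1 : 1 <= T by rewrite le_max lexx.
have T0 : 0 < T by exact: lt_le_trans T1.
have MT : M * (V / T) <= 4^-1.
  rewrite mulrA ler_pdivrMr// -ler_pdivrMl ?invr_gt0// invrK.
  by rewrite le_max lexx orbT.
pose W := 8 * (M * G `^ p * V).
have W0 : 0 < W by rewrite mulr_gt0// mulr_gt0// mulr_gt0// powR_gt0.
pose k := (Num.truncn (W `^ (p - 1)^-1)).+1.
have k0 : 0 < k%:R :> R by rewrite ltr0n.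
have Wk : W <= k%:R `^ (p - 1).
  have p10 : p - 1 != 0 by rewrite subr_eq0 gt_eqF.
  have -> : W = (W `^ (p - 1)^-1) `^ (p - 1) by rewrite -powRrM mulVf// powRr1 ?ltW.
  by apply: powR_le; rewrite ?powR_ge0 ?subr_ge0 ?(ltW p1)// ltW// truncnS_gt.
have Mk : M * ((G / k%:R) `^ p * (k%:R * 2 * V)) <= 4^-1.
  have kp : k%:R `^ p = k%:R `^ (p - 1) * k%:R :> R.
    by rewrite (powR_split _ 1 p_gt0) powRr1 ?(ltW k0).
  rewrite (powRM _ (ltW G0)) ?invr_ge0 ?(ltW k0)// powRV ?(ltW k0)// kp.
  have kp0 : 0 < k%:R `^ (p - 1) :> R by rewrite powR_gt0.
  rewrite (_ : M * _ = W / 4 / k%:R `^ (p - 1)); last first.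
    by rewrite /W; field; rewrite !gt_eqF.
  by rewrite ler_pdivrMr//; move: Wk; lra.
(* As 2 ^ k T <= 2 ^ m, any eps up to 1 / m will do. *)
pose m := (k + (Num.truncn T).+1)%N.
have m0 : 0 < m%:R :> R by rewrite ltr0n /m addnS.
have mT : 2 ^+ k * T <= 2 ^+ m.
  rewrite /m exprD ler_pM2l ?exprn_gt0// (le_trans (ltW (truncnS_gt T)))//.
  by rewrite -natrX ler_nat ltnW// ltn_expl.
exists (Num.min ((p - p0) / 2) m%:R^-1), T, k; split => //.
  have pp0 : 0 < p - p0 by rewrite subr_gt0.
  rewrite lt_min invr_gt0 m0 andbT divr_gt0//= gt_min; apply/orP; left.
  by rewrite ltr_pdivrMr// ltr_pMr// ltr1n.
split => //.
have kT1 : 1 <= 2 ^+ k * T.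
  by rewrite -[leLHS]mulr1 ler_pM// exprn_ege1// ler1n.
have m10 : 0 <= m%:R^-1 :> R by rewrite invr_ge0 ltW.
apply: (@le_trans _ _ ((2 ^+ k * T) `^ m%:R^-1)).
  by rewrite ler_powR// ge_min lexx orbT.
have := powR_le m10 (le_trans ler01 kT1) mT.
by rewrite -(powR_mulrn m (ler0n _ 2)) -powRrM mulfV ?gt_eqF// powRr1.
Qed.

Lemma improved_const_contracts (n : nat) : exists (eps T : R) (k : nat) (B : R),
  [/\ 0 < eps < p - p0, 1 <= T, (0 < k)%N, 0 <= B & forall A : R, 0 <= A ->
    improved_const CD CP (p - eps) A p n c0 T k <= A / 2 + B].
Proof.
have CD0 : 0 < CD by exact: lt_le_trans CD1.
have p_gt0 : 0 < p by exact: lt_trans p1.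
have M0 : 0 < 2 `^ p * (CD ^+ 5 * fat_const CD CP p c0).
  by rewrite mulr_gt0 ?powR_gt0// mulr_gt0 ?exprn_gt0// fat_const_gt0.
set M := (X in 0 < X) in M0.
have V0 : 0 < CD ^+ n by rewrite exprn_gt0.
set V := (X in 0 < X) in V0.
have C31 : 1 <= good_lip CD CP by exact: good_lip_ge1.
set C3 := (X in 1 <= X) in C31.
have C30 : 0 < C3 by exact: lt_le_trans C31.
have C340 : 0 < 4 * C3 by exact: mulr_gt0.
have [eps [T [k [/andP[eps0 epsp] T1 k1 MT [Mk Te]]]]] := choose_parameters M0 V0 C340.
have T0 : 0 < T by exact: lt_le_trans T1.
have k0 : 0 < k%:R :> R by rewrite ltr0n.
pose B := 2 `^ p * (CP * 2 `^ p) + 2^-1 +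
  M * (2 `^ p * (C3 `^ p * 2) + CP * 128 `^ p).
have B1 : 0 <= CP * 2 `^ p by rewrite mulr_ge0 ?powR_ge0// ltW.
have B2 : 0 <= M * (2 `^ p * (C3 `^ p * 2) + CP * 128 `^ p).
  rewrite mulr_ge0 ?(ltW M0)// addr_ge0//; last by rewrite mulr_ge0 ?powR_ge0// ltW.
  by rewrite mulr_ge0 ?powR_ge0// mulr_ge0 ?powR_ge0.
exists eps, T, k, B; split => //.
- by rewrite eps0.
- by rewrite /B !addr_ge0// mulr_ge0 ?powR_ge0.
move=> A A0; have A10 : 0 <= A + 1 by rewrite addr_ge0.
have qp : p - eps <= p by rewrite gerBl ltW.
have q1 : 1 <= p - eps by move: hp0 epsp; lra.
have two : 1 <= 2 :> R by rewrite ler1n.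
have b128 : 1 <= 128 :> R by rewrite ler1n.
rewrite /improved_const; set TE := test_energy _ _ _ _ _ _ _ _.
have F0 := ltW (fat_const_gt0 CD1 CP0 p c00).
have VA0 : 0 <= V * (A + 1) by rewrite mulr_ge0// ltW.
have kT0 : 0 < 2 ^+ k * T by rewrite mulr_gt0// exprn_gt0.
have TEle : TE <= (4 * C3 / k%:R) `^ p * (k%:R * 2 * (V * (A + 1))) +
    2 `^ p * (C3 `^ p * 2) + (V * (A + 1) / T + CP * 128 `^ p).
  rewrite /TE /test_energy -/V -/C3 subKr; apply: lerD; apply: lerD.
  - by rewrite ler_wpM2l ?powR_ge0// ler_wpM2r// ler_wpM2l// ltW.
  - rewrite ler_wpM2l ?powR_ge0// powRM ?(ltW C30) ?(ltW kT0)//.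
    apply: ler_pM; rewrite ?powR_ge0//; apply: powR_le1 => //.
    by move: hp0 hp0p epsp; lra.
  - rewrite ler_wpM2l// lef_pV2 ?posrE ?powR_gt0//.
    by rewrite -[leLHS](powRr1 (ltW T0)); exact: powR_le1.
  - by rewrite ler_wpM2l ?(ltW CP0)//; exact: powR_le1.
have TE0 : 0 <= TE.
  rewrite /TE /test_energy -/V -/C3 !addr_ge0//.
  - rewrite mulr_ge0 ?powR_ge0// mulr_ge0// mulr_ge0 ?powR_ge0// ltW//.
  - by rewrite mulr_ge0 ?powR_ge0.
  - by rewrite divr_ge0 ?powR_ge0.
  - by rewrite mulr_ge0 ?powR_ge0// ltW.
have q2 : 2 `^ (p - eps) <= 2 `^ p :> R by exact: powR_le1.
apply: (@le_trans _ _ (2 `^ p * (CP * 2 `^ p) + M * TE)).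
  rewrite mulrDr lerD//.
    by apply: ler_pM; rewrite ?powR_ge0 ?mulr_ge0 ?powR_ge0 ?(ltW CP0)// ler_wpM2l ?(ltW CP0).
  have -> : M * TE = 2 `^ p * (CD ^+ 5 * (fat_const CD CP p c0 * TE)).
    by rewrite /M; ring.
  apply: ler_wpM2r => //; rewrite mulr_ge0 ?exprn_ge0 ?(ltW CD0)//.
  exact: mulr_ge0.
have := ler_wpM2l (ltW M0) TEle.
have := ler_wpM2r A10 MT; have := ler_wpM2r A10 Mk; rewrite /B.
move: (M * TE) ((4 * C3 / k%:R) `^ p) (T^-1) => x y z; nra.
Qed.

Section iteration.
Context {X : pmetricType R}.
Variable mu : {outer_measure set X -> \bar R}.
Hypothesis mm : metric_measure mu.
Local Notation m := (cara_measure mu).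
Local Notation bm x r := (fine (mu (ball x r))).
Variables (q T B : R) (n k : nat) (E : set X) (u : X -> R).
Hypotheses (dbl : doubling mu CD) (q1 : 1 <= q) (qp : q <= p).
Hypotheses (PIq : poincare mu q CP tau) (PIp : poincare mu p CP tau).
Hypotheses (fat : uniformly_fat mu p c0 E) (taun : 5 * tau <= 2 ^+ n).
Hypotheses (T1 : 1 <= T) (k0 : (0 < k)%N) (B0 : 0 <= B).
Hypothesis contracts : forall A, 0 <= A ->
  improved_const CD CP q A p n c0 T k <= A / 2 + B.
Hypotheses (uL : Lipschitz u) (uE : forall x, E x -> u x = 0).
Hypothesis u0 : forall x, 0 <= u x.

Let q0 : 0 < q. Proof. exact: lt_le_trans ltr01 q1. Qed.

(** The constant kappa makes the right-hand side large enough for the claim to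
    hold with some constant A; each round replaces A by A / 2 + B. *)
Lemma regularized_hardy (kappa : R) (w : X) (r : R) : 0 < kappa -> E w -> 0 < r ->
  (\int[m]_(x in ball w r) (u x `^ q)%:E <=
    ((2 * B + 1) * r `^ q)%:E *
      \int[m]_(x in ball w (tau * r)) ((fine (Lip_upper u x) + kappa) `^ q)%:E)%E.
Proof.
move=> kap0 Ew r0; pose g x := fine (Lip_upper u x) + kappa.
have [L L0 uLip] := Lipschitz_ge0 uL.
have tau0 : 0 < tau by exact: lt_le_trans tau1.
have lipg x : (Lip_upper u x <= (g x)%:E)%E.
  by rewrite -(fineK (Lip_upper_fin x uL)) lee_fin /g lerDl ltW.
have gbd : exists G : R, forall x, g x <= G.
  exists (L + kappa) => x; rewrite lerD2r -lee_fin (fineK (Lip_upper_fin x uL)).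
  by apply: Lip_upper_Lip => //; exact: ltW.
have mg : measurable_fun [set: caratheodory_type mu] (g : caratheodory_type mu -> R).
  apply: measurable_funD => //; apply: measurableT_comp => //.
  by have [] := Lip_upper_weak_upper_gradient mm q0 uL.
have nuE z (s : R) : 0 < s ->
    (\int[m]_(x in ball z s) (g x `^ q)%:E)%E = (energy mu q g z s)%:E.
  by move=> s0; exact: (energyE mm q1 gbd lipg).
(* On a ball of radius s about a point of E, u is at most L s and g at least
   kappa. *)
pose A0 := (L / kappa) `^ q.
have A00 : 0 <= A0 by exact: powR_ge0.
have start y (s : R) : E y -> 0 < s -> (\int[m]_(x in ball y s) (u x `^ q)%:E <=
    (A0 * s `^ q * energy mu q g y (tau * s))%:E)%E.
  move=> Ey s0; have ts0 : 0 < tau * s by exact: mulr_gt0.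
  have s_ts : s <= tau * s by rewrite ler_peMl// ltW.
  have h : kappa `^ q * bm y s <= energy mu q g y (tau * s).
    rewrite -lee_fin -nuE// EFinM -mu_ballE//; apply: const_le_integral => //.
    - exact: measurable_ball_cara.
    - exact: le_ball.
    - exact: powR_ge0.
    - by move=> x _; rewrite lee_fin powR_ge0.
    move=> x _; rewrite lee_fin; apply: powR_le; rewrite ?(ltW q0) ?(ltW kap0)//.
    by rewrite /g lerDr fine_ge0// Lip_upper_ge0.
  have AK : 0 <= A0 * s `^ q by rewrite mulr_ge0 ?powR_ge0.
  apply: (@le_trans _ _ ((L * s) `^ q * bm y s)%:E); last first.
    rewrite lee_fin; apply: le_trans (ler_wpM2l AK h).
    rewrite /A0 mulrA ler_wpM2r ?(ltW (bm_gt0 mm y s0))//.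
    rewrite mulrAC -powRM ?divr_ge0 ?(ltW kap0) ?(ltW L0)//.
    by rewrite divfK ?gt_eqF// powRM ?(ltW L0) ?(ltW s0).
  rewrite EFinM -mu_ballE// -[leRHS](integral_cst m (measurable_ball_cara mm y s)).
  apply: integral_le_nonmeasurable => // x /ballP yx; rewrite /= lee_fin ?powR_ge0//.
  apply: powR_le; rewrite ?(ltW q0)//.
  have := uLip x y; rewrite (uE Ey) subr0 ger0_norm// => /le_trans; apply.
  by rewrite ler_wpM2l ?(ltW L0)// metric_sym ltW.
pose A i := A0 / 2 ^+ i + 2 * B.
have Age0 i : 0 <= A i by rewrite addr_ge0 ?divr_ge0 ?exprn_ge0// mulr_ge0.
have claim i : forall y (s : R), E y -> 0 < s ->
    (\int[m]_(x in ball y s) (u x `^ q)%:E <=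
      (A i * s `^ q * energy mu q g y (tau * s))%:E)%E.
  elim: i => [|i IH] y s Ey s0.
    apply: (le_trans (start y s Ey s0)); rewrite lee_fin.
    rewrite ler_wpM2r ?energy_ge0// ler_wpM2r ?powR_ge0//.
    by rewrite /A expr0 divr1 lerDl mulr_ge0.
  apply: (le_trans (energy_improvement mm dbl CD1 CP0 tau1 q1 (Age0 i) PIq uL uE u0 mg
    gbd lipg IH qp taun c00 fat PIp Ey s0 T1 k0)).
  rewrite lee_fin ler_wpM2r ?energy_ge0// ler_wpM2r ?powR_ge0//.
  apply: (le_trans (contracts (Age0 i))).
  rewrite le_eqVlt; apply/orP; left; apply/eqP; rewrite /A exprS; field.
  by rewrite expf_neq0.
rewrite nuE ?mulr_gt0// -EFinM.
apply: (le_trans (claim (Num.truncn A0).+1 w r Ew r0)); rewrite lee_fin.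
rewrite ler_wpM2r ?energy_ge0// ler_wpM2r ?powR_ge0// /A addrC lerD2l.
rewrite ler_pdivrMr ?exprn_gt0// mul1r (le_trans (ltW (truncnS_gt A0)))//.
by rewrite -natrX ler_nat ltnW// ltn_expl.
Qed.

(** Let kappa tend to 0 in the regularized inequality. *)
Lemma nonnegative_hardy (w : X) (r : R) : E w -> 0 < r ->
  (\int[m]_(x in ball w r) (u x `^ q)%:E <=
    ((2 * B + 1) * 2 `^ q * r `^ q)%:E *
      \int[m]_(x in ball w (tau * r)) (Lip_upper u x `^ q))%E.
Proof.
move=> Ew r0; have tau0 : 0 < tau by exact: lt_le_trans tau1.
have tr0 : 0 < tau * r by exact: mulr_gt0.
have mB := measurable_ball_cara mm w (tau * r).
have [L L0 uLip] := Lipschitz_ge0 uL.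
have lip_le x : fine (Lip_upper u x) <= L.
  rewrite -lee_fin (fineK (Lip_upper_fin x uL)).
  by apply: Lip_upper_Lip => //; exact: ltW.
have lip0 x : 0 <= fine (Lip_upper u x) by rewrite fine_ge0 ?Lip_upper_ge0.
have Jfin : (\int[m]_(x in ball w (tau * r)) (fine (Lip_upper u x) `^ q)%:E)%E
    \is a fin_num.
  apply: (@bounded_integral_fin _ _ _ mm _ (L `^ q)) => // [|x _].
    exact: powR_ge0.
  by rewrite powR_ge0/=; apply: powR_le; rewrite ?(ltW q0).
have -> : (\int[m]_(x in ball w (tau * r)) (Lip_upper u x `^ q) =
    \int[m]_(x in ball w (tau * r)) (fine (Lip_upper u x) `^ q)%:E)%E.
  by apply: eq_integral => x _; rewrite -poweR_EFin (fineK (Lip_upper_fin x uL)).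
set J := (\int[m]_(x in _) (fine _ `^ q)%:E)%E in Jfin *.
pose K := (2 * B + 1) * 2 `^ q * r `^ q.
have K0 : 0 <= K.
  by rewrite mulr_ge0 ?powR_ge0// mulr_ge0 ?powR_ge0// addr_ge0// mulr_ge0.
pose b := bm w (tau * r); have b0 : 0 < b by exact: bm_gt0.
rewrite -/K -(fineK Jfin) -EFinM; apply/lee_addgt0Pr => e e0.
have Kb0 : 0 < K * b + 1 by rewrite ltr_wpDl// mulr_ge0// ltW.
pose kappa := Num.min 1 (e / (K * b + 1)).
have kap0 : 0 < kappa by rewrite lt_min ltr01 divr_gt0.
apply: (le_trans (regularized_hardy kap0 Ew r0)).
have b1 : integral_bound m (ball w (tau * r))
    (fun x => fine (Lip_upper u x) `^ q) (fine J).
  split; last by rewrite fineK.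
  - apply: (measurableT_comp (measurable_powR q)); apply: measurableT_comp => //.
    by have [] := Lip_upper_weak_upper_gradient mm q0 uL.
  - by move=> x; exact: powR_ge0.
have b2 : integral_bound m (ball w (tau * r)) (cst (kappa `^ q)) (kappa `^ q * b).
  split => //; first by move=> x; exact: powR_ge0.
  by rewrite EFinM -mu_ballE// -[leRHS](integral_cst m mB).
have [_ _ b3] := integral_boundZ mB (powR_ge0 2 q) (integral_boundD mB b1 b2).
have R0 : 0 <= (2 * B + 1) * r `^ q by rewrite mulr_ge0 ?powR_ge0// addr_ge0// mulr_ge0.
apply: (@le_trans _ _ (((2 * B + 1) * r `^ q)%:E *
    (2 `^ q * (fine J + kappa `^ q * b))%:E)%E).
  apply: lee_wpmul2l; first by rewrite lee_fin.
  apply: le_trans b3; apply: integral_le_nonmeasurable => // x _.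
  - by rewrite lee_fin powR_ge0.
  - by rewrite lee_fin mulr_ge0 ?addr_ge0 ?powR_ge0.
  by rewrite lee_fin; exact: powRD_le (ltW q0) (lip0 x) (ltW kap0).
rewrite -EFinM -EFinD lee_fin [leLHS](_ : _ = K * fine J + K * b * kappa `^ q); last first.
  by rewrite /K; ring.
rewrite lerD2l; have Kb : 0 <= K * b by rewrite mulr_ge0// ltW.
have kq : kappa `^ q <= e / (K * b + 1).
  apply: (@le_trans _ _ kappa); last by rewrite ge_min lexx orbT.
  by rewrite ge1r_powR// kap0 ge_min lexx.
apply: (le_trans (ler_wpM2l Kb kq)).
by rewrite mulrCA ger_pMr// ler_pdivrMr// mul1r lerDl.
Qed.

End iteration.

End hardy_inequality.
Local Open Scope ereal_scope.

Theorem theorem3p1 (R : realType) (p p0 CD CP tau c0 : R)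
    (hp0 : (1 < p0)%R) (hp0p : (p0 < p)%R)
    (hCD : (1 <= CD)%R) (hCP : (0 < CP)%R) (htau : (1 <= tau)%R)
    (hc0 : (0 < c0 <= 1)%R) :
  exists eps C : R, [/\ (0 < eps < p - p0)%R, (0 < C)%R &
    forall (X : pmetricType R) (mu : {outer_measure set X -> \bar R}),
      metric_measure mu ->
      doubling mu CD ->
      (forall q : R, (p0 <= q <= p)%R -> poincare mu q CP tau) ->
      forall E : set X, uniformly_fat mu p c0 E ->
      forall (w : X) (rho : R) (u : X -> R),
        E w -> (0 < rho)%R -> Lip0 (~` E) u ->
        \int[cara_measure mu]_(x in ball w rho) (`|u x| `^ (p - eps))%:E <=
          (C * rho `^ (p - eps))%:E *
          \int[cara_measure mu]_(x in ball w (tau * rho)%R)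
            (Lip_upper u x `^ (p - eps))].
Proof.
have [n taun] : exists n, (5 * tau <= 2 ^+ n)%R.
  exists (Num.truncn (5 * tau)).+1; rewrite (le_trans (ltW (truncnS_gt _)))//.
  by rewrite -natrX ler_nat ltnW// ltn_expl.
case/andP: hc0 => c00 _.
have [eps [T [k [B [/andP[eps0 epsp] T1 k0 B0 contracts]]]]] :=
  improved_const_contracts hp0 hp0p hCD hCP c00 n.
have q1 : (1 <= p - eps)%R by move: hp0 epsp; lra.
have q0 : (0 < p - eps)%R by exact: lt_le_trans q1.
have qp : (p - eps <= p)%R by rewrite gerBl ltW.
exists eps, ((2 * B + 1) * 2 `^ (p - eps))%R; split.
- by rewrite eps0.
- by rewrite mulr_gt0 ?powR_gt0// ltr_wpDl// mulr_ge0.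
move=> X mu mm dbl PI E fat w rho u Ew rho0 [uL uE].
have PIq : poincare mu (p - eps) CP tau.
  by apply: PI; rewrite qp andbT; move: epsp; lra.
have PIp : poincare mu p CP tau by apply: PI; rewrite lexx andbT ltW.
pose v x := `|u x|%R.
have vL : Lipschitz v.
  have [L uLip] := uL; exists L => x y; apply: le_trans (uLip x y).
  exact: ler_dist_dist.
have vE x : E x -> v x = 0%R by move=> Ex; rewrite /v uE ?normr0// => /(_ Ex).
have v0 x : (0 <= v x)%R by exact: normr_ge0.
apply: (le_trans (nonnegative_hardy hCD hCP htau c00 mm dbl q1 qp PIq PIp fat
  taun T1 k0 B0 contracts vL vE v0 Ew rho0)).
apply: lee_wpmul2l.
  by rewrite lee_fin mulr_ge0 ?powR_ge0// mulr_ge0 ?powR_ge0// addr_ge0// mulr_ge0.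
apply: integral_le_nonmeasurable => // x _; first exact: poweR_ge0.
  exact: poweR_ge0.
rewrite -(fineK (Lip_upper_fin x vL)) -(fineK (Lip_upper_fin x uL)).
rewrite !poweR_EFin lee_fin; apply: powR_le; rewrite ?(ltW q0) ?fine_ge0//.
  exact: Lip_upper_ge0.
rewrite -lee_fin !fineK ?Lip_upper_fin//.
have uF : Lip_upper u x <= (fine (Lip_upper u x))%:E.
  by rewrite fineK ?Lip_upper_fin.
have := Lip_upper_dominated ler01 (lexx 0%R) (lexx 0%R) uF uF (f := v).
rewrite mul0r !addr0 mul1r fineK ?Lip_upper_fin//; apply=> y.
by rewrite !mul0r !addr0 mul1r; exact: ler_dist_dist.
Qed.
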